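(* Let $h\in\mathcal F$ be a nonconstant harmonic function with $\partial_nh(q_0)\ne0$. Let $\Phi=\sum_w\Phi_w\,\star_{\partial h}\partial^{(|w|+1)}\psi_w\in\ker\partial^\perp$ be such that $\Phi_w\neq0$ if and only if $w=0^k$ for some $k\in\mathbb N_0$, and $\Phi_{0^k}=a\phi^k$ for all $k\in\mathbb N_0$, where $a>0$ and $\phi\in(-\sqrt{3/5},\sqrt{3/5})$. Then $$\lim_{n\to\infty}\frac{\vec n\cdot(\Phi\,\partial h)(F_{0^n}q_1)}{\vec n\cdot\partial h(F_{0^n}q_1)}=\begin{cases}\text{divergent}&\text{if }-\sqrt{3/5}<\phi\le-3/5,\\ 0&\text{if }|\phi|<3/5,\\ -15\,\frac{a}{\partial_nh(q_0)}&\text{if }\phi=3/5,\\ -\operatorname{sgn}\big(\frac{a}{\partial_nh(q_0)}\big)\cdot\infty&\text{if }3/5<\phi<\sqrt{3/5},\end{cases}$$ and $$\lim_{n\to\infty}\frac{\vec n\cdot(\Phi\,\partial h)(F_{0^n}q_2)}{\vec n\cdot\partial h(F_{0^n}q_2)}=\begin{cases}\text{divergent}&\text{if }-\sqrt{3/5}<\phi\le-3/5,\\ 0&\text{if }|\phi|<3/5,\\ 15\,\frac{a}{\partial_nh(q_0)}&\text{if }\phi=3/5,\\ \operatorname{sgn}\big(\frac{a}{\partial_nh(q_0)}\big)\cdot\infty&\text{if }3/5<\phi<\sqrt{3/5},\end{cases}$$ where ''divergent'' means that the limit does not exist in $[-\infty,\infty]$ and all normal parts are taken from the cell $K_{0^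n}$.
   Context: Gasket. Let $r=3/5$, $q_0=(1/2,\sqrt3/2)$, $q_1=(0,0)$, $q_2=(1,0)$, $F_i(x)=\frac12(x-q_i)+q_i$, and let $K\subset\mathbb R^2$ be the Sierpinski gasket (attractor of $F_0,F_1,F_2$). For a word $w=w_1\cdots w_n$ over $\{0,1,2\}$ (length $|w|=n$, empty word allowed with $F_\emptyset=\mathrm{Id}$) put $F_w=F_{w_1}\circ\dots\circ F_{w_n}$, $K_w=F_w(K)$; $i^m$ is the word consisting of $m$ letters $i$; indices are mod 3. $V_0=\{q_0,q_1,q_2\}$, $V_n=\bigcup_{|w|=n}F_w(V_0)$. Write $p\sim_nq$ if $p\ne q$ in $V_n$ lie in a common $K_w$, $|w|=n$. $\mathcal E(u,v)=\lim_m r^{-m}\sum_{p\sim_mq}(u(p)-u(q))(v(p)-v(q))$ (each edge once), $\mathcal F$ is the set of continuous $u:K\to\mathbb R$ for which these sums with $v=u$ are bounded in $m$, $\mathcal F_{V_0}=\{u\in\mathcal F: u|_{V_0}=0\}$. $h\in\mathcal F$ is harmonic if $\mathcal E(h,\varphi)=0$ for all $\varphi\in\mathcal F_{V_0}$. $\partial_nu(q_i)=\lim_nr^{-n}(2u(q_i)-u(F_{i^n}q_{i+1})-u(F_{i^n}q_{i+2}))$ and, from the cell $K_w$, $\partial_nu(F_wq_i)=r^{-|w|}\partial_n(u\circ F_w)(q_i)$. The energy measure $\nu_{u,v}$ is the unique finite signed Borel measure with $\nu_{u,v}(K_w)=r^{-|w|}\mathcal E(u\circ F_w,v\circ F_w)$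 for all $w$; $\nu_h=\nu_{h,h}$ (non-atomic). One-forms. $\mathcal H$ is the Hilbert space obtained from finite sums of symbols $f\partial u$ ($f\in C(K)$, $u\in\mathcal F$) by quotienting and completing with respect to the bilinear extension of $\langle f\partial u,g\partial v\rangle_{\mathcal H}=\int_Kfg\,d\nu_{u,v}$; bounded Borel functions act on $\mathcal H$ by multiplication; $\partial:\mathcal F\to\mathcal H$, $\partial u=1\,\partial u$. $\ker\partial^\ast=\{\omega:\langle\omega,\partial u\rangle_{\mathcal H}=0\ \forall u\in\mathcal F\}$. Hodge decomposition: $\mathcal H=\operatorname{Im}\partial\oplus\ker\partial^\ast$ (orthogonal). Loops. $P_n\mathcal F$ ($n\ge0$) is the set of families $u=\{u^{(w)}\}_{|w|=n}$, $u^{(w)}:K_w\to\mathbb R$ with $u^{(w)}\circ F_w\in\mathcal F$, and $\partial^{(n)}u=\sum_{|w|=n}\mathds 1_{K_w}\partial\tilde u^{(w)}$ with any extension $\tilde u^{(w)}\in\mathcal F$ of $u^{(w)}$; for $n\le0$, $P_n\mathcal F=\mathcal F$ and $\partial^{(n)}=\partial$. Let $\psi\in P_1\mathcal F$ have representatives $\psi^{(i)}$ on $K_i$ with $\psi^{(i)}\circ F_i$ harmonic, $\psi^{(i)}(q_i)=0$, $\psi^{(i)}(F_iq_{i+1})=1$, $\psi^{(i)}(F_iq_{i+2})=-1$. For a word $w$, $\psi_w\in P_{|w|+1}\mathcal F$ equals $\psi^{(i)}\circ F_w^{-1}$ on $K_{wi}$ and $0$ on all other cells of level $|w|+1$. The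 family $\{\partial^{(|w|+1)}\psi_w\}_w$ is an orthogonal basis of $\ker\partial^\ast$ with $\|\partial^{(|w|+1)}\psi_w\|_{\mathcal H}^2=30(5/3)^{|w|}$. Composition with $F_w$. For $\omega=\partial\eta+\Theta$ (Hodge decomposition), $\Theta=\sum_{w'}\Theta_{w'}\partial^{(|w'|+1)}\psi_{w'}$, put $\omega\circ F_w:=\partial(\eta\circ F_w)+\sum_{w'}\Theta_{w'}\partial^{(|w'|-|w|+1)}(\psi_{w'}\circ F_w)\in\mathcal H$. Normal parts. For a finite non-atomic Borel measure $\nu$ with full support, $D_\nu(\partial^\ast_{V_0})$ is the set of $\omega\in\mathcal H$ for which there is $g=:\partial^\ast_{V_0}\omega\in L^2(K,\nu)$ with $\langle\omega,\partial u\rangle_{\mathcal H}=(g,u)_{L^2(K,\nu)}$ for all $u\in\mathcal F_{V_0}$. For such $\omega$ and $q\in V_0$: $n_{V_0}\omega(q)=\langle\omega,\partial h_q\rangle_{\mathcal H}-\int_K(\partial^\ast_{V_0}\omega)h_q\,d\nu$, $h_q$ harmonic with $h_q(q)=1$, $h_q=0$ on $V_0\setminus\{q\}$; from the cell $K_w$: $\vec n\cdot\omega(F_wq):=r^{-|w|}n_{V_0}(\omega\circ F_w)(q)$ (with $\nu$ replaced by $A\mapsto\nu(F_wA)$). For $h$ harmonic, $\vec n\cdot\partial h=\partial_nh$. Hodge star. For nonconstant harmonic $h$, $f\mapsto f\partial h$ is an isometric isomorphism $L^2(K,\nu_h)\to\mathcal H$ (as $\partial h$ is minimal energy-dominant);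 $\star_{\partial h}:\mathcal H\to L^2(K,\nu_h)$ denotes its inverse. $\ker\partial^\perp=\{f\in L^2(K,\nu_h): f\partial h\in\ker\partial^\ast\}$. *)

(* Defs.v *)
From HB Require Import structures.
From mathcomp Require Import all_boot all_order all_algebra finmap.
From mathcomp Require Import all_classical all_reals all_analysis.
From mathcomp.analysis Require showcase.summability.

Set Implicit Arguments.
Unset Strict Implicit.
Unset Printing Implicit Defensive.

Import Order.TTheory GRing.Theory Num.Theory.
Import numFieldNormedType.Exports.

Local Open Scope classical_set_scope.
Local Open Scope ring_scope.

(* Functions on the gasket K (`gasket`) are represented by functions on the ambient plane
   R * R, and Borel measures on K by Borel measures on R * R carried by K; only
   the restriction of a function to K is ever used. *)

Section Gasket.
Variable R : realType.
Local Notation T := (R * R)%type.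
Local Notation word := (seq 'I_3).

Definition qpt (i : 'I_3) : T :=
  match val i with
  | 0%N => (2^-1, Num.sqrt 3 / 2)
  | 1%N => (0, 0)
  | _ => (1, 0)
  end.

Definition Fmap (i : 'I_3) (x : T) : T := 2^-1 *: (x - qpt i) + qpt i.
Definition Fmapinv (i : 'I_3) (x : T) : T := 2 *: (x - qpt i) + qpt i.

Definition Fw (w : word) : T -> T := foldr (fun i g => Fmap i \o g) id w.
Definition Fwinv (w : word) : T -> T := foldr (fun i g => g \o Fmapinv i) id w.

Definition attractor (A : set T) :=
  [/\ compact A, A !=set0 & A = \bigcup_(i in [set: 'I_3]) (Fmap i @` A)].

Definition gasket : set T := get attractor.

Definition cell (w : word) : set T := Fw w @` gasket.

Definition Vset0 : set T := range qpt.
Definition Vset (n : nat) : set T := \bigcup_(w in [set w | size w = n]) (Fw w @` Vset0).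

Definition level_adj (n : nat) (p q : T) :=
  [/\ Vset n p, Vset n q, p <> q
    & exists w, [/\ size w = n, cell w p & cell w q]].

Definition rfac : R := 3 / 5.

(* The sum runs over ordered pairs, hence the factor 1/2. *)
Definition energy_sum (m : nat) (u v : T -> R) : R :=
  2^-1 * \sum_(e \in [set e : T * T | level_adj m e.1 e.2])
           ((u e.1 - u e.2) * (v e.1 - v e.2)).

Definition energy (u v : T -> R) : R :=
  limn (fun m => rfac ^- m * energy_sum m u v).

Definition CK (u : T -> R) := {within gasket, continuous u}.

Definition FF (u : T -> R) :=
  CK u /\ exists M, forall m, rfac ^- m * energy_sum m u u <= M.

Definition FV0 (u : T -> R) := FF u /\ forall i, u (qpt i) = 0.

Definition is_harmonic (h : T -> R) :=
  FF h /\ forall phi, FV0 phi -> energy h phi = 0.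

Definition normal_derivative (u : T -> R) (i : 'I_3) : R :=
  limn (fun n => rfac ^- n * (2 * u (qpt i)
                           - u (Fw (nseq n i) (qpt (i + 1)))
                           - u (Fw (nseq n i) (qpt (i + 2))))).

Local Notation signed := (charge T R).

Definition energy_measure (m : signed) (u v : T -> R) :=
  (forall A, measurable A -> A `&` gasket = set0 -> m A = 0%E) /\
  (forall w, m (cell w) = (rfac ^- size w * energy (u \o Fw w) (v \o Fw w))%:E).

Definition energy_measures (nu : (T -> R) -> (T -> R) -> signed) :=
  forall u v, FF u -> FF v -> energy_measure (nu u v) u v.

Definition hahnP (m : signed) := cid (Hahn_decomposition m).
Definition hahnPN (m : signed) := cid (svalP (hahnP m)).

Definition charge_integral (m : signed) (f : T -> R) : R :=
  \int[jordan_pos (svalP (hahnPN m))]_(x in gasket) f x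
  - \int[jordan_neg (svalP (hahnPN m))]_(x in gasket) f x.

Definition L2norm_sq (mu : set T -> \bar R) (f : T -> R) : \bar R :=
  (\int[mu]_(x in gasket) ((f x) ^+ 2)%:E)%E.

Definition L2 (mu : set T -> \bar R) (f : T -> R) :=
  measurable_fun gasket f /\ (L2norm_sq mu f < +oo)%E.

Definition bounded_borel (b : T -> R) :=
  measurable_fun gasket b /\ exists M, forall x, gasket x -> `|b x| <= M.

Definition usum (E : normedModType R) (x : word -> E) (s : E) :=
  (\sum_(w <- A) x w) @[A --> summability.totally] --> s.

(* The Hilbert space of one-forms: a completion of the span of the symbols
   f ∂u, together with the action of bounded Borel functions. *)
Record one_forms (nu : (T -> R) -> (T -> R) -> signed) := OneForms {
  oneform : completeNormedModType R ;
  form_ip : oneform -> oneform -> R ;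
  form_ipC : forall x y, form_ip x y = form_ip y x ;
  form_ipP : forall a x y z, form_ip (a *: x + y) z = a * form_ip x z + form_ip y z ;
  form_ip_norm : forall x, form_ip x x = `|x| ^+ 2 ;
  form_symb : (T -> R) -> (T -> R) -> oneform ;
  form_ip_symb : forall f g u v, CK f -> CK g -> FF u -> FF v ->
    form_ip (form_symb f u) (form_symb g v) = charge_integral (nu u v) (f \* g) ;
  form_symb_dense : dense [set x | exists2 s : seq ((T -> R) * (T -> R)),
    (forall fu, fu \in s -> CK fu.1 /\ FF fu.2)
    & x = \sum_(fu <- s) form_symb fu.1 fu.2] ;
  form_act : (T -> R) -> oneform -> oneform ;
  form_act_linear : forall b a x y, bounded_borel b ->
    form_act b (a *: x + y) = a *: form_act b x + form_act b y ;
  form_act_bounded : forall (b : T -> R) (M : R) (x : oneform), measurable_fun gasket b ->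
    (forall t, gasket t -> `|b t| <= M) -> `|form_act b x| <= M * `|x| ;
  form_act_symb : forall b f g u v, bounded_borel b -> CK f -> CK g -> FF u -> FF v ->
    form_ip (form_act b (form_symb f u)) (form_symb g v) = charge_integral (nu u v) (b \* f \* g)
}.

(* psi_cell i represents ψ^(i) on the cell F_i(K) *)
Definition psi_cell (i : 'I_3) : T -> R :=
  get [set u : T -> R | [/\ is_harmonic (u \o Fmap i), u (qpt i) = 0,
        u (Fmap i (qpt (i + 1))) = 1 & u (Fmap i (qpt (i + 2))) = -1]].

(* An element of P_n F is given by its values on the words of length n *)
Definition psi_word (w : word) : word -> T -> R :=
  fun v => if [pick i : 'I_3 | v == rcons w i] is Some i
           then psi_cell i \o Fwinv w else cst 0.

(* u ∘ F_w for u in P_n F, as an element of P_(n - |w|) F. When n <= |w| the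
   cell K_w lies in the cell of the prefix of w of length n, and u ∘ F_w is the
   single function indexed by the empty word. *)
Definition family_comp (n : nat) (u : word -> T -> R) (w : word) : word -> T -> R :=
  fun v => u (take n (w ++ v)) \o Fw w.

Definition extension (w : word) (f : T -> R) : T -> R :=
  get [set v : T -> R | FF v /\ forall x, cell w x -> v x = f x].

Definition harm_q (i : 'I_3) : T -> R :=
  get [set u : T -> R | is_harmonic u /\ forall j, u (qpt j) = (j == i)%:R].

Section OneForms.
Variable nu : (T -> R) -> (T -> R) -> signed.
Variable H : one_forms nu.

Definition dform (u : T -> R) : oneform H := form_symb H (cst 1) u.

Definition ker_dstar (x : oneform H) := forall u, FF u -> form_ip x (dform u) = 0.

(* For n = 0 this is ∂ itself, so that truncated subtraction on the level agrees
   with the convention that ∂^(n) = ∂ for n <= 0. *)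
Definition dform_n (n : nat) (u : word -> T -> R) : oneform H :=
  \sum_(w : n.-tuple 'I_3) form_act (\1_(cell w)) (dform (extension w (u w))).

Definition dpsi (w : word) : oneform H := dform_n (size w).+1 (psi_word w).

Definition is_comp (x : oneform H) (w : word) (y : oneform H) :=
  exists (eta : T -> R) (Theta : oneform H) (c : word -> R) (Theta' : oneform H),
    [/\ FF eta /\ ker_dstar Theta,
        usum (fun w' => c w' *: dpsi w') Theta,
        x = dform eta + Theta,
        usum (fun w' => c w' *: dform_n ((size w').+1 - size w)
                                   (family_comp (size w').+1 (psi_word w') w)) Theta'
      & y = dform (eta \o Fw w) + Theta'].

Definition form_comp (x : oneform H) (w : word) : oneform H := get (is_comp x w).

Definition is_dstar (mu : set T -> \bar R) (x : oneform H) (g : T -> R) :=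
  L2 mu g /\ forall u, FV0 u ->
    form_ip x (dform u) = fine (\int[mu]_(t in gasket) (g t * u t)%:E)%E.

Definition dom_dstar (mu : set T -> \bar R) (x : oneform H) := exists g, is_dstar mu x g.

Definition dstar (mu : set T -> \bar R) (x : oneform H) : T -> R := get (is_dstar mu x).

Definition normal_part_V0 (mu : set T -> \bar R) (x : oneform H) (i : 'I_3) : R :=
  form_ip x (dform (harm_q i)) - fine (\int[mu]_(t in gasket) (dstar mu x t * harm_q i t)%:E)%E.

Definition pullback (mu : set T -> \bar R) (w : word) : set T -> \bar R :=
  fun A => mu (Fw w @` A).

Definition has_normal_part (mu : set T -> \bar R) (x : oneform H) (w : word) :=
  dom_dstar (pullback mu w) (form_comp x w).

(* The normal part of x at F_w q_i, from the cell K_w *)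
Definition normal_part (mu : set T -> \bar R) (x : oneform H) (w : word) (i : 'I_3) : R :=
  rfac ^- size w * normal_part_V0 (pullback mu w) (form_comp x w) i.

(* ν_(u,u) is nonnegative, hence equal to its total variation, which the library
   equips with a measure structure. *)
Definition emeas (u : T -> R) : {measure set T -> \bar R} :=
  charge_variation (svalP (hahnPN (nu u u))).

(* y = f ∂u for f in L^2(K, ν_u), by isometric extension from f in C(K) *)
Definition is_L2mul (f u : T -> R) (y : oneform H) :=
  L2 (emeas u) f /\ exists g : nat -> T -> R,
    [/\ forall n, CK (g n),
        L2norm_sq (emeas u) (f \- g n) @[n --> \oo] --> 0%E
      & form_symb H (g n) u @[n --> \oo] --> y].

Definition L2mul (f u : T -> R) : oneform H := get (is_L2mul f u).

(* star is the inverse of f |-> f ∂h from L^2(K, ν_h), functions being taken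
   modulo equality almost everywhere, to the space of one-forms *)
Definition hodge_star (h : T -> R) (star : oneform H -> T -> R) :=
  (forall y, is_L2mul (star y) h y) /\
  (forall f y, is_L2mul f h y -> L2norm_sq (emeas h) (f \- star y) = 0%E).

Definition ker_d_perp (h f : T -> R) :=
  L2 (emeas h) f /\ ker_dstar (L2mul f h).

Definition usumL2 (h : T -> R) (x : word -> T -> R) (f : T -> R) :=
  L2norm_sq (emeas h) (fun t => f t - \sum_(w <- A) x w t)
    @[A --> summability.totally] --> 0%E.

End OneForms.

Definition measure_on_K (mu : {finite_measure set T -> \bar R}) :=
  forall A, measurable A -> A `&` gasket = set0 -> mu A = 0%E.

Definition nonatomic (mu : {finite_measure set T -> \bar R}) :=
  forall x : T, mu [set x] = 0%E.

Definition full_support (mu : {finite_measure set T -> \bar R}) :=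
  forall U : set T, open U -> U `&` gasket !=set0 -> (0 < mu U)%E.

Definition nonconstant (h : T -> R) :=
  exists x y, [/\ gasket x, gasket y & h x <> h y].

End Gasket.

(* Main.v *)
(* Harmonic functions are the extensions of their boundary values by the 1/5-2/5 rule, so
   E(h, u) only depends on the values of h and u on V_0. Those with values (0, 1, 1) and
   (0, 1, -1) on V_0 are eigenvectors of u |-> u o F_0 for 3/5 and 1/5. Since psi_w o F_{0^n}
   is psi_w' for w = 0^n w', and 5^(k+1-n) times the antisymmetric eigenvector for w = 0^k
   with k < n, the composition of Phi dh with F_{0^n} is an exact harmonic form plus an
   element of ker d^*, which does not contribute to normal parts. This makes the normal part
   at F_{0^n} q_1 equal to 3 a (5/3)^n sum_{k<n} phi^k 5^(k+1-n), and the opposite at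
   F_{0^n} q_2, while that of dh tends to -d_n h(q_0) / 2 at both points. *)
Require Import Defs.
From HB Require Import structures.
From mathcomp Require Import all_boot all_order all_algebra finmap.
From mathcomp Require Import all_classical all_reals all_analysis.
From mathcomp.analysis Require showcase.summability.
From mathcomp Require Import measurable_realfun.
From mathcomp Require Import ring lra.

Set Implicit Arguments.
Unset Strict Implicit.
Unset Printing Implicit Defensive.

Import Order.TTheory GRing.Theory Num.Theory.
Import numFieldNormedType.Exports.

Local Open Scope classical_set_scope.
Local Open Scope ring_scope.

(** * Geometry of the gasket *)

(** Many objects of the statement are choices by [get] ([gasket], [psi_cell], [extension], [harm_q],
    [form_comp], [dstar], [L2mul]), so each has to be shown to exist and to be determined as far as
    the argument needs. The one-forms are accessible only through inner products of symbols, and the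
    energy measures only through the masses of cells. Hence identities between forms are proved by
    showing that a difference has norm 0, and orthogonality of the loop forms requires that junction
    points carry no energy. The bound sqrt(3/5) on phi makes the series converge, since the loop
    form at 0^k has norm of order (5/3)^(k/2). The critical value 3/5 comes from the factor (5/3)^n
    of normal parts: the sum over k < n equals (phi^n - 5^(-n)) / (phi - 1/5), so for |phi| >= 3/5
    the ratio behaves like (5 phi / 3)^n. At phi = 3/5 the normal part at F_{0^n} q_1 tends to 3 a /
    (2/5), and dividing by -d_n h(q_0) / 2 gives the constant -15. *)

Lemma I3_ind (P : 'I_3 -> Prop) : P 0 -> P 1 -> P 2 -> forall i, P i.
Proof.
move=> P0 P1 P2 [[|[|[|//]]] hi].
- by rewrite (_ : Ordinal hi = 0) //; exact: val_inj.
- by rewrite (_ : Ordinal hi = 1) //; exact: val_inj.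
- by rewrite (_ : Ordinal hi = 2) //; exact: val_inj.
Qed.

Lemma big_I3 (V : nmodType) (f : 'I_3 -> V) : \sum_i f i = f 0 + f 1 + f 2.
Proof.
rewrite !big_ord_recl big_ord0 addr0 addrA.
by congr (f _ + f _ + f _); exact: val_inj.
Qed.

Section Geometry.
Variable R : realType.
Local Notation T := (R * R)%type.
Local Notation word := (seq 'I_3).
Implicit Types (x y p : T) (i j k : 'I_3) (w v : word).

Let s3 : R := Num.sqrt 3.
Let s3_gt0 : 0 < s3. Proof. by rewrite sqrtr_gt0. Qed.
Let s3_neq0 : s3 != 0. Proof. by rewrite gt_eqF. Qed.

(** In these barycentric coordinates with respect to q_0, q_1, q_2 the map [Fmap j] halves every
    coordinate and adds 1/2 to coordinate j, so sqrt 3 disappears from nearly all later geometry. *)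
Definition bary (i : 'I_3) (x : T) : R :=
  match val i with
  | 0%N => 2 * x.2 / Num.sqrt 3
  | 1%N => 1 - x.1 - x.2 / Num.sqrt 3
  | _ => x.1 - x.2 / Num.sqrt 3
  end.

Lemma bary_sum x : bary 0 x + bary 1 x + bary 2 x = 1.
Proof. by rewrite /bary /=; field. Qed.

Lemma bary_inj x y : (forall i, bary i x = bary i y) -> x = y.
Proof.
move=> e; have := e 0; have := e 2; rewrite /bary /= -/s3 => e2 e0.
have yE : x.2 = y.2.
  have := congr1 ( *%R^~ s3) e0; rewrite !divfK // => /mulfI -> //.
by case: x y yE e2 {e e0} => x1 x2 [y1 y2] /= -> /addIr ->.
Qed.

Lemma bary_qpt i j : bary i (qpt R j) = (i == j)%:R.
Proof.
by elim/I3_ind: i; elim/I3_ind: j; rewrite /bary /qpt /= -/s3; field.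
Qed.

Lemma bary_Fmap i j x : bary i (Fmap j x) = (bary i x + (i == j)%:R) / 2.
Proof.
rewrite /Fmap; elim/I3_ind: i; elim/I3_ind: j;
  by rewrite /bary /= /qpt /= -/s3 /GRing.scale /=; field.
Qed.

Lemma bary_Fmapinv i j x : bary i (Fmapinv j x) = 2 * bary i x - (i == j)%:R.
Proof.
rewrite /Fmapinv; elim/I3_ind: i; elim/I3_ind: j;
  by rewrite /bary /= /qpt /= -/s3 /GRing.scale /=; field.
Qed.

Lemma FmapK i : cancel (@Fmap R i) (@Fmapinv R i).
Proof. by move=> x; apply: bary_inj => j; rewrite bary_Fmapinv bary_Fmap; field. Qed.

Lemma FmapinvK i : cancel (@Fmapinv R i) (@Fmap R i).
Proof. by move=> x; apply: bary_inj => j; rewrite bary_Fmap bary_Fmapinv; field. Qed.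

Lemma Fmap_inj i : injective (@Fmap R i).
Proof. exact: can_inj (FmapK i). Qed.

Lemma FwK w : cancel (@Fw R w) (@Fwinv R w).
Proof. by elim: w => //= i w IH x /=; rewrite FmapK IH. Qed.

Lemma FwinvK w : cancel (@Fwinv R w) (@Fw R w).
Proof. by elim: w => //= i w IH x /=; rewrite IH FmapinvK. Qed.

Lemma Fw_cat w v x : Fw (w ++ v) x = Fw w (Fw v x).
Proof. by elim: w => //= i w ->. Qed.

Lemma Fw_rcons w i x : Fw (rcons w i) x = Fw w (Fmap i x).
Proof. by rewrite -cats1 Fw_cat. Qed.

Lemma Fmap_fix i : Fmap i (qpt R i) = qpt R i.
Proof. by rewrite /Fmap subrr scaler0 add0r. Qed.

(** The common point is the midpoint of q_i and q_j, where the cells i and j touch; functions given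
    on the three cells are glued along it. *)
Lemma Fmap_swap i j : Fmap i (qpt R j) = Fmap j (qpt R i).
Proof. by apply: bary_inj => k; rewrite !bary_Fmap !bary_qpt addrC. Qed.

Lemma Fw_nseq_fix i n : Fw (nseq n i) (qpt R i) = qpt R i.
Proof. by elim: n => //= n ->; exact: Fmap_fix. Qed.

Lemma qpt_inj : injective (@qpt R).
Proof.
move=> i j e; have := bary_qpt i j; rewrite -e bary_qpt eqxx => /eqP.
by rewrite eqr_nat => h; apply/eqP; case: (i == j) h.
Qed.

Lemma continuous_bary i : continuous (bary i).
Proof.
elim/I3_ind: i => x; rewrite /bary /=.
- apply: cvgMl; apply: cvgMr; exact: cvg_snd.
- apply: cvgB; last by apply: cvgMl; exact: cvg_snd.
  by apply: cvgB; [exact: cvg_cst|exact: cvg_fst].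
- apply: cvgB; [exact: cvg_fst|by apply: cvgMl; exact: cvg_snd].
Qed.

Lemma continuous_Fmap i : continuous (@Fmap R i).
Proof.
move=> x; apply: (@cvgD _ T); last exact: cvg_cst.
apply: (@cvgZr _ T); apply: (@cvgB _ T); [exact: cvg_id|exact: cvg_cst].
Qed.

Lemma continuous_Fmapinv i : continuous (@Fmapinv R i).
Proof.
move=> x; apply: (@cvgD _ T); last exact: cvg_cst.
apply: (@cvgZr _ T); apply: (@cvgB _ T); [exact: cvg_id|exact: cvg_cst].
Qed.

Lemma continuous_Fw w : continuous (@Fw R w).
Proof.
elim: w => [|i w IH] x /=; first exact: cvg_id.
by apply: continuous_comp; [exact: IH|exact: continuous_Fmap].
Qed.

Lemma continuous_Fwinv w : continuous (@Fwinv R w).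
Proof.
elim: w => [|i w IH] x /=; first exact: cvg_id.
by apply: continuous_comp; [exact: continuous_Fmapinv|exact: IH].
Qed.

Definition triangle : set T := [set x | forall i, 0 <= bary i x].

Lemma triangle_le1 x i : triangle x -> bary i x <= 1.
Proof.
move=> tx; have := bary_sum x; have := tx 0; have := tx 1; have := tx 2.
by elim/I3_ind: i; lra.
Qed.

Lemma triangle_compact : compact triangle.
Proof.
have cI := @segment_compact R 0 1.
apply: (subclosed_compact _ (compact_setX cI cI)).
- have -> : triangle = \bigcap_(i in [set: 'I_3]) (bary i @^-1` [set r | 0 <= r]).
    by apply/seteqP; split => x h i; [move=> _; exact: h|exact: (h i I)].
  apply: closed_bigI => i _; apply: closed_comp; last exact: closed_ge.
  by move=> x _; exact: continuous_bary.
- move=> x tx; have := bary_sum x; have := tx 0; have := tx 1; have := tx 2.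
  have e1 : x.1 = bary 2 x + bary 0 x / 2 by rewrite /bary /=; field.
  have e2 : x.2 = bary 0 x * (s3 / 2) by rewrite /bary /= -/s3; field.
  move=> h2 h1 h0 hs; have := s3_gt0; have s3le : s3 / 2 <= 1.
    by rewrite ler_pdivrMr // mul1r -[leRHS]ger0_norm // -sqrtr_sqr ler_sqrt; lra.
  move=> s3p; split; rewrite /= in_itv /= ?e1 ?e2; first by apply/andP; split; lra.
  by apply/andP; split; [rewrite mulr_ge0 // divr_ge0 // ltW|apply: mulr_ile1; lra].
Qed.

(** The iterates of the union map [S] on the triangle decrease, and their intersection is an
    attractor. As [gasket] is a choice among attractors, all later facts are drawn from the three
    attractor properties. *)
Lemma attractor_exists : exists A : set T, attractor A.
Proof.
pose S (A : set T) : set T := \bigcup_(i in [set: 'I_3]) (Fmap i @` A).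
pose Kn n := iter n S triangle.
have mono A B : A `<=` B -> S A `<=` S B.
  by move=> AB x [i _ [y Ay <-]]; exists i => //; exists y => //; exact: AB.
have St : S triangle `<=` triangle.
  move=> x [i _ [y ty <-]] j; rewrite bary_Fmap divr_ge0 // addr_ge0 //.
have decr n : Kn n.+1 `<=` Kn n by elim: n => // n IH; exact: mono.
have decrD n m : Kn (n + m)%N `<=` Kn n.
  by elim: m => [|m IH]; rewrite ?addn0 // addnS; exact: subset_trans (decr _) IH.
have cpt n : compact (Kn n).
  elim: n => [|n IH]; first exact: triangle_compact.
  have -> : Kn n.+1 = Fmap 0 @` Kn n `|` Fmap 1 @` Kn n `|` Fmap 2 @` Kn n.
    apply/seteqP; split => x.
      by move=> [+ _]; elim/I3_ind; [left; left|left; right|right].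
    by move=> [[]|] h; [exists 0|exists 1|exists 2].
  have ci i : compact (Fmap i @` Kn n).
    apply: continuous_compact => //; apply: continuous_subspaceT.
    exact: continuous_Fmap.
  by do 2 apply: compactU => //.
have hT : hausdorff_space T by exact: norm_hausdorff.
exists (\bigcap_n Kn n); split.
- apply: (subclosed_compact _ (cpt 0%N)); last by move=> x /(_ 0%N I).
  by apply: closed_bigI => n _; exact: compact_closed.
- exists (qpt R 0) => n _; elim: n => [|n IH]; first by move=> i; rewrite bary_qpt.
  by exists 0 => //; exists (qpt R 0) => //; exact: Fmap_fix.
- apply/seteqP; split => x; last first.
    move=> [i _ [y Ky <-]] n _; apply: decr; exists i => //; exists y => //.
    exact: Ky.
  move=> Kx; apply: contrapT => nx.
  (* [Fmapinv i x] is the only candidate preimage of x under [Fmap i]. It leaves the iterates at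
     some stage for each i, so x leaves them one stage after the sum of the three. *)
  have bad i : exists n, ~ Kn n (Fmapinv i x).
    apply: contrapT => h; apply: nx; exists i => //.
    exists (Fmapinv i x); last exact: FmapinvK.
    by move=> n _; apply: contrapT => h'; apply: h; exists n.
  have [[n0 h0] [n1 h1]] := (bad 0, bad 1); have [n2 h2] := bad 2.
  have [i _ [y Ky e]] := Kx (n0 + n1 + n2).+1 I.
  have yE : y = Fmapinv i x by rewrite -e FmapK.
  rewrite {}yE in Ky; move: i Ky {e}; elim/I3_ind => Ky.
  + by apply: h0; apply: (@decrD _ (n1 + n2)%N); rewrite addnA.
  + by apply: h1; apply: (@decrD _ (n0 + n2)%N); rewrite addnA (addnC n1).
  + by apply: h2; apply: (@decrD _ (n0 + n1)%N); rewrite addnC.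
Qed.

Local Notation K := (@gasket R).

Lemma gasketP : attractor K.
Proof. by have [A hA] := attractor_exists; exact: (getPex (ex_intro _ A hA)). Qed.

Lemma gasket_compact : compact K. Proof. by case: gasketP. Qed.

Lemma gasket_F : K = \bigcup_(i in [set: 'I_3]) (Fmap i @` K).
Proof. by case: gasketP. Qed.

Lemma gasket_Fmap i x : K x -> K (Fmap i x).
Proof. by move=> Kx; rewrite gasket_F; exists i => //; exists x. Qed.

Lemma gasket_Fw w x : K x -> K (Fw w x).
Proof. by move=> Kx; elim: w => //= i w IH; exact: gasket_Fmap. Qed.

Lemma gasketE x : K x -> exists i y, K y /\ x = Fmap i y.
Proof. by rewrite {1}gasket_F => -[i _ [y Ky <-]]; exists i, y. Qed.

Lemma gasket_closed : closed K.
Proof. by apply: compact_closed gasket_compact; exact: norm_hausdorff. Qed.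

(** At a minimum point [Fmap j y] of [bary i] the value is at least half of [bary i y], so the
    minimum is at least half of itself, hence nonnegative. *)
Lemma gasket_triangle : K `<=` triangle.
Proof.
have [_ K0 _] := gasketP => x Kx i.
have [p Kp pmin] := compact_EVT_min K0 gasket_compact
   (continuous_subspaceT (@continuous_bary i)).
move/set_mem in Kp.
have [j [y [Ky e]]] := gasketE Kp.
have := pmin _ (mem_set Ky); have := pmin _ (mem_set Kx); rewrite e bary_Fmap.
by case: (i == j) => /=; lra.
Qed.

Lemma triangle_bary1 i x : triangle x -> bary i x = 1 -> x = qpt R i.
Proof.
move=> tx lx; apply: bary_inj => k; rewrite bary_qpt.
have := bary_sum x; have := tx 0; have := tx 1; have := tx 2.
by move: i lx k; elim/I3_ind => lx; elim/I3_ind => /=; lra.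
Qed.

(** If [bary i] has maximum m at p, then [Fmap i p] has the value (m + 1) / 2 <= m, so m >= 1; the
    corner is the only point of the triangle where this happens. *)
Lemma gasket_qpt i : K (qpt R i).
Proof.
have [_ K0 _] := gasketP.
have [p Kp pmax] := compact_EVT_max K0 gasket_compact
   (continuous_subspaceT (@continuous_bary i)).
move/set_mem in Kp.
have := pmax _ (mem_set (gasket_Fmap i Kp)).
rewrite bary_Fmap eqxx /= => l1.
rewrite -(@triangle_bary1 i p) //; first exact: gasket_triangle.
by have := triangle_le1 i (gasket_triangle Kp); lra.
Qed.

Lemma Fmap_overlap i j y : triangle y -> i != j -> 2^-1 <= bary i (Fmap j y) ->
  y = qpt R i.
Proof.
move=> ty ij; rewrite bary_Fmap (negbTE ij) addr0 => ly.
by apply: triangle_bary1 => //; have := triangle_le1 i ty; lra.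
Qed.

Lemma half_le_bary_Fmap i y : triangle y -> 2^-1 <= bary i (Fmap i y).
Proof. by move=> /(_ i); rewrite bary_Fmap eqxx /=; lra. Qed.

(** On cell i the coordinate [bary i] is at least 1/2, so a common point has both coordinates i and
    j at least 1/2 and can only be the midpoint. *)
Lemma Fmap_meet i j x y : triangle x -> triangle y -> i != j -> Fmap i x = Fmap j y ->
  x = qpt R j /\ y = qpt R i.
Proof.
move=> tx ty ij e; split; apply: Fmap_overlap.
- exact: tx.
- by rewrite eq_sym; exact: ij.
- by rewrite e; exact: half_le_bary_Fmap.
- exact: ty.
- exact: ij.
- by rewrite -e; exact: half_le_bary_Fmap.
Qed.

(** A point with [bary i] at least 1/2 that comes from another cell is the junction point, which
    also lies in cell i. *)
Lemma gasket_Fmap_bary i x : K x -> 2^-1 <= bary i x -> K (Fmapinv i x).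
Proof.
move=> Kx lx; have [j [y [Ky xE]]] := gasketE Kx.
have [e|ij] := eqVneq i j; first by rewrite xE e FmapK.
rewrite xE in lx *.
rewrite (Fmap_overlap (gasket_triangle Ky) ij lx) Fmap_swap FmapK.
exact: gasket_qpt.
Qed.

Lemma gasket_Fmapinv i x : K x -> triangle (Fmapinv i x) -> K (Fmapinv i x).
Proof.
move=> Kx /(_ i); rewrite bary_Fmapinv eqxx => h.
by apply: gasket_Fmap_bary => //; move: h => /=; lra.
Qed.

Lemma Fw_triangle w x : triangle x -> triangle (Fw w x).
Proof.
elim: w => //= i w IH tx j; rewrite bary_Fmap divr_ge0 // addr_ge0 //; exact: IH.
Qed.

(** Describes a cell inside the gasket by signs of barycentric coordinates, which is what the
    continuous functions [bump] detect. *)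
Lemma cellP w x : cell w x <-> K x /\ triangle (Fwinv w x).
Proof.
split=> [[y Ky <-]|[Kx]].
  by split; [exact: gasket_Fw|rewrite FwK; exact: gasket_triangle].
move=> tx; exists (Fwinv w x); last exact: FwinvK.
elim: w x Kx tx => //= i w IH x Kx tx.
apply: IH => //; apply: gasket_Fmapinv => //.
by rewrite -(FwinvK w (Fmapinv i x)); exact: Fw_triangle.
Qed.

Lemma cell_nil : cell [::] = K.
Proof. by rewrite /cell /= image_id. Qed.

Lemma cell_sub w : cell w `<=` K.
Proof. by move=> x [y Ky <-]; exact: gasket_Fw. Qed.

Lemma cell_cat w v : @cell R (w ++ v) = Fw w @` cell v.
Proof.
apply/seteqP; split => x; rewrite /cell.
  by move=> [y Ky <-]; exists (Fw v y); [exists y|rewrite Fw_cat].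
by move=> [_ [y Ky <-] <-]; exists y => //; rewrite Fw_cat.
Qed.

Lemma cell_catS w v : @cell R (w ++ v) `<=` cell w.
Proof. by rewrite cell_cat => x [y /cell_sub Ky <-]; exists y. Qed.

Lemma cell_closed w : closed (@cell R w).
Proof.
apply: compact_closed; first exact: norm_hausdorff.
apply: continuous_compact gasket_compact.
by apply: continuous_subspaceT; exact: continuous_Fw.
Qed.

Lemma cell_split w : @cell R w = cell (rcons w 0) `|` cell (rcons w 1) `|` cell (rcons w 2).
Proof.
apply/seteqP; split => x; rewrite -!cats1; last by move=> [[]|]; exact: cell_catS.
move=> [y Ky <-]; have [i [z [Kz ->]]] := gasketE Ky.
have : cell (w ++ [:: i]) (Fw w (Fmap i z)) by exists z => //; rewrite Fw_cat.
by elim/I3_ind: i {Ky}; [left; left|left; right|right].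
Qed.

Lemma cell_meet w i j v v' : i != j ->
  cell (w ++ i :: v) `&` cell (w ++ j :: v') `<=` [set Fw w (Fmap i (qpt R j))].
Proof.
move=> ij x; rewrite -!cat_rcons => -[/cell_catS[y Ky <-] /cell_catS[z Kz]].
rewrite !Fw_rcons => /(can_inj (FwK w)) /esym e.
by have [-> _] := Fmap_meet (gasket_triangle Ky) (gasket_triangle Kz) ij e.
Qed.

Lemma neq_split w v : size w = size v -> w != v ->
  exists u i j w' v', [/\ i != j, w = u ++ i :: w' & v = u ++ j :: v'].
Proof.
elim: w v => [|i w IH] [|j v] //= [sz].
have [<-{j}|ij _] := eqVneq i j; last by exists [::], i, j, w, v.
rewrite eqseq_cons eqxx /= => /(IH _ sz) [p [k [l [w' [v' [kl -> ->]]]]]].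
by exists (i :: p), k, l, w', v'.
Qed.

End Geometry.

(** * Continuous functions and harmonic approximants *)

Section Within.
Variables (S U V : topologicalType).

Lemma within_continuousP (W X : topologicalType) (A : set W) (f : W -> X) :
  {within A, continuous f} <-> forall x, A x -> f @ within A (nbhs x) --> f x.
Proof. exact: subspace_continuousP. Qed.

Lemma within_continuous_comp (A : set S) (B : set U) (g : S -> U) (f : U -> V) :
  continuous g -> (forall x, A x -> B (g x)) ->
  {within B, continuous f} -> {within A, continuous (f \o g)}.
Proof.
move=> cg AB /within_continuousP cf; apply/within_continuousP => x Ax.
apply: (@cvg_comp _ _ _ g f _ (within B (nbhs (g x)))); last exact: cf (AB _ Ax).
move=> W /= BW; have h : nbhs x (g @^-1` [set y | B y -> W y]) by exact: cg.
by apply: filterS h => y /= h Ay; exact: (h (AB _ Ay)).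
Qed.
End Within.

Section Harmonic.
Variable R : realType.
Local Notation T := (R * R)%type.
Local Notation word := (seq 'I_3).
Local Notation K := (@gasket R).
Implicit Types (x y : T) (i j k : 'I_3) (w : word) (u f g : T -> R) (v a b : 'I_3 -> R).

Lemma CK_eq u f : (forall x, K x -> u x = f x) -> CK u -> CK f.
Proof.
move=> e /within_continuousP cu; apply/within_continuousP => x Kx.
have -> : f x = u x by rewrite e.
apply: cvg_trans (cu x Kx); apply: near_eq_cvg.
by apply: filterS (withinT K (nbhs_filter x)) => z Kz; rewrite e.
Qed.

Lemma CK_Fmap u i : CK u -> CK (u \o Fmap i).
Proof.
by apply: within_continuous_comp; [exact: continuous_Fmap|exact: gasket_Fmap].
Qed.

Lemma CK_glue u : (forall i, CK (u \o Fmap i)) -> CK u.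
Proof.
move=> cu.
have h i : {within cell [:: i], continuous u}.
  have -> : u = (u \o Fmap i) \o Fmapinv i.
    by apply/funext => x /=; rewrite FmapinvK.
  apply: within_continuous_comp (cu i); first exact: continuous_Fmapinv.
  by move=> x [y Ky <-] /=; rewrite FmapK.
rewrite /CK -(cell_nil R) cell_split /=.
by apply: withinU_continuous; [apply: closedU; exact: cell_closed|exact: cell_closed|
  by apply: withinU_continuous => //; exact: cell_closed|].
Qed.

Lemma CK_cst (c : R) : CK (cst c : T -> R).
Proof. by apply: continuous_subspaceT => x; exact: cvg_cst. Qed.

Lemma CK_continuous u : continuous u -> CK u.
Proof. exact: continuous_subspaceT. Qed.

Lemma CK_add f g : CK f -> CK g -> CK (f \+ g).
Proof.
move=> /within_continuousP cf /within_continuousP cg; apply/within_continuousP => x Kx.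
by apply: cvgD; [exact: cf|exact: cg].
Qed.

Lemma CK_mul f g : CK f -> CK g -> CK (f \* g).
Proof.
move=> /within_continuousP cf /within_continuousP cg; apply/within_continuousP => x Kx.
by apply: cvgM; [exact: cf|exact: cg].
Qed.

Lemma CK_scale (c : R) f : CK f -> CK (fun x => c * f x).
Proof. by move=> cf; apply: CK_mul cf; exact: CK_cst. Qed.

Lemma CK_lin (c : R) f g : CK f -> CK g -> CK (fun x => c * f x + g x).
Proof. by move=> cf; apply: CK_add; exact: CK_scale. Qed.

Lemma CK_bounded f : CK f -> exists2 M, 0 <= M & forall x, K x -> `|f x| <= M.
Proof.
move=> cf; have : CK (fun x => `|f x|).
  move/within_continuousP: cf => cf; apply/within_continuousP => x Kx.
  by apply: cvg_norm; exact: cf.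
have K0 : K !=set0 by exists (qpt R 0); exact: gasket_qpt.
move=> /(compact_EVT_max K0 (@gasket_compact R)) [c _ h].
by exists `|f c| => // x Kx; apply: h; exact: mem_set.
Qed.

(** Defined on the whole plane by the first coordinate that reaches 1/2. A junction point falls
    under the smaller index, hence the matching hypothesis of [glueE]. *)
Definition glue (f : 'I_3 -> T -> R) (x : T) : R :=
  if 2^-1 <= bary 0 x then f 0 (Fmapinv 0 x)
  else if 2^-1 <= bary 1 x then f 1 (Fmapinv 1 x) else f 2 (Fmapinv 2 x).

Lemma glueE (f : 'I_3 -> T -> R) i x :
  (forall i j, f i (qpt R j) = f j (qpt R i)) -> K x -> glue f (Fmap i x) = f i x.
Proof.
move=> fq Kx; have tx := gasket_triangle Kx; rewrite /glue.
have h j : 2^-1 <= bary j (Fmap i x) -> f j (Fmapinv j (Fmap i x)) = f i x.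
  have [->|ji] := eqVneq j i; first by rewrite FmapK.
  by move=> /(Fmap_overlap tx ji) ->; rewrite Fmap_swap FmapK fq.
case: ifPn => [/h//|n0]; case: ifPn => [/h//|n1].
apply: h; move: n0 n1; have := half_le_bary_Fmap i tx.
by elim/I3_ind: i => // ->.
Qed.

Lemma CK_gluef (f : 'I_3 -> T -> R) :
  (forall i j, f i (qpt R j) = f j (qpt R i)) -> (forall i, CK (f i)) -> CK (glue f).
Proof.
move=> fq cf; apply: CK_glue => i; apply: CK_eq (cf i) => x Kx /=.
by rewrite glueE.
Qed.

(* The "1/5-2/5 rule": boundary values on F_i V_0 of the harmonic extension of v. *)
Definition harm_rule v i j : R := if j == i then v i else (v i + v j + (v 0 + v 1 + v 2)) / 5.

Lemma harm_rule_sym v i j : harm_rule v i j = harm_rule v j i.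
Proof. by rewrite /harm_rule eq_sym; case: eqP => [->//|_]; rewrite (addrC (v i)). Qed.

(** The values of the harmonic extension on V_n, interpolated affinely on the cells of level n. *)
Fixpoint harm_approx (n : nat) v : T -> R :=
  if n is m.+1 then glue (fun i => harm_approx m (harm_rule v i))
  else fun x => v 0 * bary 0 x + v 1 * bary 1 x + v 2 * bary 2 x.

Lemma harm_approx_qpt n v i : harm_approx n v (qpt R i) = v i.
Proof.
elim: n v i => [|n IH] v i /=.
  by rewrite !bary_qpt; elim/I3_ind: i; rewrite /= ?mulr0 ?mulr1 ?addr0 ?add0r.
rewrite -{1}(Fmap_fix R i) glueE; last exact: gasket_qpt.
  by rewrite IH /harm_rule eqxx.
by move=> k j; rewrite !IH harm_rule_sym.
Qed.

Lemma harm_approxS n v i x : K x -> harm_approx n.+1 v (Fmap i x) = harm_approx n (harm_rule v i) x.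
Proof.
by move=> Kx; rewrite /= glueE // => k j; rewrite !harm_approx_qpt harm_rule_sym.
Qed.

Lemma CK_harm_approx n v : CK (harm_approx n v).
Proof.
elim: n v => [|n IH] v; last first.
  rewrite (_ : harm_approx n.+1 v = glue (fun i => harm_approx n (harm_rule v i))) //.
  apply: CK_gluef => [k j|i]; last exact: IH.
  by rewrite !harm_approx_qpt harm_rule_sym.
apply: CK_continuous => x /=; have cl := @continuous_bary R.
by apply: cvgD; first apply: cvgD; apply: cvgMr; exact: cl.
Qed.

Definition osc_le v (d : R) := forall i j, v i - v j <= d.

(** The contraction by 3/5 per level makes consecutive approximants differ by a geometric amount,
    uniformly on the gasket. *)
Lemma osc_harm_rule v d i : osc_le v d -> osc_le (harm_rule v i) (3 / 5 * d).
Proof.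
move=> h.
have := h 0 1; have := h 1 0; have := h 0 2; have := h 2 0; have := h 1 2; have := h 2 1.
by elim/I3_ind: i => ? ? ? ? ? ?; elim/I3_ind; elim/I3_ind; rewrite /harm_rule /=; lra.
Qed.

Lemma harm_approx_step n v d x : osc_le v d -> K x ->
  `|harm_approx n.+1 v x - harm_approx n v x| <= d * (3 / 5) ^+ n.
Proof.
elim: n v d x => [|n IH] v d x dv Kx.
  have [i [y [Ky xE]]] := gasketE Kx; rewrite xE harm_approxS // /= expr0 mulr1.
  have := bary_sum y; have ty := gasket_triangle Ky; have := ty 0; have := ty 1; have := ty 2.
  have := dv 0 1; have := dv 1 0; have := dv 0 2; have := dv 2 0; have := dv 1 2; have := dv 2 1.
  move=> d21 d12 d20 d02 d10 d01 t2 t1 t0 ts.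
  (* On the cell both functions are affine, and their difference has the corner values c j: the
     1/5-2/5 value minus the average given by linear interpolation. *)
  pose c j := harm_rule v i j - (v i + v j) / 2.
  have c_le j : `|c j| <= d.
    rewrite /c ler_norml; apply/andP; split;
    by move: i j {xE c}; elim/I3_ind; elim/I3_ind; rewrite /harm_rule /=; lra.
  rewrite (_ : _ - _ = bary 0 y * c 0 + bary 1 y * c 1 + bary 2 y * c 2); last first.
    rewrite !bary_Fmap /c (_ : bary 2 y = 1 - bary 0 y - bary 1 y); last by lra.
    by elim/I3_ind: i {xE c c_le} => /=; field.
  apply: (@le_trans _ _ (bary 0 y * d + bary 1 y * d + bary 2 y * d)); last by nra.
  apply: le_trans (ler_normD _ _) _; apply: lerD; first apply: le_trans (ler_normD _ _) (lerD _ _);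
    by rewrite normrM ger0_norm // ler_wpM2l.
have [i [y [Ky ->]]] := gasketE Kx; rewrite !harm_approxS //.
apply: le_trans (IH _ (3 / 5 * d) _ _ Ky) _; first exact: osc_harm_rule.
by rewrite exprS mulrCA mulrA.
Qed.
End Harmonic.

(** * Harmonic extension and graph energies *)

Lemma geometric_cvg (R : realType) (V : completeNormedModType R) (u : nat -> V) (C q : R) :
  0 <= q < 1 -> 0 <= C -> (forall n, `|u n.+1 - u n| <= C * q ^+ n) ->
  cvgn u /\ forall n, `|limn u - u n| <= C / (1 - q) * q ^+ n.
Proof.
move=> /andP[q0 q1] C0 h.
have q1' : 0 < 1 - q by lra.
have D k n : `|u (n + k)%N - u n| <= C / (1 - q) * q ^+ n.
  (* With the factor 1 - q^k the bound is the exact sum of the first k geometric terms, so the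
     induction on k closes. *)
  apply: le_trans (_ : C / (1 - q) * q ^+ n * (1 - q ^+ k) <= _); last first.
    apply: ler_piMr.
      by rewrite mulr_ge0 ?divr_ge0 ?exprn_ge0 ?(ltW q1').
    by rewrite lerBlDr lerDl exprn_ge0.
  elim: k => [|k IH]; first by rewrite addn0 subrr normr0 expr0 subrr mulr0.
  rewrite addnS -(subrKA (u (n + k)%N)); apply: le_trans (ler_normD _ _) _.
  rewrite (_ : _ * (1 - q ^+ k.+1) =
     C * q ^+ (n + k) + C / (1 - q) * q ^+ n * (1 - q ^+ k)).
    by rewrite lerD.
  by rewrite exprD exprS; field; rewrite gt_eqF.
have q_to0 : (fun n => C / (1 - q) * q ^+ n) @ \oo --> 0.
  rewrite -(mulr0 (C / (1 - q))); apply: cvgMr; apply: cvg_expr.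
  by rewrite ger0_norm.
have cu : cvgn u.
  apply/cauchy_cvgP/cauchy_exP => e e0.
  have [N _ hN] : \forall n \near \oo, C / (1 - q) * q ^+ n < e.
    exact: (cvgr_lt _ q_to0).
  exists (u N); exists N => // n /= Nn; rewrite -ball_normE /= distrC.
  by rewrite -(subnKC Nn); apply: le_lt_trans (D _ _) (hN N _) => /=.
split=> // n.
have cn : (fun m => `|u m - u n|) @ \oo --> `|limn u - u n|.
  by apply: cvg_norm; apply: cvgB => //; exact: cvg_cst.
apply: (cvgr_to_le cn); exists n => // m /= nm.
by rewrite -(subnKC nm); exact: D.
Qed.

Section HarmonicExtension.
Variable R : realType.
Local Notation T := (R * R)%type.
Local Notation word := (seq 'I_3).
Local Notation K := (@gasket R).
Implicit Types (x y : T) (i j k : 'I_3) (w : word) (u f g : T -> R) (v a b : 'I_3 -> R).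

(** A uniform limit on the gasket; at other points of the plane the value of [limn] carries no
    information. *)
Definition harm_ext v x : R := limn (fun n => harm_approx n v x).

Lemma osc_exists v : exists2 d, 0 <= d & osc_le v d.
Proof.
pose d := 2 * \sum_i `|v i|.
have vd i : `|v i| <= \sum_i `|v i|.
  by rewrite (bigD1 i) //= lerDl sumr_ge0.
exists d => [|i j]; first by rewrite mulr_ge0 // sumr_ge0.
apply: le_trans (ler_norm _) _; apply: le_trans (ler_normB _ _) _.
by rewrite /d mulr_natl mulr2n lerD.
Qed.

Lemma harm_approx_harm_ext v : exists2 C, 0 <= C &
  forall x n, K x -> `|harm_ext v x - harm_approx n v x| <= C * (3 / 5) ^+ n.
Proof.
have [d d0 dv] := osc_exists v.
exists (d / (1 - 3 / 5)) => [|x n Kx]; first by rewrite divr_ge0 //; lra.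
have [||cu] := @geometric_cvg R R (fun n => harm_approx n v x) d (3 / 5) _ d0 _; last exact.
  by apply/andP; split; lra.
by move=> m; exact: harm_approx_step.
Qed.

Lemma harm_approx_cvg v x : K x -> harm_approx n v x @[n --> \oo] --> harm_ext v x.
Proof.
have [d d0 dv] := osc_exists v => Kx.
have [||cu _] := @geometric_cvg R R (fun n => harm_approx n v x) d (3 / 5) _ d0 _; last exact: cu.
  by apply/andP; split; lra.
by move=> m; exact: harm_approx_step.
Qed.

Lemma harm_ext_qpt v i : harm_ext v (qpt R i) = v i.
Proof.
apply/cvg_lim => //; under eq_fun do rewrite harm_approx_qpt; exact: cvg_cst.
Qed.

Lemma harm_ext_Fmap v i x : K x -> harm_ext v (Fmap i x) = harm_ext (harm_rule v i) x.
Proof.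
move=> Kx; apply/cvg_lim => //; rewrite -cvg_shiftS.
by under eq_fun do rewrite harm_approxS //; exact: harm_approx_cvg.
Qed.

Lemma CK_harm_ext v : CK (harm_ext v).
Proof.
have [C C0 hC] := harm_approx_harm_ext v.
apply/within_continuousP => x Kx; apply/cvgrPdist_lt => e e0.
have [n hn] : exists n, C * (3 / 5) ^+ n < e / 3.
  have h0 : C * (3 / 5) ^+ n @[n --> \oo] --> (0 : R).
    rewrite -(mulr0 C); apply: cvgMr; apply: cvg_expr; rewrite ger0_norm; lra.
  have [N _ hN] : \forall n \near \oo, C * (3 / 5) ^+ n < e / 3.
    by apply: (cvgr_lt _ h0); lra.
  by exists N; apply: hN => /=.
have /within_continuousP/(_ x Kx)/cvgrPdist_lt/(_ (e / 3)) := @CK_harm_approx R n v.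
have e3 : 0 < e / 3 by lra.
move=> /(_ e3); apply: filterS2 (withinT K (nbhs_filter x)) => z Kz h.
have := le_lt_trans (hC x n Kx) hn; have := le_lt_trans (hC z n Kz) hn.
rewrite !ltr_norml in h *; move=> /andP[? ?] /andP[? ?]; move: h => /andP[? ?].
by apply/andP; split; lra.
Qed.

Definition energy_V0 a b : R := (a 0 - a 1) * (b 0 - b 1) + (a 1 - a 2) * (b 1 - b 2)
  + (a 0 - a 2) * (b 0 - b 2).

(** The unscaled energy of level m arranged by cells rather than by edges, so that self-similarity
    becomes recursion; [energy_sumE] identifies the two. *)
Fixpoint graph_energy (m : nat) u f : R :=
  if m is m'.+1 then \sum_i graph_energy m' (u \o Fmap i) (f \o Fmap i)
  else energy_V0 (u \o @qpt R) (f \o @qpt R).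

Definition Fpair i (e : T * T) : T * T := (Fmap i e.1, Fmap i e.2).

Definition edges m : set (T * T) := [set e | level_adj m e.1 e.2].

Lemma Fpair_inj i : injective (Fpair i).
Proof.
apply: (can_inj (g := fun e => (Fmapinv i e.1, Fmapinv i e.2))) => -[x y].
by rewrite /Fpair [LHS]/= !FmapK.
Qed.

Lemma Vset_qpt n i : Vset n (qpt R i).
Proof.
exists (nseq n i); rewrite /= ?size_nseq //.
by exists (qpt R i); [exists i|exact: Fw_nseq_fix].
Qed.

Lemma VsetS n x : Vset n.+1 x <-> exists i y, Vset n y /\ x = Fmap i y.
Proof.
split=> [[[|i w] //= [sw] [p p0 <-]]|[i [y [[w sw [p p0 <-]] ->]]]].
  by exists i, (Fw w p); split=> //; exists w => //; exists p.
by exists (i :: w); [rewrite /= sw|exists p].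
Qed.

Lemma Vset_gasket n x : Vset n x -> K x.
Proof. by move=> [w _ [_ [i _ <-] <-]]; apply: gasket_Fw; exact: gasket_qpt. Qed.

(** The vertex may have been produced by a neighbouring cell; then it is a junction point, which is
    the image under [Fmap i] of a corner, and corners are vertices of every level. *)
Lemma Vset_cell n i w x : Vset n.+1 x -> cell (i :: w) x ->
  exists y, [/\ Vset n y, cell w y & x = Fmap i y].
Proof.
move=> /VsetS[j [y [Vy xE]]] [z Kz /= e].
have [ij|ij] := eqVneq i j.
  exists y; split=> //; last by rewrite ij.
  by exists z => //; apply: (@Fmap_inj _ i); rewrite e xE ij.
have tz : triangle (Fw w z) by apply: gasket_triangle; exact: gasket_Fw.
rewrite xE in e *.
have [zE yE] := Fmap_meet tz (gasket_triangle (Vset_gasket Vy)) ij e.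
exists (qpt R j); split; first exact: Vset_qpt.
  by exists z.
by rewrite yE Fmap_swap.
Qed.

Lemma edgesS m : edges m.+1 =
  Fpair 0 @` edges m `|` Fpair 1 @` edges m `|` Fpair 2 @` edges m.
Proof.
apply/seteqP; split=> [[x y] [/= Vx Vy xy [[|i w] [// sw cx cy]]]|e].
  move: sw => [sw].
  have [x' [Vx' cx' xE]] := Vset_cell Vx cx; have [y' [Vy' cy' yE]] := Vset_cell Vy cy.
  have h : (Fpair i @` edges m) (x, y).
    exists (x', y'); last by rewrite /Fpair /= xE yE.
    split => //=; first by move=> e; apply: xy; rewrite xE yE e.
    by exists w.
  by move: h; elim/I3_ind: i {cx cy xE yE}; [left; left|left; right|right].
have h i : (Fpair i @` edges m) e -> edges m.+1 e.
  move=> [[x y] [/= Vx Vy xy [w [sw cx cy]]] <-]; split => /=.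
  - by apply/VsetS; exists i, x.
  - by apply/VsetS; exists i, y.
  - by move/Fmap_inj.
  - exists (i :: w); rewrite -cat1s cell_cat.
    by split; [rewrite /= sw|exists x|exists y].
by move=> [[]|]; exact: h.
Qed.

Lemma edges0 : edges 0 = [set` [seq (qpt R ij.1, qpt R ij.2) | ij <-
  [:: (0, 1); (1, 0); (1, 2); (2, 1); (0, 2); (2, 0)] ]].
Proof.
apply/seteqP; split=> [[x y] [/= Vx Vy xy _]|[x y]].
  have hq (z : T) : Vset 0 z -> exists i, z = qpt R i.
    by move=> [w /size0nil -> [p [i _ <-] /= <-]]; exists i.
  have [i xE] := hq x Vx; have [j yE] := hq y Vy; rewrite {}xE {}yE in xy *.
  by move: i j xy {Vx Vy}; elim/I3_ind; elim/I3_ind => // _; rewrite !inE eqxx ?orbT.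
move=> /mapP [[i j] h [-> ->]]; split=> /=; try exact: Vset_qpt.
  by move/qpt_inj => ij; move: h; rewrite ij; elim/I3_ind: j {ij}.
by exists [::]; rewrite cell_nil; split=> //; exact: gasket_qpt.
Qed.

Lemma edges_finite m : finite_set (edges m).
Proof.
elim: m => [|m IH]; first by rewrite edges0; exact: finite_seq.
by rewrite edgesS !finite_setU; split; [split|]; exact: finite_image.
Qed.

(** An edge has two distinct endpoints, whereas two different cells share a single point. *)
Lemma edges_disj m i j : i != j -> Fpair i @` edges m `&` Fpair j @` edges m = set0.
Proof.
move=> ij; rewrite -subset0 => e [[[x y] [/= Vx Vy xy _] <-] [[x' y'] [/= Vx' Vy' _ _]]].
have t (z : T) : Vset m z -> triangle z 
    by move=> Vz; apply: gasket_triangle; exact: (Vset_gasket Vz).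
rewrite /Fpair => E; have /esym ex := congr1 fst E; have /esym ey := congr1 snd E; apply: xy.
have [-> _] := Fmap_meet (t _ Vx) (t _ Vx') ij ex.
by have [-> _] := Fmap_meet (t _ Vy) (t _ Vy') ij ey.
Qed.

Lemma energy_sumE m u f : energy_sum m u f = graph_energy m u f.
Proof.
elim: m u f => [|m IH] u f; rewrite /energy_sum -/(edges _).
  rewrite edges0 -fsbig_seq; last first.
    rewrite map_inj_uniq // => -[i j] [i' j'] E.
    by move: (congr1 fst E) (congr1 snd E) => /= /qpt_inj -> /qpt_inj ->.
  by rewrite /= !big_cons big_nil /energy_V0 /=; field.
have himg i : \sum_(e \in Fpair i @` edges m) ((u e.1 - u e.2) * (f e.1 - f e.2)) =
    2 * graph_energy m (u \o Fmap i) (f \o Fmap i).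
  rewrite -IH /energy_sum mulrA divff // mul1r.
  rewrite (reindex_fsbig (Fpair i) (edges m)) //; split.
  - by move=> e he; exists e.
  - by move=> e e' _ _; exact: Fpair_inj.
  - by move=> e.
have fin i : finite_set (Fpair i @` edges m) by apply: finite_image; exact: edges_finite.
rewrite edgesS /= big_I3 fsbigU //; first last.
- by rewrite setIUl !edges_disj // setU0.
- by rewrite finite_setU.
rewrite fsbigU //; last by rewrite edges_disj.
by rewrite !himg /=; field.
Qed.
End HarmonicExtension.

(** * Energy *)

Section Energy.
Variable R : realType.
Local Notation T := (R * R)%type.
Local Notation word := (seq 'I_3).
Local Notation K := (@gasket R).
Local Notation r := (@rfac R).
Implicit Types (x y : T) (i j k : 'I_3) (m n : nat) (w : word) (u f g : T -> R)
  (v a b : 'I_3 -> R) (c : R).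

Lemma rfac_gt0 : 0 < r. Proof. by rewrite /rfac; lra. Qed.
Lemma rfacX_gt0 n : 0 < r ^+ n. Proof. by rewrite exprn_gt0 // rfac_gt0. Qed.
Lemma rfacX_neq0 n : r ^+ n != 0. Proof. by rewrite gt_eqF // rfacX_gt0. Qed.

Lemma energy_V0_sym a b : energy_V0 a b = energy_V0 b a.
Proof. by rewrite /energy_V0; ring. Qed.

Lemma energy_V0_ge0 a : 0 <= energy_V0 a a.
Proof. by rewrite /energy_V0 -!expr2 !addr_ge0 // sqr_ge0. Qed.

(** Summation by parts: under the rule the differences around each junction sum to zero, so the
    values of b there cancel and only those at the corners, [b i i], remain. This is where the
    renormalization factor 3/5 comes from. *)
Lemma energy_V0_harm_rule v (b : 'I_3 -> 'I_3 -> R) : (forall i j, b i j = b j i) ->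
  \sum_i energy_V0 (harm_rule v i) (b i) = r * energy_V0 v (fun i => b i i).
Proof.
move=> bs; rewrite big_I3 /energy_V0 /harm_rule /= /rfac (bs 1 0) (bs 2 0) (bs 2 1).
by field.
Qed.

Lemma graph_energy_sym m u f : graph_energy m u f = graph_energy m f u.
Proof.
by elim: m u f => [|m IH] u f /=; [exact: energy_V0_sym|under eq_bigr do rewrite IH].
Qed.

Lemma graph_energy_linl m c u f g :
  graph_energy m (fun x => c * u x + f x) g = c * graph_energy m u g + graph_energy m f g.
Proof.
elim: m u f g => [|m IH] u f g /=; first by rewrite /energy_V0 /=; ring.
rewrite mulr_sumr -big_split /=; apply: eq_bigr => i _; exact: IH.
Qed.

Lemma graph_energy_linr m c u f g :
  graph_energy m g (fun x => c * u x + f x) = c * graph_energy m g u + graph_energy m g f.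
Proof. by rewrite graph_energy_sym graph_energy_linl !(graph_energy_sym m g). Qed.

Lemma graph_energy_eq m u u' f f' : (forall x, K x -> u x = u' x) ->
  (forall x, K x -> f x = f' x) -> graph_energy m u f = graph_energy m u' f'.
Proof.
elim: m u u' f f' => [|m IH] u u' f f' uu' ff' /=.
  by rewrite /energy_V0 /= !uu' ?ff' //; exact: gasket_qpt.
apply: eq_bigr => i _; apply: IH => x Kx /=; [apply: uu'|apply: ff'];
  exact: gasket_Fmap.
Qed.

Lemma graph_energy_ge0 m u : 0 <= graph_energy m u u.
Proof.
by elim: m u => [|m IH] u /=; [exact: energy_V0_ge0|apply: sumr_ge0 => i _; exact: IH].
Qed.

(** On V_1 the function is the extension by the rule of its values on V_0 plus a rest vanishing on
    V_0. The cross term is zero by [energy_V0_harm_rule], and the energy of the rest is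
    nonnegative. *)
Lemma graph_energy_mono m u : r * graph_energy m u u <= graph_energy m.+1 u u.
Proof.
elim: m u => [|m IH] u; last first.
  by rewrite [leRHS]/= [graph_energy m.+1 _ _]/= mulr_sumr; apply: ler_sum => i _; exact: IH.
rewrite /=; set v := u \o @qpt R.
pose b i j := u (Fmap i (qpt R j)).
pose d i j := b i j - harm_rule v i j.
have bs i j : b i j = b j i by rewrite /b Fmap_swap.
have ds i j : d i j = d j i by rewrite /d bs harm_rule_sym.
have d0 i : d i i = 0 by rewrite /d /b Fmap_fix /harm_rule eqxx /v /= subrr.
have e0d : energy_V0 v (fun i => d i i) = 0 by rewrite /energy_V0 !d0; ring.
have hs i j : harm_rule v i j = harm_rule v j i by exact: harm_rule_sym.
have -> : \sum_i energy_V0 ((u \o Fmap i) \o @qpt R) ((u \o Fmap i) \o @qpt R) =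
    \sum_i energy_V0 (harm_rule v i) (harm_rule v i) + 2 * \sum_i energy_V0 (harm_rule v i) (d i)
    + \sum_i energy_V0 (d i) (d i).
  rewrite mulr_sumr -!big_split /=; apply: eq_bigr => i _.
  by rewrite /d /energy_V0 /b /=; ring.
rewrite energy_V0_harm_rule // energy_V0_harm_rule // e0d mulr0 mulr0 addr0.
rewrite (_ : energy_V0 v (fun i => harm_rule v i i) = energy_V0 v v); last first.
  by rewrite /energy_V0 /harm_rule !eqxx.
by rewrite lerDl sumr_ge0 // => i _; exact: energy_V0_ge0.
Qed.

(** By [energy_V0_harm_rule] each level contributes exactly a factor r, so after scaling the pairing
    with a harmonic extension is constant in m. *)
Lemma graph_energy_harm_ext m v u :
  graph_energy m (harm_ext v) u = r ^+ m * energy_V0 v (u \o @qpt R).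
Proof.
elim: m v u => [|m IH] v u /=.
  by rewrite expr0 mul1r /energy_V0 /= !harm_ext_qpt.
have h i : graph_energy m (harm_ext v \o Fmap i) (u \o Fmap i) =
    r ^+ m * energy_V0 (harm_rule v i) (fun j => u (Fmap i (qpt R j))).
  rewrite -(IH _ (u \o Fmap i)); apply: graph_energy_eq => // x Kx /=; exact: harm_ext_Fmap.
under eq_bigr do rewrite h.
rewrite -mulr_sumr energy_V0_harm_rule; last by move=> i j; rewrite Fmap_swap.
rewrite exprSr -mulrA; congr (_ * (_ * _)).
by rewrite /energy_V0 /= !Fmap_fix.
Qed.

Definition scaled_energy m u f : R := r ^- m * graph_energy m u f.

Lemma energyE u f : energy u f = limn (fun m => scaled_energy m u f).
Proof. by rewrite /energy; under eq_fun do rewrite energy_sumE. Qed.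

Lemma FFE u : FF u <-> CK u /\ exists M, forall m, scaled_energy m u u <= M.
Proof.
by split=> -[cu [M h]]; split => //; exists M => m; have := h m; rewrite energy_sumE.
Qed.

Lemma FF_CK u : FF u -> CK u. Proof. by case. Qed.

Lemma scaled_energy_ge0 m u : 0 <= scaled_energy m u u.
Proof. by rewrite mulr_ge0 ?graph_energy_ge0 // invr_ge0 ltW // rfacX_gt0. Qed.

Lemma scaled_energy_linl m c u f g :
  scaled_energy m (fun x => c * u x + f x) g = c * scaled_energy m u g + scaled_energy m f g.
Proof. by rewrite /scaled_energy graph_energy_linl; ring. Qed.

Lemma scaled_energy_sym m u f : scaled_energy m u f = scaled_energy m f u.
Proof. by rewrite /scaled_energy graph_energy_sym. Qed.

Lemma scaled_energy_linr m c u f g :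
  scaled_energy m g (fun x => c * u x + f x) = c * scaled_energy m g u + scaled_energy m g f.
Proof. by rewrite /scaled_energy graph_energy_linr; ring. Qed.

Lemma scaled_energyS m u f :
  scaled_energy m.+1 u f = r^-1 * \sum_i scaled_energy m (u \o Fmap i) (f \o Fmap i).
Proof.
rewrite /scaled_energy /= !mulr_sumr; apply: eq_bigr => i _.
by rewrite mulrA exprS invfM.
Qed.

Lemma scaled_energy_nd u : nondecreasing_seq (fun m => scaled_energy m u u).
Proof.
apply/nondecreasing_seqP => m.
rewrite /scaled_energy exprSr invfM -mulrA ler_pM2l ?invr_gt0 ?rfacX_gt0 //.
by rewrite ler_pdivlMl ?rfac_gt0 //; exact: graph_energy_mono.
Qed.

Lemma FF_eq u f : (forall x, K x -> u x = f x) -> FF u -> FF f.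
Proof.
move=> e /FFE [cu [M h]]; apply/FFE; split; first exact: CK_eq cu.
by exists M => m; rewrite /scaled_energy -(graph_energy_eq m e e); exact: h.
Qed.

Lemma FF_cst c : FF (cst c : T -> R).
Proof.
have h m : graph_energy m (cst c : T -> R) (cst c : T -> R) = 0.
  elim: m => [|m IH] /=; first by rewrite /energy_V0 /=; ring.
  by rewrite big1.
by apply/FFE; split; [exact: CK_cst|exists 0 => m; rewrite /scaled_energy h mulr0].
Qed.

Lemma FF_lin c u f : FF u -> FF f -> FF (fun x => c * u x + f x).
Proof.
move=> /FFE[cu [M hM]] /FFE[cf [N hN]]; apply/FFE; split; first exact: CK_lin.
(* Parallelogram identity at each level: the bound exceeds the energy of c u + f by the energy of c
   u - f. *)
exists (2 * (c ^+ 2 * M + N)) => m.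
apply: le_trans (_ : 2 * (c ^+ 2 * scaled_energy m u u + scaled_energy m f f) <= _); last first.
  by rewrite ler_pM2l // lerD // ler_wpM2l // sqr_ge0.
rewrite /scaled_energy (_ : 2 * _ =
  r ^- m * (2 * (c ^+ 2 * graph_energy m u u + graph_energy m f f))); last by ring.
rewrite ler_pM2l ?invr_gt0 ?rfacX_gt0 // -subr_ge0.
elim: m u f {cu cf hM hN} => [|m IH] u f /=; last first.
  rewrite !mulr_sumr -big_split mulr_sumr -sumrB; apply: sumr_ge0 => i _; exact: IH.
rewrite (_ : _ - _ = energy_V0 (fun i => c * u (qpt R i) - f (qpt R i))
  (fun i => c * u (qpt R i) - f (qpt R i))); first exact: energy_V0_ge0.
by rewrite /energy_V0 /=; ring.
Qed.

Lemma FF_sub u f : FF u -> FF f -> FF (fun x => u x - f x).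
Proof.
by move=> Fu Ff; apply: FF_eq (FF_lin (-1) Ff Fu) => x _; rewrite mulN1r addrC.
Qed.

Lemma scaled_energy_cvg1 u : FF u -> cvgn (fun m => scaled_energy m u u).
Proof.
move=> /FFE[_ [M hM]]; apply: nondecreasing_is_cvgn; first exact: scaled_energy_nd.
by exists M => _ [m _ <-]; exact: hM.
Qed.

(** Polarization reduces this to diagonal energies, whose scaled sequences are monotone and
    bounded. *)
Lemma energy_cvg u f : FF u -> FF f -> scaled_energy m u f @[m --> \oo] --> energy u f.
Proof.
move=> Fu Ff; rewrite energyE.
have h : (fun m => scaled_energy m u f) = (fun m => 2^-1 *
    (scaled_energy m (fun x => 1 * u x + f x) (fun x => 1 * u x + f x)
      - scaled_energy m u u - scaled_energy m f f)).
  apply/funext => m; rewrite !(scaled_energy_linl, scaled_energy_linr) (scaled_energy_sym m f u).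
  by field.
suff : cvgn (fun m => scaled_energy m u f) by [].
rewrite h; apply: is_cvgMr; apply: is_cvgB; last exact: scaled_energy_cvg1.
by apply: is_cvgB; apply: scaled_energy_cvg1 => //; exact: FF_lin.
Qed.

Lemma energy_linl c u f g : FF u -> FF f -> FF g ->
  energy (fun x => c * u x + f x) g = c * energy u g + energy f g.
Proof.
move=> Fu Ff Fg; rewrite energyE; apply/cvg_lim => //.
under eq_fun do rewrite scaled_energy_linl.
by apply: cvgD; [apply: cvgMr|]; exact: energy_cvg.
Qed.

Lemma energy_sym u f : energy u f = energy f u.
Proof. by rewrite !energyE; under eq_fun do rewrite scaled_energy_sym. Qed.

Lemma energy_linr c u f g : FF u -> FF f -> FF g ->
  energy g (fun x => c * u x + f x) = c * energy g u + energy g f.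
Proof. by move=> *; rewrite energy_sym energy_linl // !(energy_sym g). Qed.

Lemma energy_eq u u' f f' : (forall x, K x -> u x = u' x) ->
  (forall x, K x -> f x = f' x) -> energy u f = energy u' f'.
Proof.
move=> uu' ff'; rewrite !energyE.
by under eq_fun do rewrite /scaled_energy (graph_energy_eq _ uu' ff').
Qed.

Lemma scaled_energy_le_energy m u : FF u -> scaled_energy m u u <= energy u u.
Proof.
move=> Fu; rewrite energyE; apply: nondecreasing_cvgn_le; first exact: scaled_energy_nd.
exact: scaled_energy_cvg1.
Qed.

Lemma energy_ge0 u : FF u -> 0 <= energy u u.
Proof. by move=> Fu; apply: le_trans (scaled_energy_le_energy 0 Fu); exact: scaled_energy_ge0. Qed.

Lemma FF_Fmap u i : FF u -> FF (u \o Fmap i).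
Proof.
move=> /FFE [cu [M hM]]; apply/FFE; split; first exact: CK_Fmap.
exists (r * M) => m; have := hM m.+1; rewrite scaled_energyS ler_pdivrMl ?rfac_gt0 //.
apply: le_trans; rewrite (bigD1 i) //= lerDl sumr_ge0 // => j _; exact: scaled_energy_ge0.
Qed.

Lemma FF_Fw u w : FF u -> FF (u \o Fw w).
Proof.
elim: w u => [|i w IH] u Fu; first exact: FF_eq Fu.
exact: (IH (u \o Fmap i) (FF_Fmap i Fu)).
Qed.

Lemma energy_split u f : FF u -> FF f ->
  energy u f = r^-1 * \sum_i energy (u \o Fmap i) (f \o Fmap i).
Proof.
move=> Fu Ff; rewrite [LHS]energyE; apply/cvg_lim => //; rewrite -cvg_shiftS.
under eq_fun do rewrite scaled_energyS big_I3.
rewrite big_I3; apply: cvgMr.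
by apply: cvgD; [apply: cvgD|]; apply: energy_cvg; exact: FF_Fmap.
Qed.

Lemma FF_glue u : (forall i, FF (u \o Fmap i)) -> FF u.
Proof.
move=> Fu; apply/FFE; split; first by apply: CK_glue => i; exact: FF_CK.
exists (r^-1 * \sum_i energy (u \o Fmap i) (u \o Fmap i)) => m.
(* Scaled energies increase with the level, so level m is bounded by level m + 1, which splits over
   the three cells. *)
apply: le_trans (_ : scaled_energy m.+1 u u <= _); first exact: scaled_energy_nd.
rewrite scaled_energyS ler_pM2l ?invr_gt0 ?rfac_gt0 //; apply: ler_sum => i _.
exact: scaled_energy_le_energy.
Qed.

Lemma FF_gluef (f : 'I_3 -> T -> R) :
  (forall i j, f i (qpt R j) = f j (qpt R i)) -> (forall i, FF (f i)) -> FF (glue f).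
Proof.
move=> fq Ff; apply: FF_glue => i; apply: FF_eq (Ff i) => x Kx /=.
by rewrite glueE.
Qed.

Lemma scaled_energy_harm_ext m v u : scaled_energy m (harm_ext v) u = energy_V0 v (u \o @qpt R).
Proof. by rewrite /scaled_energy graph_energy_harm_ext mulKf // rfacX_neq0. Qed.

Lemma energy_harm_ext v u : energy (harm_ext v) u = energy_V0 v (u \o @qpt R).
Proof.
rewrite energyE; apply/cvg_lim => //.
by under eq_fun do rewrite scaled_energy_harm_ext; exact: cvg_cst.
Qed.

Lemma FF_harm_ext v : FF (harm_ext v).
Proof.
apply/FFE; split; first exact: CK_harm_ext.
by exists (energy_V0 v (harm_ext v \o @qpt R)) => m; rewrite scaled_energy_harm_ext.
Qed.

Lemma harmonic_harm_ext v : is_harmonic (harm_ext v).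
Proof.
split=> [|u [_ u0]]; first exact: FF_harm_ext.
by rewrite energy_harm_ext /energy_V0 /= !u0; ring.
Qed.

Lemma Fw_sub w x y : Fw w x - Fw w y = 2^-1 ^+ size w *: (x - y).
Proof.
elim: w => [|i w IH] /=; first by rewrite expr0 scale1r.
rewrite /Fmap opprD addrACA subrr addr0 -scalerBr opprB subrKA.
by rewrite IH scalerA exprS.
Qed.

Lemma cell_size_ex n x : K x -> exists w y, [/\ size w = n, K y & x = Fw w y].
Proof.
elim: n x => [|n IH] x Kx; first by exists [::], x.
have [i [y [Ky ->]]] := gasketE Kx; have [w [z [<- Kz ->]]] := IH y Ky.
by exists (i :: w), z.
Qed.

(** Monotonicity forces every [graph_energy] to vanish, so u takes one value at all vertices. These
    are dense, as cells of level n have diameter of order 2^-n, and u is continuous. *)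
Lemma energy0_cst u : FF u -> energy u u = 0 -> forall x, K x -> u x = u (qpt R 0).
Proof.
move=> Fu u0.
have es0 m : graph_energy m u u = 0.
  have := scaled_energy_le_energy m Fu.
  rewrite u0 /scaled_energy pmulr_rle0 ?invr_gt0 ?rfacX_gt0 //.
  by move=> h; apply/eqP; rewrite eq_le h graph_energy_ge0.
have V w i : u (Fw w (qpt R i)) = u (qpt R 0).
  have e0c (g : T -> R) j k : graph_energy 0 g g = 0 -> g (qpt R j) = g (qpt R k).
    rewrite /= /energy_V0 /= -!expr2 => /eqP; rewrite !paddr_eq0 ?addr_ge0 ?sqr_ge0 //.
    rewrite !sqrf_eq0 !subr_eq0 => /andP[/andP[/eqP e01 /eqP e12] _].
    by move: j k; elim/I3_ind; elim/I3_ind; rewrite ?e01 ?e12.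
  have h m (g : T -> R) j : graph_energy m.+1 g g = 0 ->
      graph_energy m (g \o Fmap j) (g \o Fmap j) = 0.
    move=> /= /eqP; rewrite psumr_eq0; last by move=> *; exact: graph_energy_ge0.
    by move=> /allP/(_ j (mem_index_enum j))/eqP.
  have {es0} : forall m, graph_energy m u u = 0 by [].
  elim: w u {Fu u0} => [|j w IH] u es0 /=; first exact: e0c (es0 0%N).
  have /= -> := IH (u \o Fmap j) (fun m => h m u j (es0 m.+1)).
  rewrite -(e0c u j 0 (es0 0%N)) -(Fmap_fix R j).
  exact: (e0c (u \o Fmap j) 0 j (h 0%N u j (es0 1%N))).
have [M [_ hM]] := compact_bounded (@gasket_compact R).
pose B := 2 * (`|M| + 1).
have Bh x y : K x -> K y -> `|x - y| <= B.
  move=> Kx Ky; apply: le_trans (ler_normB _ _) _.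
  have h := hM (`|M| + 1) (ltr_pwDr ltr01 (ler_norm M)).
  by rewrite /B mulr_natl mulr2n lerD //; exact: h.
move=> x Kx; apply/eqP; apply: contraT => ne.
have /within_continuousP/(_ x Kx)/cvgrPdist_lt/(_ `|u x - u (qpt R 0)|) := FF_CK Fu.
rewrite normr_gt0 subr_eq0 => /(_ ne); rewrite /within /= -nbhs_ballE.
move=> [e /= e0p he].
have [n hn] : exists n, 2^-1 ^+ n * (B + 1) < e.
  have h0 : (2^-1 : R) ^+ n * (B + 1) @[n --> \oo] --> (0 : R).
    rewrite -(mul0r (B + 1)); apply: cvgMl; apply: cvg_expr.
    by rewrite ger0_norm // invf_lt1 // ltr1n.
  have [N _ hN] : \forall n \near \oo, (2^-1 : R) ^+ n * (B + 1) < e.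
    exact: (cvgr_lt _ h0).
  by exists N; apply: hN => /=.
have [w [y [sw Ky xE]]] := cell_size_ex n Kx.
have := he (Fw w (qpt R 0)); rewrite V ltxx => /(_ _ (gasket_Fw _ (gasket_qpt R 0))).
apply; rewrite -ball_normE /= xE Fw_sub normrZ ger0_norm ?exprn_ge0 // sw.
apply: le_lt_trans hn; rewrite ler_wpM2l ?exprn_ge0 //.
by apply: le_trans (Bh _ _ Ky (gasket_qpt R 0)) _; rewrite lerDl.
Qed.

(** The difference from the harmonic extension vanishes on V_0, so both functions are orthogonal to
    it in energy; its own energy is then zero and [energy0_cst] applies. *)
Lemma harmonicE u : is_harmonic u -> forall x, K x -> u x = harm_ext (u \o @qpt R) x.
Proof.
move=> [Fu hu] x Kx; set v := u \o @qpt R.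
pose d x := u x - harm_ext v x.
have Fd : FF d by apply: FF_sub => //; exact: FF_harm_ext.
have d0 i : d (qpt R i) = 0 by rewrite /d harm_ext_qpt subrr.
have dd : energy d d = 0.
  rewrite (@energy_eq d (fun x => -1 * harm_ext v x + u x) d d) //; last first.
    by move=> y _; rewrite mulN1r addrC.
  rewrite energy_linl // ?hu ?energy_harm_ext //; last exact: FF_harm_ext.
  by rewrite /energy_V0 /= !d0; ring.
have := energy0_cst Fd dd Kx; rewrite d0 => /eqP; rewrite subr_eq0 => /eqP //.
Qed.

Lemma harm_ext_extension w v : exists2 f, FF f & forall x, K x -> f (Fw w x) = harm_ext v x.
Proof.
elim: w => [|i w [f Ff fE]]; first by exists (harm_ext v) => //; exact: FF_harm_ext.
(* A sibling cell j carries the harmonic function that matches f at the corner shared with cell i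
   and is zero at its two other corners. *)
pose g j : T -> R := if j == i then f else harm_ext (fun k => if k == i then f (qpt R j) else 0).
have gq j k : g j (qpt R k) = g k (qpt R j).
  rewrite /g; have [->|ji] := eqVneq j i; have [->|ki] := eqVneq k i;
    rewrite ?harm_ext_qpt ?eqxx //.
  by rewrite (negbTE ki) (negbTE ji).
exists (glue g) => [|x Kx /=].
  by apply: FF_gluef => // j; rewrite /g; case: ifP => // _; exact: FF_harm_ext.
by rewrite glueE ?/g ?eqxx ?fE //; exact: gasket_Fw.
Qed.

End Energy.

(** * Borel measurability and charge integrals *)

Section PlaneMeasurability.
Variable R : realType.
Local Notation T := (R * R)%type.
Local Notation K := (@gasket R).
Implicit Types (f g : T -> R) (c : R) (A : set T).

(** The plane carries the product sigma-algebra; an open set is a countable union of boxes with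
    rational centres and radii 1/(n+1). *)
Lemma open_measurable_plane (U : set T) : open U -> measurable U.
Proof.
move=> oU.
pose box (q : rat * rat * nat) : set T :=
  ball (ratr q.1.1 : R) q.2.+1%:R^-1 `*` ball (ratr q.1.2 : R) q.2.+1%:R^-1.
pose F k := if (choice.unpickle k : option (rat * rat * nat)) is Some q then
  if `[< box q `<=` U >] then box q else set0 else set0.
have FE q : box q `<=` U -> F (choice.pickle q) = box q.
  by move=> h; rewrite /F choice.pickleK asboolT.
have -> : U = \bigcup_k F k.
  apply/seteqP; split=> [x Ux|x [k _]]; last first.
    rewrite /F; case: choice.unpickle => // q; case: asboolP => // qU; exact: qU.
  have /nbhs_ballP [e /= e_gt0 eU] : nbhs x U by exact: open_nbhs_nbhs.
  have [n hn] : exists n, n.+1%:R^-1 < e / 2.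
    have [N _ hN] : \forall n \near \oo, n.+1%:R^-1 < e / 2.
      by apply: (cvgr_lt _ (@cvg_harmonic R)); lra.
    by exists N; apply: hN => /=.
  have d_gt0 : 0 < n.+1%:R^-1 :> R by rewrite invr_gt0.
  have near_rat (t d : R) : 0 < d -> exists q : rat, `|ratr q - t| < d.
    move=> d0; have [|q] := @rat_in_itvoo R (t - d) (t + d); first by lra.
    rewrite in_itv /= => /andP[h1 h2]; exists q.
    by rewrite ltr_norml; apply/andP; split; lra.
  have [[p hp] [q hq]] := (near_rat x.1 _ d_gt0, near_rat x.2 _ d_gt0).
  suff bU : box (p, q, n) `<=` U.
    exists (choice.pickle (p, q, n)); first exact: I.
    by rewrite FE //; split; rewrite /= -ball_normE.
  move=> y [/= y1 y2]; apply: eU; split; rewrite /= -ball_normE /= in y1 y2 *.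
    rewrite -(subrKA (ratr p)); apply: le_lt_trans (ler_normD _ _) _.
    rewrite distrC (splitr e); apply: ltrD; [exact: lt_trans hp hn|exact: lt_trans y1 hn].
  rewrite -(subrKA (ratr q)); apply: le_lt_trans (ler_normD _ _) _.
  by rewrite distrC (splitr e); apply: ltrD; [exact: lt_trans hq hn|exact: lt_trans y2 hn].
apply: bigcup_measurable => k _; rewrite /F; case: choice.unpickle => // q.
case: ifP => // _; apply: measurableX; apply: open_measurable; exact: ball_open.
Qed.

Lemma closed_measurable_plane A : closed A -> measurable A.
Proof. by move/closed_openC/open_measurable_plane/measurableC; rewrite setCK. Qed.

Lemma measurable_gasket : measurable K.
Proof. by apply: closed_measurable_plane; exact: gasket_closed. Qed.

Lemma measurable_cell w : measurable (@cell R w).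
Proof. by apply: closed_measurable_plane; exact: cell_closed. Qed.

Lemma measurable_set1 (x : T) : measurable [set x].
Proof.
by apply: closed_measurable_plane; apply: accessible_closed_set1;
  apply: hausdorff_accessible; exact: norm_hausdorff.
Qed.

Lemma CK_measurable f : CK f -> measurable_fun K f.
Proof.
move=> /continuousP cf; apply: (measurability _ (RGenOpens.measurableE R)).
move=> _ [_ [a [b ->] <-]]; have := cf _ (interval_open (a := BRight a) (b := BLeft b) isT isT).
move=> /open_subspaceP [V oV VD]; rewrite setIC -VD.
by apply: measurableI; [exact: open_measurable_plane|exact: measurable_gasket].
Qed.

Lemma CK_bounded_borel f : CK f -> bounded_borel f.
Proof.
by move=> cf; split; [exact: CK_measurable|have [M _ h] := CK_bounded cf; exists M].
Qed.

Lemma bounded_borel_lin c f g : bounded_borel f -> bounded_borel g ->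
  bounded_borel (fun x => c * f x + g x).
Proof.
move=> [mf [M hM]] [mg [N hN]]; split.
  by apply: measurable_funD => //; apply: measurable_funM.
exists (`|c| * M + N) => x Kx; apply: le_trans (ler_normD _ _) _.
by rewrite lerD ?hN // normrM ler_wpM2l // hM.
Qed.

Lemma bounded_borelM f g : bounded_borel f -> bounded_borel g -> bounded_borel (f \* g).
Proof.
move=> [mf [M hM]] [mg [N hN]]; split; first exact: measurable_funM.
exists (M * N) => x Kx /=; rewrite normrM ler_pM ?hM ?hN //.
Qed.

Lemma bounded_borel_indic A : measurable A -> bounded_borel (\1_A : T -> R).
Proof.
move=> mA; split; first exact: measurable_indic.
by exists 1 => x _; rewrite indicE; case: (_ \in _); rewrite ?normr1 ?normr0.
Qed.

Lemma bounded_borel_cst c : bounded_borel (cst c : T -> R).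
Proof. by split; [exact: measurable_cst|exists `|c|]. Qed.

Lemma bounded_borel_integrable (mu : {finite_measure set T -> \bar R}) f :
  bounded_borel f -> mu.-integrable K (EFin \o f).
Proof.
move=> [mf [M hM]]; apply: measurable_bounded_integrable => //.
- exact: measurable_gasket.
- by rewrite ltey_eq fin_num_measure //; exact: measurable_gasket.
- exists M; split; first exact: num_real.
  by move=> N MN x Kx; apply: le_trans (ltW MN); exact: hM.
Qed.

Lemma Rintegral_dominated (mu : {finite_measure set T -> \bar R}) (f_ : nat -> T -> R)
    f (M : R) :
  (forall n, measurable_fun K (f_ n)) -> measurable_fun K f ->
  (forall n x, K x -> `|f_ n x| <= M) ->
  (forall x, K x -> f_ n x @[n --> \oo] --> f x) ->
  \int[mu]_(x in K) f_ n x @[n --> \oo] --> \int[mu]_(x in K) f x.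
Proof.
move=> mf_ mf hM f_f.
have [|||||ifx _ h] := @dominated_convergence _ T R mu K measurable_gasket
  (fun n => EFin \o f_ n) (EFin \o f) (cst M%:E).
- by move=> n; exact/measurable_EFinP.
- exact/measurable_EFinP.
- by apply: aeW => x Kx; apply: cvg_EFin; [exact: nearW|exact: f_f].
- exact: bounded_borel_integrable (bounded_borel_cst M).
- by apply: aeW => x n Kx /=; rewrite lee_fin; exact: hM.
have fx : (\int[mu]_(x in K) (f x)%:E)%E \is a fin_num.
  by apply: integrable_fin_num ifx; exact: measurable_gasket.
by rewrite /Rintegral; apply: fine_cvg; rewrite fineK.
Qed.
End PlaneMeasurability.

Section ChargeIntegral.
Variable R : realType.
Local Notation T := (R * R)%type.
Local Notation K := (@gasket R).
Variable m : {charge set T -> \bar R}.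
Implicit Types (f g : T -> R) (c : R) (A : set T).

Let mp : {finite_measure set T -> \bar R} := jordan_pos (svalP (hahnPN m)).
Let mn : {finite_measure set T -> \bar R} := jordan_neg (svalP (hahnPN m)).

Let ciE f : charge_integral m f = \int[mp]_(x in K) f x - \int[mn]_(x in K) f x.
Proof. by []. Qed.

Lemma charge_integral_eq f g : (forall x, K x -> f x = g x) ->
  charge_integral m f = charge_integral m g.
Proof.
move=> e; rewrite !ciE; congr (_ - _); apply: eq_Rintegral => x /set_mem; exact: e.
Qed.

Lemma charge_integral_lin c f g : bounded_borel f -> bounded_borel g ->
  charge_integral m (fun x => c * f x + g x) = c * charge_integral m f + charge_integral m g.
Proof.
move=> bf bg; rewrite !ciE.
have bcf : bounded_borel (fun x => c * f x).
  rewrite (_ : (fun x => _) = (fun x => c * f x + cst 0 x)).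
    by apply: bounded_borel_lin => //; exact: bounded_borel_cst.
  by apply/funext => x /=; rewrite addr0.
have mK : measurable K := @measurable_gasket R.
have h (mu : {finite_measure set T -> \bar R}) :
    \int[mu]_(x in K) (c * f x + g x) = c * \int[mu]_(x in K) f x + \int[mu]_(x in K) g x.
  rewrite RintegralD //; [|exact: bounded_borel_integrable..].
  by rewrite RintegralZl //; exact: bounded_borel_integrable.
by rewrite !h; ring.
Qed.

Lemma charge_integral_indic A : measurable A ->
  charge_integral m (\1_A : T -> R) = fine (m (A `&` K)).
Proof.
move=> mA; have mAK : measurable (A `&` K).
  by apply: measurableI => //; exact: measurable_gasket.
rewrite ciE (jordan_decomp (svalP (hahnPN m)) mAK) /cadd /= cscaleN1.
rewrite /Rintegral !integral_indic //; try exact: measurable_gasket.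
by rewrite fineB // fin_num_measure.
Qed.

Lemma charge_integral_dominated (f_ : nat -> T -> R) f (M : R) :
  (forall n, measurable_fun K (f_ n)) -> measurable_fun K f ->
  (forall n x, K x -> `|f_ n x| <= M) ->
  (forall x, K x -> f_ n x @[n --> \oo] --> f x) ->
  charge_integral m (f_ n) @[n --> \oo] --> charge_integral m f.
Proof.
move=> mf_ mf hM f_f; rewrite ciE; under eq_fun do rewrite ciE.
by apply: cvgB; exact: Rintegral_dominated mf_ mf hM f_f.
Qed.

Lemma charge_integral_bound f (M : R) : bounded_borel f ->
  (forall x, K x -> `|f x| <= M) ->
  `|charge_integral m f| <= M * fine (charge_variation (svalP (hahnPN m)) K).
Proof.
move=> bf hM; have mK : measurable K := @measurable_gasket R.
have h (mu : {finite_measure set T -> \bar R}) :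
    `|\int[mu]_(x in K) f x| <= M * fine (mu K).
  apply: le_trans (le_normr_Rintegral mK (bounded_borel_integrable mu bf)) _.
  rewrite -Rintegral_cst //; apply: le_Rintegral => //.
  - apply: bounded_borel_integrable; case: bf => mf _; split.
      exact: measurableT_comp.
    by exists M => x Kx; rewrite normr_id; exact: hM.
  - exact: bounded_borel_integrable (bounded_borel_cst M).
rewrite ciE; apply: le_trans (ler_normB _ _) _.
rewrite /charge_variation /= fineD ?fin_num_measure // mulrDr.
by rewrite lerD // h.
Qed.

(** Norms of symbols are integrals against the charge, while [L2norm_sq] uses its variation; p - n
    <= p + n for the Jordan parts compares the two. *)
Lemma charge_integral_sqr_le f : bounded_borel f ->
  ((charge_integral m (f \* f))%:E <=
    L2norm_sq (charge_variation (svalP (hahnPN m))) f)%E.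
Proof.
move=> bf; have mK : measurable K := @measurable_gasket R.
have bff := bounded_borelM bf bf.
have -> : L2norm_sq (charge_variation (svalP (hahnPN m))) f =
    (\int[measure_add mp mn]_(x in K) ((f x) ^+ 2)%:E)%E.
  by apply: eq_measure_integral => A mA _; rewrite [RHS]measure_addE.
have fE : (fun x => ((f x) ^+ 2)%:E) = EFin \o (f \* f).
  by apply/funext => x /=; rewrite expr2.
rewrite fE ge0_integral_measure_add //; first last.
- by apply/measurable_EFinP; case: bff.
- by move=> x Kx /=; rewrite lee_fin -expr2 sqr_ge0.
rewrite -(@fineK _ (\int[mp]_(x in K) _)%E); last first.
  apply: (integrable_fin_num mK); exact: (bounded_borel_integrable mp bff).
rewrite -(@fineK _ (\int[mn]_(x in K) _)%E); last first.
  apply: (integrable_fin_num mK); exact: (bounded_borel_integrable mn bff).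
have n0 : 0 <= \int[mn]_(x in K) (f \* f) x.
  by apply: Rintegral_ge0 => x _ /=; rewrite -expr2 sqr_ge0.
rewrite -EFinD lee_fin ciE; apply: lerD => //.
by apply: le_trans (n0); rewrite oppr_le0.
Qed.
End ChargeIntegral.

(** * Energy measures and one-forms *)

Section EnergyMeasures.
Variable R : realType.
Local Notation T := (R * R)%type.
Local Notation word := (seq 'I_3).
Local Notation K := (@gasket R).
Local Notation r := (@rfac R).
Variable nu : (T -> R) -> (T -> R) -> {charge set T -> \bar R}.
Hypothesis nuE : energy_measures nu.
Implicit Types (x y : T) (i j k : 'I_3) (w v : word) (u f g : T -> R) (c : R) (A B : set T).

Let M u f A : R := fine (nu u f A).

Lemma charge_setU_fine (m : {charge set T -> \bar R}) A B : measurable A -> measurable B ->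
  fine (m (A `|` B)) = fine (m A) + fine (m B) - fine (m (A `&` B)).
Proof.
move=> mA mB.
have add C D : measurable C -> measurable D -> C `&` D = set0 ->
    fine (m (C `|` D)) = fine (m C) + fine (m D).
  by move=> mC mD CD; rewrite chargeU // fineD //; exact: fin_num_measure.
have -> : A `|` B = A `|` (B `\` A).
  by apply/seteqP; split => x [Ax|]; [left|have [] := pselect (A x); [left|right]|left|case; right].
rewrite add //; [|exact: measurableD|by rewrite setDE setICA setICr setI0].
have -> : fine (m B) = fine (m (B `\` A)) + fine (m (A `&` B)); last by ring.
rewrite -add.
- congr (fine (m _)); apply/seteqP; split=> x; last by case=> [[]|[]].
  by move=> Bx; have [Ax|nAx] := pselect (A x); [right|left].
- exact: measurableD.
- exact: measurableI.
- by rewrite -subset0 => x [[_ nA] [Ax _]]; exact: nA.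
Qed.

Lemma nu_cell u f w : FF u -> FF f ->
  fine (nu u f (cell w)) = r ^- size w * energy (u \o Fw w) (f \o Fw w).
Proof. by move=> Fu Ff; have [_ ->] := nuE Fu Ff. Qed.

Lemma bary_Fw_nseq j n x : bary j (Fw (nseq n j) x) = 1 - 2^-1 ^+ n * (1 - bary j x).
Proof.
elim: n => [|n IH] /=; first by rewrite expr0; ring.
by rewrite bary_Fmap eqxx IH exprS /=; field.
Qed.

(** The cells w j^n shrink to the corner, because [bary j] is at least 1 - 2^-n on the cell j^n. *)
Lemma cell_corner_eventually j w x : K x -> x <> Fw w (qpt R j) ->
  \forall n \near \oo, ~ cell (w ++ nseq n j) x.
Proof.
move=> Kx ne.
have [cx|ncx] := pselect (cell w x); last first.
  by exists 0%N => // n _ /cell_catS.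
have [y Ky yE] := cx; rewrite -yE in ne *.
have ty := gasket_triangle Ky.
have ly : 0 < 1 - bary j y.
  rewrite lt_neqAle subr_ge0 triangle_le1 // andbT eq_sym subr_eq0 eq_sym.
  by apply/eqP => l1; apply: ne; rewrite (triangle_bary1 ty l1).
have h0 : (2^-1 : R) ^+ n @[n --> \oo] --> (0 : R).
  by apply: cvg_expr; rewrite ger0_norm // invf_lt1 // ltr1n.
have : \forall n \near \oo, (2^-1 : R) ^+ n < 1 - bary j y by exact: (cvgr_lt _ h0).
apply: filterS => n hn; rewrite cell_cat => -[z [z' Kz' <-] /(can_inj (FwK w)) e].
move: hn; rewrite -e bary_Fw_nseq; have tz := gasket_triangle Kz'.
have := triangle_le1 j tz; have := tz j.
have : 0 <= (2^-1 : R) ^+ n by rewrite exprn_ge0.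
by move: (_ ^+ n) (bary j z') => a b; nra.
Qed.

(** Dominated convergence of the indicators of the cells w j^n: masses of points become limits of
    masses of cells, the only ones that are given. *)
Lemma atom_cvg u f w j : FF u -> FF f ->
  r ^- size (w ++ nseq n j) * energy (u \o Fw (w ++ nseq n j)) (f \o Fw (w ++ nseq n j))
    @[n --> \oo] --> fine (nu u f [set Fw w (qpt R j)]).
Proof.
move=> Fu Ff; set p := Fw w (qpt R j).
have Kp : K p by apply: gasket_Fw; exact: gasket_qpt.
have -> : [set p] = [set p] `&` K.
  by rewrite setIidl // => _ ->.
rewrite -charge_integral_indic; last exact: measurable_set1.
rewrite (_ : (fun n => _) =
    (fun n => charge_integral (nu u f) (\1_(cell (w ++ nseq n j))))).
  apply: (@charge_integral_dominated _ _ _ _ 1).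
  - by move=> n; apply: measurable_indic; exact: measurable_cell.
  - by apply: measurable_indic; exact: measurable_set1.
  - by move=> n x _; rewrite indicE; case: (_ \in _); rewrite ?normr1 ?normr0.
  - move=> x Kx; have [->|ne] := pselect (x = p).
      have h n : cell (w ++ nseq n j) p.
        by exists (qpt R j); [exact: gasket_qpt|rewrite Fw_cat Fw_nseq_fix].
      rewrite !indicE mem_set //.
      by under eq_fun do rewrite indicE mem_set //; exact: cvg_cst.
    apply: cvg_near_cst; apply: filterS (cell_corner_eventually Kx ne) => n h.
    by rewrite !indicE memNset // memNset.
apply/funext => n; rewrite charge_integral_indic; last exact: measurable_cell.
by rewrite setIidl ?nu_cell //; exact: cell_sub.
Qed.

Lemma FF_energy_scale w u f : FF u -> FF f ->
  r ^- size w * energy (u \o Fw w) (f \o Fw w) =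
  \sum_i r ^- size (rcons w i) * energy (u \o Fw (rcons w i)) (f \o Fw (rcons w i)).
Proof.
move=> Fu Ff; rewrite energy_split; [|exact: FF_Fw..].
rewrite mulrA -invfM -exprSr mulr_sumr; apply: eq_bigr => i _.
rewrite size_rcons; congr (_ * _).
by apply: energy_eq => x _ /=; rewrite Fw_rcons.
Qed.

(** The mass of a cell is the sum of the masses of its three children, so by inclusion-exclusion the
    masses of the three junction points add up to zero. Each is nonnegative as a limit of scaled
    energies. *)
Let junction_self u w i j : FF u -> i != j ->
  fine (nu u u [set Fw w (Fmap i (qpt R j))]) = 0.
Proof.
move=> Fu.
pose p i j := [set Fw w (Fmap i (qpt R j))].
have mp k l : measurable (p k l) by exact: measurable_set1.
pose c i := @cell R (rcons w i).
have mc k : measurable (c k) by exact: measurable_cell.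
have cc k l : k != l -> c k `&` c l = p k l.
  move=> kl; apply/seteqP; split.
    by have := @cell_meet R w k l [::] [::] kl; rewrite !cats1.
  move=> _ ->; split; [exists (qpt R l)|exists (qpt R k)]; try exact: gasket_qpt.
    by rewrite Fw_rcons.
  by rewrite Fw_rcons Fmap_swap.
have pp : p 0 2 `&` p 1 2 = set0.
  rewrite -subset0 => x [-> /(can_inj (FwK w))].
  by rewrite (Fmap_swap _ 0 2) (Fmap_swap _ 1 2) => /Fmap_inj /qpt_inj.
have ge0 k l : 0 <= M u u (p k l).
  have := @atom_cvg u u (rcons w k) l Fu Fu; rewrite Fw_rcons => h.
  apply: (cvgr_to_ge h); apply: nearW => n.
  rewrite mulr_ge0 ?invr_ge0 ?(ltW (rfacX_gt0 _ _)) //.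
  by apply: energy_ge0; exact: FF_Fw.
have sum0 : M u u (p 0 1) + M u u (p 0 2) + M u u (p 1 2) = 0.
  have : M u u (cell w) = M u u (c 0) + M u u (c 1) + M u u (c 2).
    by rewrite /M !nu_cell // FF_energy_scale // big_I3.
  rewrite cell_split /M (charge_setU_fine _ (measurableU _ _ (mc 0) (mc 1)) (mc 2)).
  rewrite (charge_setU_fine _ (mc 0) (mc 1)) setIUl !cc //.
  rewrite (charge_setU_fine _ (mp 0 2) (mp 1 2)) pp.
  by rewrite charge0 /=; lra.
have := ge0 0 1; have := ge0 0 2; have := ge0 1 2.
have sym k l : p k l = p l k by rewrite /p Fmap_swap.
move=> h12 h02 h01.
have z01 : M u u (p 0 1) = 0 by lra.
have z02 : M u u (p 0 2) = 0 by lra.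
have z12 : M u u (p 1 2) = 0 by lra.
by move: i j; elim/I3_ind; elim/I3_ind => //= _; rewrite -/(p _ _) ?(sym 1 0) ?(sym 2 0) ?(sym 2 1).
Qed.

(** Bilinearity is available for energies, so polarization is carried out on the cell masses that
    converge to the atom, and then passes to the limit. *)
Lemma nu_junction u f w i j : FF u -> FF f -> i != j ->
  fine (nu u f [set Fw w (Fmap i (qpt R j))]) = 0.
Proof.
move=> Fu Ff ij; pose g x := 1 * u x + f x.
have Fg : FF g by exact: FF_lin.
pose w' := rcons w i.
have [hg hu hf huf] := (And4 (@atom_cvg g g w' j Fg Fg) (@atom_cvg u u w' j Fu Fu)
  (@atom_cvg f f w' j Ff Ff) (@atom_cvg u f w' j Fu Ff)).
rewrite Fw_rcons in hg hu hf huf.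
rewrite !junction_self // in hg hu hf.
have h : r ^- size (w' ++ nseq n j) *
    energy (u \o Fw (w' ++ nseq n j)) (f \o Fw (w' ++ nseq n j)) @[n --> \oo] --> (0 : R).
  rewrite (_ : (fun n => _) = (fun n => 2^-1 * (
     r ^- size (w' ++ nseq n j) * energy (g \o Fw (w' ++ nseq n j)) (g \o Fw (w' ++ nseq n j))
   - r ^- size (w' ++ nseq n j) * energy (u \o Fw (w' ++ nseq n j)) (u \o Fw (w' ++ nseq n j))
   - r ^- size (w' ++ nseq n j) * energy (f \o Fw (w' ++ nseq n j)) (f \o Fw (w' ++ nseq n j))))).
    rewrite -[X in _ --> X](mulr0 2^-1); apply: cvgMr.
    by rewrite -[X in _ --> X](subr0 0) -[X in _ --> X - _](subr0 0);
      apply: cvgB hf; apply: cvgB hu.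
  apply/funext => n; move: (w' ++ nseq n j) => z.
  have [Fuz Ffz] : FF (u \o Fw z) /\ FF (f \o Fw z) by split; exact: FF_Fw.
  have -> : energy (g \o Fw z) (g \o Fw z) =
      energy (u \o Fw z) (u \o Fw z) + 2 * energy (u \o Fw z) (f \o Fw z)
      + energy (f \o Fw z) (f \o Fw z).
    have Fgz : FF (g \o Fw z) by exact: FF_Fw.
    rewrite [LHS](energy_linl 1 Fuz Ffz Fgz).
    rewrite (energy_linr 1 Fuz Ffz Fuz) (energy_linr 1 Fuz Ffz Ffz) (energy_sym (f \o _) (u \o _)).
    by ring.
  by field; exact: rfacX_neq0.
exact: (cvg_unique (@Rhausdorff R) huf h).
Qed.

(** * Inner product calculus in the space of one-forms *)

Variable H : one_forms nu.
Local Notation form := (oneform H).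
Implicit Types X Y Z : form.

Lemma ip_linl c X Y Z : form_ip (c *: X + Y) Z = c * form_ip X Z + form_ip Y Z.
Proof. exact: form_ipP. Qed.

Lemma ip0l Z : form_ip (0 : form) Z = 0.
Proof.
have := ip_linl 1 0 0 Z; rewrite scale1r addr0 mul1r => /eqP.
by rewrite -subr_eq0 opprD addrA subrr sub0r oppr_eq0 => /eqP.
Qed.

Lemma ipDl X Y Z : form_ip (X + Y) Z = form_ip X Z + form_ip Y Z.
Proof. by have := ip_linl 1 X Y Z; rewrite scale1r mul1r. Qed.

Lemma ipZl c X Z : form_ip (c *: X) Z = c * form_ip X Z.
Proof. by have := ip_linl c X 0 Z; rewrite addr0 ip0l addr0. Qed.

Lemma ipBl X Y Z : form_ip (X - Y) Z = form_ip X Z - form_ip Y Z.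
Proof. by rewrite ipDl -scaleN1r ipZl mulN1r. Qed.

Lemma ip0r Z : form_ip Z (0 : form) = 0.
Proof. by rewrite form_ipC ip0l. Qed.

Lemma ipDr X Y Z : form_ip Z (X + Y) = form_ip Z X + form_ip Z Y.
Proof. by rewrite form_ipC ipDl !(form_ipC Z). Qed.

Lemma ipZr c X Z : form_ip Z (c *: X) = c * form_ip Z X.
Proof. by rewrite form_ipC ipZl (form_ipC Z). Qed.

Lemma ipBr X Y Z : form_ip Z (X - Y) = form_ip Z X - form_ip Z Y.
Proof. by rewrite form_ipC ipBl !(form_ipC Z). Qed.

Lemma ip_suml (I : Type) (s : seq I) (P : pred I) (F : I -> form) Z :
  form_ip (\sum_(i <- s | P i) F i) Z = \sum_(i <- s | P i) form_ip (F i) Z.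
Proof. by apply: (big_morph (fun X => form_ip X Z)) => [X Y|]; [exact: ipDl|exact: ip0l]. Qed.

Lemma ip_sumr (I : Type) (s : seq I) (P : pred I) (F : I -> form) Z :
  form_ip Z (\sum_(i <- s | P i) F i) = \sum_(i <- s | P i) form_ip Z (F i).
Proof. by rewrite form_ipC ip_suml; under eq_bigr do rewrite form_ipC. Qed.

Lemma ip_cauchy_schwarz X Y : `|form_ip X Y| <= `|X| * `|Y|.
Proof.
have [->|Y0] := eqVneq Y 0; first by rewrite ip0r !normr0 mulr0.
have Yp : 0 < `|Y| by rewrite normr_gt0.
have := form_ip_norm (X - (form_ip X Y / `|Y| ^+ 2) *: Y).
rewrite ipBl !ipBr !ipZl !ipZr !form_ip_norm (form_ipC Y X) => e.
have h : 0 <= `|X| ^+ 2 - form_ip X Y ^+ 2 / `|Y| ^+ 2.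
  rewrite (_ : _ - _ = `|X - (form_ip X Y / `|Y| ^+ 2) *: Y| ^+ 2) ?sqr_ge0 // -e.
  by field; rewrite gt_eqF.
rewrite -(@ler_pXn2r _ 2) ?nnegrE ?mulr_ge0 // exprMn real_normK ?num_real //.
by move: h; rewrite subr_ge0 ler_pdivrMr ?exprn_gt0.
Qed.

Lemma ip_cvgl (I : Type) (D : set_system I) {DF : Filter D} (F : I -> form) X Y :
  F i @[i --> D] --> X -> form_ip (F i) Y @[i --> D] --> form_ip X Y.
Proof.
move=> /cvgrPdist_lt FX; apply/cvgrPdist_lt => e e0.
have Y0 : 0 < `|Y| + 1 by rewrite ltr_pwDr.
have := FX (e / (`|Y| + 1)) (divr_gt0 e0 Y0); apply: filterS => i h.
rewrite -ipBl; apply: le_lt_trans (ip_cauchy_schwarz _ _) _.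
apply: le_lt_trans (_ : `|X - F i| * (`|Y| + 1) < _).
  by rewrite ler_wpM2l // lerDl.
by rewrite -ltr_pdivlMr.
Qed.

Lemma form_eq0 X : form_ip X X = 0 -> X = 0.
Proof. by rewrite form_ip_norm => /eqP; rewrite sqrf_eq0 normr_eq0 => /eqP. Qed.

(** By boundedness, the test form may be replaced by a nearby finite sum of symbols, which exists by
    density. *)
Lemma weak_cvg (F : nat -> form) X (B : R) :
  (forall n, `|F n| <= B) ->
  (forall f u, CK f -> FF u ->
     form_ip (F n) (form_symb H f u) @[n --> \oo] --> form_ip X (form_symb H f u)) ->
  forall Y, form_ip (F n) Y @[n --> \oo] --> form_ip X Y.
Proof.
move=> FB hs Y; apply/cvgrPdist_lt => e e0.
pose C := `|X| + `|B| + 1.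
have C0 : 0 < C by rewrite /C ltr_pwDr // addr_ge0.
have d0 : 0 < e / (2 * C) by rewrite divr_gt0 // mulr_gt0.
have ne : ball Y (e / (2 * C)) !=set0 by exists Y; exact: ballxx.
have [S [SY [s hS SE]]] := @form_symb_dense R nu H _ ne (ball_open Y _).
have SX : form_ip (F n) S @[n --> \oo] --> form_ip X S.
  rewrite {}SE; elim: s hS => [_|[f u] s IH hS].
    by rewrite big_nil; under eq_fun do rewrite ip0r; rewrite ip0r; exact: cvg_cst.
  have [cf Fu] := hS (f, u) (mem_head _ _).
  rewrite big_cons ipDr; under eq_fun do rewrite ipDr.
  apply: cvgD; first exact: hs.
  by apply: IH => fu fus; apply: hS; rewrite inE fus orbT.
have e2 : 0 < e / 2 by lra.
move: SX => /cvgrPdist_lt/(_ _ e2); apply: filterS => n h.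
rewrite -ipBl; rewrite -(subrK S Y) ipDr; apply: le_lt_trans (ler_normD _ _) _.
rewrite (splitr e); apply: ltr_leD; last by rewrite ipBl; exact: ltW.
apply: le_lt_trans (ip_cauchy_schwarz _ _) _.
have XC : `|X - F n| < C.
  apply: le_lt_trans (ler_normB _ _) _; rewrite /C -addrA ler_ltD //.
  by apply: le_lt_trans (FB n) _; apply: le_lt_trans (ler_norm B) _; rewrite ltrDl.
move: SY; rewrite -ball_normE /= => SY.
apply: le_lt_trans (_ : C * `|Y - S| < _); first by rewrite ler_wpM2r // ltW.
rewrite mulrC -ltr_pdivlMr //; apply: lt_le_trans SY _.
by rewrite (_ : e / (2 * C) = e / 2 / C) // invfM mulrA.
Qed.

Lemma CK_1 : CK (cst 1 : T -> R). Proof. exact: CK_cst. Qed.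

Lemma ip_dform u f : FF u -> FF f -> form_ip (dform H u) (dform H f) = energy u f.
Proof.
move=> Fu Ff; rewrite /dform form_ip_symb //; try exact: CK_1.
rewrite (@charge_integral_eq _ _ _ (\1_(cell [::]))).
  rewrite charge_integral_indic; last exact: measurable_cell.
  rewrite cell_nil setIid -(cell_nil R) nu_cell //= expr0 invr1 mul1r.
  exact: energy_eq.
by move=> x Kx /=; rewrite indicE mem_set ?mulr1 // cell_nil.
Qed.

Lemma ip_act_dform u f w : FF u -> FF f ->
  form_ip (form_act (\1_(cell w)) (dform H u)) (dform H f) =
  r ^- size w * energy (u \o Fw w) (f \o Fw w).
Proof.
move=> Fu Ff; rewrite /dform form_act_symb //; try exact: CK_1; last first.
  by apply: bounded_borel_indic; exact: measurable_cell.
rewrite (@charge_integral_eq _ _ _ (\1_(cell w))); last by move=> x _ /=; rewrite !mulr1.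
rewrite charge_integral_indic; last exact: measurable_cell.
by rewrite setIidl ?nu_cell //; exact: cell_sub.
Qed.

(** The sum is twice the total negative part of the barycentric coordinates of [Fwinv w x]. By
    [cellP] the base of the power is 1 on the cell and smaller than 1 on the rest of the gasket. *)
Definition bump w n x : R :=
  ((1 + \sum_i (`|bary i (Fwinv w x)| - bary i (Fwinv w x)))^-1) ^+ n.

Lemma bump_den_ge1 w x : 1 <= 1 + \sum_i (`|bary i (Fwinv w x)| - bary i (Fwinv w x)).
Proof. by rewrite lerDl sumr_ge0 // => i _; rewrite subr_ge0 ler_norm. Qed.

Lemma bump_ge0 w n x : 0 <= bump w n x.
Proof. by rewrite exprn_ge0 // invr_ge0 (le_trans ler01) // bump_den_ge1. Qed.

Lemma bump_le1 w n x : bump w n x <= 1.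
Proof.
rewrite exprn_ile1 // ?invr_ge0 ?(le_trans ler01) ?bump_den_ge1 //.
by rewrite invf_le1 ?(lt_le_trans ltr01) ?bump_den_ge1.
Qed.

Lemma CK_bump w n : CK (bump w n).
Proof.
apply: CK_continuous => x.
have cl i : {for x, continuous (fun x => bary i (Fwinv w x))}.
  apply: (@continuous_comp _ _ _ (Fwinv w) (bary i)); first exact: continuous_Fwinv.
  exact: continuous_bary.
have c1 : {for x, continuous (fun x =>
    (1 + \sum_i (`|bary i (Fwinv w x)| - bary i (Fwinv w x)))^-1)}.
  apply: cvgV; first by rewrite gt_eqF // (lt_le_trans ltr01) // bump_den_ge1.
  apply: cvgD; first exact: cvg_cst.
  have cd i : `|bary i (Fwinv w y)| - bary i (Fwinv w y) @[y --> x] -->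
      `|bary i (Fwinv w x)| - bary i (Fwinv w x).
    by apply: cvgB; [apply: cvg_norm|]; exact: cl.
  rewrite big_I3; under eq_fun do rewrite big_I3.
  by apply: cvgD; [apply: cvgD|]; exact: cd.
exact: (continuous_comp c1 (@exprn_continuous R n _)).
Qed.

Lemma bump_cvg w x : K x -> bump w n x @[n --> \oo] --> (\1_(cell w) x : R).
Proof.
move=> Kx; rewrite indicE.
have [cx|ncx] := pselect (cell w x).
  rewrite mem_set //; have [_ tx] := (cellP w x).1 cx.
  rewrite (_ : bump w ^~ x = cst 1); first exact: cvg_cst.
  apply/funext => n; rewrite /bump big1 ?addr0 ?invr1 ?expr1n // => i _.
  by rewrite ger0_norm ?subrr //; exact: tx.
rewrite memNset //; apply: cvg_expr.
have nt : ~ triangle (Fwinv w x) by move=> tx; apply: ncx; apply/cellP.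
have [i hi] : exists i, ~ 0 <= bary i (Fwinv w x).
  by apply/existsNP => h; apply: nt.
have den1 : 1 < 1 + \sum_i (`|bary i (Fwinv w x)| - bary i (Fwinv w x)).
  rewrite ltrDl (bigD1 i) //=; apply: ltr_pwDl.
    by move/negP: hi; rewrite -ltNge => hi; rewrite ltr0_norm //; lra.
  by apply: sumr_ge0 => j _; rewrite subr_ge0 ler_norm.
rewrite ger0_norm ?invr_ge0 ?(ltW (lt_trans ltr01 den1)) //.
by rewrite invf_lt1 // (lt_trans ltr01).
Qed.

(* The bumps [bump w n] tend weakly to the indicator of the cell; this is how the product
   of two cell indicators is computed, since the action is only specified on symbols. *)
Lemma ip_act_act u f w v : FF u -> FF f ->
  form_ip (form_act (\1_(cell w)) (dform H u)) (form_act (\1_(cell v)) (dform H f)) =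
  fine (nu f u (cell w `&` cell v)).
Proof.
move=> Fu Ff; have mc z := @measurable_cell R z.
have bb n : bounded_borel (bump w n) by apply: CK_bounded_borel; exact: CK_bump.
have b1 z : bounded_borel (\1_(cell z) : T -> R) by exact: bounded_borel_indic.
pose Z n := form_symb H (bump w n) u.
have abs1 n x : `|bump w n x| <= 1 by rewrite ger0_norm ?bump_ge0 ?bump_le1.
have cvgI (m : {charge set T -> \bar R}) g : bounded_borel g ->
    charge_integral m (fun x => bump w n x * g x) @[n --> \oo] -->
    charge_integral m (fun x => \1_(cell w) x * g x).
  move=> bg; have [mg [N hN]] := bg.
  apply: (@charge_integral_dominated _ _ _ _ N).
  - by move=> n; have [] := bounded_borelM (bb n) bg.
  - by have [] := bounded_borelM (b1 w) bg.
  - move=> n x Kx; rewrite normrM -[leRHS]mul1r.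
    by apply: ler_pM => //; exact: hN.
  - by move=> x Kx; apply: cvgMl; exact: bump_cvg.
have [b hb] : exists b : R, forall n, `|Z n| <= b.
  exists (Num.sqrt (1 * fine (charge_variation (svalP (hahnPN (nu u u))) K))) => n.
  rewrite -[leLHS]ger0_norm // -sqrtr_sqr ler_wsqrtr // -form_ip_norm.
  rewrite /Z form_ip_symb //; try exact: CK_bump.
  apply: le_trans (ler_norm _) _; apply: charge_integral_bound.
    exact: bounded_borelM.
  by move=> x Kx /=; rewrite normrM mulr_ile1.
have weak := weak_cvg (X := form_act (\1_(cell w)) (dform H u)) hb.
have {weak} weak : forall Y, form_ip (Z n) Y @[n --> \oo] -->
    form_ip (form_act (\1_(cell w)) (dform H u)) Y.
  apply: weak => g z cg Fz; rewrite /dform form_act_symb //; last exact: CK_1.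
  rewrite (@charge_integral_eq _ _ _ (fun x => \1_(cell w) x * g x)).
    rewrite (_ : (fun n => _) = (fun n => charge_integral (nu u z) (fun x => bump w n x * g x))).
      by apply: cvgI; exact: CK_bounded_borel.
    by apply/funext => n; rewrite /Z form_ip_symb //; exact: CK_bump.
  by move=> x _ /=; rewrite mulr1.
have := weak (form_act (\1_(cell v)) (dform H f)).
have cI := cvgI (nu f u) _ (b1 v).
rewrite (_ : (fun n => form_ip (Z n) _) =
    (fun n => charge_integral (nu f u) (fun x => bump w n x * \1_(cell v) x))); last first.
  apply/funext => n; rewrite form_ipC /dform form_act_symb //; [|exact: CK_1|exact: CK_bump].
  by apply: charge_integral_eq => x _ /=; rewrite mulr1 mulrC.
move=> h; rewrite -(cvg_unique (@Rhausdorff R) cI h).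
rewrite (@charge_integral_eq _ _ _ (\1_(cell w `&` cell v))).
  rewrite charge_integral_indic; last exact: measurableI.
  by rewrite setIidl // => x [/cell_sub].
by move=> x _; rewrite indicI.
Qed.
End EnergyMeasures.

(** * The forms of the loops *)

(** [dform_n] sums over all words of length |w| + 1, whereas a loop lives on the three children of
    w. *)
Lemma sum_rcons (V : nmodType) (w : seq 'I_3) (G : seq 'I_3 -> V) :
  (forall v, size v = (size w).+1 -> (forall i, v <> rcons w i) -> G v = 0) ->
  \sum_(v : (size w).+1.-tuple 'I_3) G v = \sum_i G (rcons w i).
Proof.
move=> G0.
transitivity (\sum_(v : (size w).+1.-tuple 'I_3) \sum_(i | val v == rcons w i) G v).
  apply: eq_bigr => v _.
  have [[i /eqP vi]|nv] := pselect (exists i, val v == rcons w i).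
    rewrite (big_pred1 i) // => j /=; rewrite vi.
    by apply/eqP/eqP => [/rcons_inj[->]//|->].
  rewrite big1; last by move=> i vi; case: nv; exists i.
  by apply: G0 => [|i vi]; [rewrite size_tuple|apply: nv; exists i; apply/eqP].
rewrite (exchange_big_dep xpredT) //=; apply: eq_bigr => i _.
by rewrite (big_pred1 (rcons_tuple (in_tuple w) i)).
Qed.

Section PsiForms.
Variable R : realType.
Local Notation T := (R * R)%type.
Local Notation word := (seq 'I_3).
Local Notation K := (@gasket R).
Local Notation r := (@rfac R).
Variable nu : (T -> R) -> (T -> R) -> {charge set T -> \bar R}.
Hypothesis nuE : energy_measures nu.
Variable H : one_forms nu.
Implicit Types (x y : T) (i j k : 'I_3) (w v : word) (u f g : T -> R) (c : R).

(** Boundary values of psi^(i) o F_i on V_0. *)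
Definition psi_val i j : R := if j == i then 0 else if j == i + 1 then 1 else -1.

(** Since [psi_val i] sums to zero, the pairing is three times the Euclidean inner product. *)
Lemma energy_V0_psi_val i (b : 'I_3 -> R) : energy_V0 (psi_val i) b = 3 * (b (i + 1) - b (i + 2)).
Proof.
have e (k l : 'I_3) : val k = val l -> b k = b l by move=> /val_inj ->.
elim/I3_ind: i; rewrite /energy_V0 /psi_val /=.
- by rewrite (e (0 + 1) 1) // (e (0 + 2) 2) //; ring.
- by rewrite (e (1 + 1) 2) // (e (1 + 2) 0) //; ring.
- by rewrite (e (2 + 1) 0) // (e (2 + 2) 1) //; ring.
Qed.

(** A harmonic extension transported by [Fmapinv] gives existence, and [harmonicE] gives uniqueness,
    so the choice made in [psi_cell] is determined on its cell. *)
Lemma psi_cellE i x : K x -> psi_cell i (Fmap i x) = harm_ext (psi_val i) x.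
Proof.
have neq k : (k + 1 != k) * (k + 2 != k) * (k + 2 != k + 1) :> Prop.
  by elim/I3_ind: k.
have /(@getPex _ _) : exists u : T -> R, [/\ is_harmonic (u \o Fmap i), u (qpt R i) = 0,
        u (Fmap i (qpt R (i + 1))) = 1 & u (Fmap i (qpt R (i + 2))) = -1].
  exists (harm_ext (psi_val i) \o Fmapinv i); split=> /=.
  - rewrite (_ : _ \o _ = harm_ext (psi_val i)); first exact: harmonic_harm_ext.
    by apply/funext => y /=; rewrite FmapK.
  - by rewrite -{1}(Fmap_fix R i) FmapK harm_ext_qpt /psi_val eqxx.
  - by rewrite FmapK harm_ext_qpt /psi_val (negbTE (neq i).1.1) eqxx.
  - by rewrite FmapK harm_ext_qpt /psi_val (negbTE (neq i).1.2) (negbTE (neq i).2).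
rewrite -/(psi_cell i) => -[hh u0 u1 u2] Kx.
have := harmonicE hh Kx; rewrite /= => ->; congr (harm_ext _ x).
apply/funext => j /=; rewrite /psi_val.
have [->|ji] := eqVneq j i; first by rewrite Fmap_fix.
have [->//|ji1] := eqVneq j (i + 1).
by rewrite (_ : j = i + 2) //; move: i j ji ji1 {neq hh u0 u1 u2};
  elim/I3_ind; elim/I3_ind => // _ _; exact: val_inj.
Qed.

Definition psi_ext w i : T -> R := extension (rcons w i) (psi_word w (rcons w i)).

Lemma psi_word_rcons w i : @psi_word R w (rcons w i) = psi_cell i \o Fwinv w.
Proof.
rewrite /psi_word; case: pickP => [j /eqP /rcons_inj [->]//|/(_ i)].
by rewrite eqxx.
Qed.

Lemma psi_word_out w v : (forall i, v <> rcons w i) -> @psi_word R w v = cst 0.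
Proof. by move=> nv; rewrite /psi_word; case: pickP => // i /eqP /nv. Qed.

Lemma extensionP w f : (exists2 g, FF g & forall x, K x -> g (Fw w x) = f (Fw w x)) ->
  FF (extension w f) /\ forall x, K x -> extension w f (Fw w x) = f (Fw w x).
Proof.
move=> [g Fg gf].
have /(@getPex _ _) : exists g : T -> R, FF g /\ forall x, cell w x -> g x = f x.
  by exists g; split=> // x [y Ky <-]; exact: gf.
by rewrite -/(extension w f) => -[Fe e]; split=> // x Kx; apply: e; exists x.
Qed.

Lemma psi_extP w i : FF (psi_ext w i) /\
  forall x, K x -> psi_ext w i (Fw (rcons w i) x) = harm_ext (psi_val i) x.
Proof.
have h x : K x -> psi_word w (rcons w i) (Fw (rcons w i) x) = harm_ext (psi_val i) x.
  by move=> Kx; rewrite psi_word_rcons /= Fw_rcons FwK psi_cellE.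
have [g Fg gE] := harm_ext_extension (rcons w i) (psi_val i).
have [|Fe e] := @extensionP (rcons w i) (psi_word w (rcons w i)).
- by exists g => // x Kx; rewrite gE ?h.
- by split=> // x Kx; rewrite /psi_ext e ?h.
Qed.

Lemma psi_ext_FF w i : FF (psi_ext w i). Proof. by have [] := psi_extP w i. Qed.

Lemma energy_psi_ext w i f :
  energy (psi_ext w i \o Fw (rcons w i)) f = energy_V0 (psi_val i) (f \o @qpt R).
Proof.
rewrite -energy_harm_ext; apply: energy_eq => // x Kx /=.
by have [_ ->] := psi_extP w i.
Qed.

Lemma energy_cstl c f : energy (cst c) f = 0.
Proof.
have h m (g : T -> R) : graph_energy m (cst c : T -> R) g = 0.
  elim: m g => [|m IH] g /=; first by rewrite /energy_V0 /=; ring.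
  by rewrite big1.
rewrite energyE; apply/cvg_lim => //.
by under eq_fun do rewrite /scaled_energy h mulr0; exact: cvg_cst.
Qed.

Lemma act_norm u w : FF u ->
  form_ip (form_act (\1_(cell w)) (dform H u)) (form_act (\1_(cell w)) (dform H u)) =
  r ^- size w * energy (u \o Fw w) (u \o Fw w).
Proof. by move=> Fu; rewrite ip_act_act // setIid nu_cell. Qed.

Lemma dpsiE w : dpsi H w =
  \sum_i form_act (\1_(cell (rcons w i))) (dform H (psi_ext w i)).
Proof.
rewrite /dpsi /dform_n; apply: (@sum_rcons _ w (fun v =>
  form_act (\1_(cell v)) (dform H (extension v (psi_word w v))))) => v sv nv.
(* The chosen extension of 0 from the cell v may be nonzero elsewhere, but its form cut to that cell
   has norm zero. *)
rewrite psi_word_out //.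
have [|Fe e] := @extensionP v (cst 0); first by exists (cst 0) => //; exact: FF_cst.
apply: form_eq0; rewrite act_norm //.
rewrite (@energy_eq _ _ (cst 0) _ (extension v (cst 0) \o Fw v)) //.
by rewrite energy_cstl mulr0.
Qed.

(** Up to a common factor, cell i contributes the difference of f between its two junction points;
    around the loop these differences cancel by [Fmap_swap]. *)
Lemma ip_dpsi_dform w f : FF f -> form_ip (dpsi H w) (dform H f) = 0.
Proof.
move=> Ff; rewrite dpsiE ip_suml.
under eq_bigr => i _ do rewrite (ip_act_dform nuE _ _ (psi_ext_FF w i) Ff) energy_psi_ext
  energy_V0_psi_val size_rcons /= !Fw_rcons.
rewrite big_I3.
have e (k l : 'I_3) : val k = val l -> k = l by exact: val_inj.
rewrite (e (0 + 1) 1) // (e (0 + 2) 2) // (e (1 + 1) 2) // (e (1 + 2) 0) //.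
rewrite (e (2 + 1) 0) // (e (2 + 2) 1) //.
rewrite (Fmap_swap R 1 0) (Fmap_swap R 2 0) (Fmap_swap R 2 1).
by ring.
Qed.

Let nu_cells_disj u f v w i j w' w'' : FF u -> FF f -> i != j ->
  v = w ++ i :: w' -> forall v', v' = w ++ j :: w'' -> fine (nu u f (cell v `&` cell v')) = 0.
Proof.
move=> Fu Ff ij -> v' ->; have h := @cell_meet R w i j w' w'' ij.
by have [->|->] := subset_set1 h; [rewrite charge0|exact: nu_junction].
Qed.

(** Consider a child wi of w. If all children of w' lie in it, then on them the form of w agrees
    with the exact form of [psi_ext w i], which is orthogonal to the loop at w'. Otherwise the child
    cells meet in at most one junction point, which has no mass. *)
Lemma ip_dpsi_neq w w' : w != w' -> (size w <= size w')%N -> form_ip (dpsi H w) (dpsi H w') = 0.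
Proof.
move=> ww sz; rewrite (dpsiE w) ip_suml big1 // => i _.
have [e|ne] := eqVneq (take (size w).+1 w') (rcons w i).
  have sub j : cell (rcons w i) `&` cell (rcons w' j) = @cell R (rcons w' j).
    rewrite setIidr // -(cat_take_drop (size w).+1 w') e rcons_cat.
    exact: cell_catS.
  rewrite dpsiE ip_sumr -[RHS](ip_dpsi_dform w' (psi_ext_FF w i)) dpsiE ip_suml.
  apply: eq_bigr => j _; rewrite ip_act_act ?sub //; try exact: psi_ext_FF.
  by rewrite ip_act_dform ?nu_cell //; exact: psi_ext_FF.
rewrite dpsiE ip_sumr big1 // => j _.
rewrite ip_act_act //; try exact: psi_ext_FF.
have sz' : size (rcons w i) = size (take (size w).+1 (rcons w' j)).
  by rewrite size_take !size_rcons ltnS; case: ltngtP sz => // ->.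
have ne' : rcons w i != take (size w).+1 (rcons w' j).
  rewrite -cats1 -(cats1 w') take_cat; move: sz; rewrite leq_eqVlt => /predU1P[e|lt].
    rewrite e ltnNge leqnSn /= subSnn /= !cats1.
    by apply: contra ww => /eqP /rcons_inj [->].
  move: lt; rewrite leq_eqVlt => /predU1P[e|lt].
    rewrite -e ltnn subnn /= cats0 cats1.
    by move: ne; rewrite take_oversize ?e // eq_sym.
  by rewrite lt cats1 eq_sym.
have [u [k [l [v' [v [kl e1 e2]]]]]] := neq_split sz' ne'.
apply: (nu_cells_disj _ _ kl e1 (v' := rcons w' j)); try exact: psi_ext_FF.
by rewrite -(cat_take_drop (size w).+1 (rcons w' j)) e2 -catA.
Qed.

Lemma ip_dpsi_eq w : form_ip (dpsi H w) (dpsi H w) = 30 * (5 / 3) ^+ size w.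
Proof.
rewrite dpsiE ip_suml.
under eq_bigr => i _.
  rewrite ip_sumr (bigD1 i) //= big1 ?addr0; last first.
    move=> j ji; rewrite ip_act_act //; try exact: psi_ext_FF.
    apply: (@nu_cells_disj _ _ _ w i j [::] [::]); rewrite ?cats1 //; try exact: psi_ext_FF.
    by rewrite eq_sym.
  rewrite act_norm; last exact: psi_ext_FF.
  (* 6 = 1 + 4 + 1 is the energy of the values (0, 1, -1); three cells with the factor (5/3)^(|w|+1)
     give 30 (5/3)^|w|. *)
  rewrite energy_psi_ext (_ : energy_V0 _ _ = 6); last first.
    rewrite (_ : _ \o _ = psi_val i).
      by elim/I3_ind: i; rewrite /energy_V0 /psi_val /=; ring.
    apply/funext => j /=; have [_ ->] := psi_extP w i; last exact: gasket_qpt.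
    exact: harm_ext_qpt.
  rewrite size_rcons.
  over.
by rewrite big_I3 exprSr invfM /rfac -exprVn invf_div; field.
Qed.

Lemma ip_dpsi w w' : form_ip (dpsi H w) (dpsi H w') =
  if w == w' then 30 * (5 / 3) ^+ size w else 0.
Proof.
have [<-|ne] := eqVneq w w'; first exact: ip_dpsi_eq.
have [le|lt] := leqP (size w) (size w'); first exact: ip_dpsi_neq.
by rewrite form_ipC ip_dpsi_neq // 1?eq_sym // ltnW.
Qed.
End PsiForms.

(** * Unconditional sums and square integrable functions *)

#[local] Existing Instance summability.totally_filter.

Section UnconditionalSums.
Local Notation word := (seq 'I_3).

Lemma totally_above (I : choiceType) (A0 : {fset I}) :
  \forall A \near summability.totally, (A0 `<=` A)%fset.
Proof. by exists A0. Qed.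

Lemma cvg_totally_unique (I : choiceType) (U : topologicalType) (F : {fset I} -> U) (a b : U) :
  hausdorff_space U -> F @ summability.totally --> a -> F @ summability.totally --> b -> a = b.
Proof.
move=> hU Fa Fb; have PF := @summability.totally_filter I.
exact: (@cvg_unique _ hU (F @ summability.totally) (fmap_proper_filter F PF) a b Fa Fb).
Qed.

Lemma sum_fset_nseq (V : nmodType) (F : word -> V) (A : {fset word}) (N : nat) :
  (forall w, (forall k, w <> nseq k 0) -> F w = 0) ->
  (forall k, nseq k 0 \in A -> (k < N)%N) ->
  \sum_(w <- A) F w = \sum_(k < N | nseq k 0 \in A) F (nseq k 0).
Proof.
move=> F0 AN.
transitivity (\sum_(w <- A) \sum_(k < N | w == nseq k 0) F w).
  apply: eq_big_seq => w wA.
  have [[k wk]|nw] := pselect (exists k, w = nseq k 0); last first.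
    rewrite F0; last by move=> k wk; apply: nw; exists k.
    by rewrite big1.
  have kN : (k < N)%N by apply: AN; rewrite -wk.
  rewrite (big_pred1 (Ordinal kN)) // => j /=; rewrite wk.
  apply/eqP/eqP => [/(congr1 size)|->//].
  by rewrite !size_nseq => kj; apply: val_inj.
rewrite (exchange_big_dep xpredT) //= [RHS]big_mkcond; apply: eq_bigr => k _.
case: ifPn => kA; last first.
  rewrite big_seq_cond big_pred0 // => w; apply/negP => /andP[wA /eqP e].
  by rewrite -e wA in kA.
by rewrite -big_filter filter_pred1_uniq ?fset_uniq // big_seq1.
Qed.

(** A geometric bound on the norms gives unconditional summability. The limit of ordinary partial
    sums is returned as well, because pairings are computed on it. *)
Lemma usum_nseq (R : realType) (V : completeNormedModType R) (F : word -> V) (C q : R) :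
  0 <= q < 1 -> 0 <= C ->
  (forall w, (forall k, w <> nseq k 0) -> F w = 0) ->
  (forall k, `|F (nseq k 0)| <= C * q ^+ k) ->
  exists2 S, usum F S & \sum_(k < n) F (nseq k 0) @[n --> \oo] --> S.
Proof.
move=> q01 C0 F0 hF; pose u n := \sum_(k < n) F (nseq k 0).
have [|cu tail] := @geometric_cvg R V u C q q01 C0.
  by move=> n; rewrite /u big_ord_recr /= addrAC subrr add0r.
exists (limn u) => //; apply/cvgrPdist_le => e e0.
have /andP[q0 q1] := q01.
have q_to0 : C / (1 - q) * q ^+ n @[n --> \oo] --> (0 : R).
  rewrite -(mulr0 (C / (1 - q))); apply: cvgMr; apply: cvg_expr.
  by rewrite ger0_norm.
have [N _ hN] : \forall n \near \oo, C / (1 - q) * q ^+ n < e / 2.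
  by apply: (cvgr_lt _ q_to0); lra.
have {hN} hN : C / (1 - q) * q ^+ N < e / 2 by apply: hN => /=.
apply: filterS (totally_above [fset nseq (val k) 0 | k in 'I_N]%fset) => A /fsubsetP A0A.
have inA k : (k < N)%N -> nseq k 0 \in A.
  move=> kN; apply: A0A; apply/imfsetP; exists (Ordinal kN) => //.
(* Every 0^k in A has k < M, so the sum over A is a sum over k < M that contains all k < N. *)
pose M := (N + \sum_(w <- A) (size w).+1)%N.
have AM k : nseq k 0 \in A -> (k < M)%N.
  move=> kA; rewrite /M (bigD1_seq _ kA) ?fset_uniq //= size_nseq.
  by rewrite addnCA leq_addr.
rewrite (sum_fset_nseq F0 AM) -(subrKA (u N)); apply: le_trans (ler_normD _ _) _.
rewrite (splitr e); apply: lerD; first by apply: le_trans (tail N) (ltW hN).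
have -> : \sum_(k < M | nseq k 0 \in A) F (nseq k 0) =
    u N + \sum_(N <= k < M | nseq k 0 \in A) F (nseq k 0).
  rewrite -(big_mkord (fun k => nseq k 0 \in A) (fun k => F (nseq k 0))).
  rewrite (@big_cat_nat _ _ _ N) ?leq_addr //=; congr (_ + _).
  by rewrite big_mkord; apply: eq_bigl => k; rewrite inA.
rewrite opprD addrA subrr sub0r normrN; apply: le_trans (ler_norm_sum _ _ _) _.
apply: le_trans (_ : \sum_(N <= k < M) C * q ^+ k <= _).
  rewrite big_mkcond /=; apply: ler_sum => k _; case: ifP => // _.
  by rewrite mulr_ge0 // exprn_ge0.
apply: le_trans (ltW hN).
suff geo m n : \sum_(i <- iota n m) C * q ^+ i <= C / (1 - q) * q ^+ n by exact: geo.
elim: m n => [|m IH] n /=.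
  by rewrite big_nil mulr_ge0 ?divr_ge0 ?exprn_ge0 // subr_ge0 ltW.
rewrite big_cons; apply: le_trans (lerD (lexx _) (IH n.+1)) _.
rewrite exprS (_ : _ + _ = C / (1 - q) * q ^+ n) //; field.
by rewrite subr_eq0 gt_eqF.
Qed.
End UnconditionalSums.

Section L2.
Variable R : realType.
Local Notation T := (R * R)%type.
Local Notation K := (@gasket R).
Implicit Types (f g : T -> R) (c : R) (mu : {measure set T -> \bar R}).

Local Open Scope ereal_scope.

Lemma measurable_sqr f : measurable_fun K f -> measurable_fun K (fun x => ((f x) ^+ 2)%:E).
Proof. by move=> mf; apply/measurable_EFinP; exact: measurable_funX. Qed.

Lemma measurable_lin c f g : measurable_fun K f -> measurable_fun K g ->
  measurable_fun K (fun x => c * f x + g x)%R.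
Proof. by move=> mf mg; apply: measurable_funD => //; apply: measurable_funM. Qed.

Lemma L2norm_sq_ge0 mu f : 0 <= L2norm_sq mu f.
Proof. by apply: integral_ge0 => x _; rewrite lee_fin sqr_ge0. Qed.

Lemma L2norm_sq_lin mu c f g : measurable_fun K f -> measurable_fun K g ->
  L2norm_sq mu (fun x => c * f x + g x)%R <=
  (2 * c ^+ 2)%:E * L2norm_sq mu f + 2%:E * L2norm_sq mu g.
Proof.
move=> mf mg; have mK : measurable K := @measurable_gasket R.
have sq0 (k : R) : (0 <= k ^+ 2)%R by rewrite sqr_ge0.
rewrite /L2norm_sq -!ge0_integralZl //; try exact: measurable_sqr;
  try (by move=> x _; rewrite lee_fin); try (by rewrite lee_fin mulr_ge0).
have pos (a : R) (k : T -> R) x : (0 <= a)%R -> 0 <= a%:E * ((k x) ^+ 2)%:E.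
  by move=> a0; rewrite mule_ge0 // lee_fin.
have mpos (a : R) (k : T -> R) : measurable_fun K k ->
    measurable_fun K (fun x => a%:E * ((k x) ^+ 2)%:E).
  by move=> mk; apply: measurable_funeM; exact: measurable_sqr.
have c2 : (0 <= 2 * c ^+ 2)%R by rewrite mulr_ge0.
rewrite -(ge0_integralD _ mK (fun x _ => pos _ f x c2) (mpos _ _ mf)
  (fun x _ => pos _ g x (ler0n _ 2)) (mpos _ _ mg)).
apply: ge0_le_integral => //.
- by move=> x _; rewrite lee_fin.
- by apply: measurable_sqr; exact: measurable_lin.
- by apply: emeasurable_funD; apply: measurable_funeM; exact: measurable_sqr.
move=> x Kx; rewrite -!EFinM -EFinD lee_fin -subr_ge0.
by rewrite (_ : _ - _ = (c * f x - g x) ^+ 2)%R ?sqr_ge0 //; ring.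
Qed.

Lemma L2_lin mu c f g : L2 mu f -> L2 mu g -> L2 mu (fun x => c * f x + g x)%R.
Proof.
move=> [mf ff] [mg fg]; split; first exact: measurable_lin.
apply: le_lt_trans (L2norm_sq_lin _ _ mf mg) _.
apply: lte_add_pinfty; apply: lte_mul_pinfty => //; rewrite lee_fin //.
by rewrite mulr_ge0 // sqr_ge0.
Qed.

Lemma L2_0 mu : L2 mu (cst 0%R).
Proof.
split; first exact: measurable_cst.
by rewrite /L2norm_sq (eq_integral (cst 0)) ?integral0 // => x _; rewrite expr0n.
Qed.
End L2.

(** * Multiplication of a form by a square integrable function *)

Section L2Multiplication.
Variable R : realType.
Local Notation T := (R * R)%type.
Local Notation word := (seq 'I_3).
Variable nu : (T -> R) -> (T -> R) -> {charge set T -> \bar R}.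
Variable H : one_forms nu.
Local Notation form := (oneform H).
Variable h : T -> R.
Hypothesis Fh : FF h.
Implicit Types (f g : T -> R) (c : R) (y z : form).
Local Notation mu := (emeas nu h).

Lemma symb_norm_le g : CK g -> ((`|form_symb H g h| ^+ 2)%:E <= L2norm_sq mu g)%E.
Proof.
move=> cg; rewrite -form_ip_norm form_ip_symb //.
by apply: charge_integral_sqr_le; exact: CK_bounded_borel.
Qed.

(** Inner products of symbols are linear in the coefficient function, so the difference of the two
    sides is orthogonal to every symbol with h, hence to itself. *)
Lemma symb_lin c f g : CK f -> CK g ->
  form_symb H (fun x => c * f x + g x) h = c *: form_symb H f h + form_symb H g h.
Proof.
move=> cf cg; have cfg := @CK_lin R c f g cf cg.
apply/eqP; rewrite -subr_eq0; apply/eqP; apply: form_eq0.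
set X := _ - _.
have X0 k : CK k -> form_ip X (form_symb H k h) = 0.
  move=> ck; rewrite /X ipBl ipDl ipZl !form_ip_symb //.
  rewrite (@charge_integral_eq _ _ _ (fun x => c * (f \* k) x + (g \* k) x)).
    rewrite charge_integral_lin; first by ring.
    - by apply: CK_bounded_borel; exact: CK_mul.
    - by apply: CK_bounded_borel; exact: CK_mul.
  by move=> x _ /=; ring.
by rewrite {2}/X ipBr ipDr ipZr !X0 //; ring.
Qed.

Lemma is_L2mul_lin c f g y z : is_L2mul f h y -> is_L2mul g h z ->
  is_L2mul (fun x => c * f x + g x) h (c *: y + z).
Proof.
move=> [L2f [a [ca fa ya]]] [L2g [b [cb gb zb]]]; split; first exact: L2_lin.
exists (fun n x => c * a n x + b n x); split.
- by move=> n; exact: CK_lin.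
- apply: (@squeeze_cvge _ _ _ _ (cst 0%E) _ (fun n => (2 * c ^+ 2)%:E *
    L2norm_sq mu (f \- a n)%R + 2%:E * L2norm_sq mu (g \- b n)%R)%E).
  + apply: nearW => n /=; rewrite L2norm_sq_ge0 /=.
    rewrite (_ : (fun x => _) \- _ = (fun x => c * (f \- a n) x + (g \- b n) x)).
      apply: L2norm_sq_lin; apply: measurable_funB; try exact: CK_measurable.
        by case: L2f.
      by case: L2g.
    by apply/funext => x /=; ring.
  + exact: cvg_cst.
  + rewrite [X in _ --> X](_ : _ = (2 * c ^+ 2)%:E * 0 + 2%:E * 0)%E; last by rewrite !mule0 adde0.
    apply: cvgeD; [by rewrite !mule0|by apply: cvgeZl => //; exact: fa|].
    by apply: cvgeZl => //; exact: gb.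
- rewrite (_ : (fun n => _) = (fun n => c *: form_symb H (a n) h + form_symb H (b n) h)).
    by apply: cvgD => //; exact: cvgZr.
  by apply/funext => n; rewrite symb_lin.
Qed.

Lemma is_L2mul_0 : is_L2mul (cst 0) h (0 : form).
Proof.
split; first exact: L2_0.
have s0 : form_symb H (cst 0) h = 0.
  have := symb_lin (-1) (@CK_cst R 0) (@CK_cst R 0).
  rewrite (_ : (fun x => _) = cst 0); last by apply/funext => x /=; rewrite mulr0 addr0.
  by rewrite scaleN1r addNr.
exists (fun=> cst 0); split => //.
- by move=> n; exact: CK_cst.
- rewrite (_ : (fun n => _) = cst 0%E); first exact: cvg_cst.
  apply/funext => n /=; rewrite /L2norm_sq (eq_integral (cst 0%E)) ?integral0 //.
  by move=> x _ /=; rewrite subr0 expr0n.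
- by rewrite s0; exact: cvg_cst.
Qed.

Lemma is_L2mul_sum (I : Type) (s : seq I) (c : I -> R) (x : I -> T -> R) (y : I -> form) :
  (forall i, is_L2mul (x i) h (y i)) ->
  is_L2mul (fun t => \sum_(i <- s) c i * x i t) h (\sum_(i <- s) c i *: y i).
Proof.
move=> xy; elim: s => [|i s IH].
  rewrite big_nil (_ : (fun t => _) = cst 0); first exact: is_L2mul_0.
  by apply/funext => t; rewrite big_nil.
rewrite big_cons (_ : (fun t => _) = (fun t => c i * x i t + \sum_(i <- s) c i * x i t)).
  exact: is_L2mul_lin.
by apply/funext => t; rewrite big_cons.
Qed.

(** The difference of two values is a limit of forms whose coefficient functions tend to 0 in L^2,
    and [symb_norm_le] bounds their norms. *)
Lemma is_L2mul_unique f y z : is_L2mul f h y -> is_L2mul f h z -> y = z.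
Proof.
move=> yf zf; have := is_L2mul_lin (-1) yf zf.
rewrite (_ : (fun x => _) = cst 0); last by apply/funext => x /=; rewrite mulN1r addNr.
move=> [_ [g [cg g0 gy]]].
suff : -1 *: y + z = 0 by rewrite scaleN1r addrC => /subr0_eq ->.
have n2 : (fun n => `|form_symb H (g n) h| ^+ 2) @ \oo --> `|-1 *: y + z| ^+ 2.
  by rewrite expr2; under eq_fun do rewrite expr2; apply: cvgM; exact: cvg_norm.
apply/eqP; rewrite -normr_eq0 -sqrf_eq0; apply/eqP.
suff n0 : (fun n => `|form_symb H (g n) h| ^+ 2) @ \oo --> 0.
  exact: (cvg_unique (@Rhausdorff R) n2 n0).
have : (fun n => (`|form_symb H (g n) h| ^+ 2)%:E) @ \oo --> 0%:E.
  apply: (@squeeze_cvge _ _ _ _ (cst 0%E) _ _ _ _ _ g0); last exact: cvg_cst.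
  apply: nearW => n /=; rewrite lee_fin sqr_ge0 /=.
  apply: le_trans (symb_norm_le (cg n)) _.
  by rewrite /L2norm_sq; under [leRHS]eq_integral do rewrite /= sub0r sqrrN.
by move/fine_cvgP => [_].
Qed.

(** Diagonal argument: for each n, a finite set A close to the limit both in L^2 and in the space of
    forms, then a continuous approximant of the finite sum over A. *)
Lemma is_L2mul_usum (c : word -> R) (x : word -> T -> R) (y : word -> form) f S :
  (forall w, is_L2mul (x w) h (y w)) -> L2 mu f ->
  usumL2 nu h (fun w t => c w * x w t) f -> usum (fun w => c w *: y w) S ->
  is_L2mul f h S.
Proof.
move=> xy L2f sf sy; split=> //.
pose e n : R := n.+1%:R^-1.
have e_gt0 n : 0 < e n by rewrite invr_gt0.
have FF0 : Filter (@summability.totally word) by exact: filter_filter.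
have tot2 (P Q Z : set {fset word}) : (forall A, P A -> Q A -> Z A) ->
    summability.totally P -> summability.totally Q -> summability.totally Z.
  exact: filterS2.
have step n : exists g, [/\ CK g, (L2norm_sq mu (f \- g)%R <= (4 * e n)%:E)%E &
    `|S - form_symb H g h| <= 2 * e n].
  have sf' : (fun A : {fset word} =>
      L2norm_sq mu (fun t => f t - \sum_(w <- A) c w * x w t)%R) @ summability.totally --> 0%E.
    exact: sf.
  have /fine_cvgP[fin1 lim1] := sf'.
  have near1 : summability.totally (fun A : {fset word} =>
      (L2norm_sq mu (fun t => f t - \sum_(w <- A) c w * x w t)%R <= (e n)%:E)%E).
    have lt1 : summability.totally (fun A : {fset word} =>
        fine (L2norm_sq mu (fun t => f t - \sum_(w <- A) c w * x w t)%R) < e n).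
      by apply: (cvgr_lt _ lim1).
    apply: tot2 fin1 lt1 => A finA ltA.
    by rewrite -(fineK finA) lee_fin ltW.
  have sy' : (fun A : {fset word} => \sum_(w <- A) c w *: y w) @ summability.totally --> S.
    exact: sy.
  have near2 : summability.totally (fun A : {fset word} =>
      `|S - \sum_(w <- A) c w *: y w| < e n).
    by move/cvgrPdist_lt: sy' => /(_ _ (e_gt0 n)).
  have [A [A1 A2]] : exists A : {fset word},
     (L2norm_sq mu (fun t => f t - \sum_(w <- A) c w * x w t)%R <= (e n)%:E)%E /\
     `|S - \sum_(w <- A) c w *: y w| < e n.
    by apply: (@filter_ex _ summability.totally); by apply: tot2 near1 near2.
  have [L2A [g [cg gA yA]]] := is_L2mul_sum A c xy.
  have /fine_cvgP[fin3 lim3] := gA.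
  have near3 : \forall m \near \oo,
      (L2norm_sq mu ((fun t => \sum_(w <- A) c w * x w t) \- g m)%R <= (e n)%:E)%E.
    have lt3 : \forall m \near \oo,
        fine (L2norm_sq mu ((fun t => \sum_(w <- A) c w * x w t) \- g m)%R) < e n.
      by apply: (cvgr_lt _ lim3).
    apply: filterS2 fin3 lt3 => m finA ltA.
    by rewrite -(fineK finA) lee_fin ltW.
  have near4 : \forall m \near \oo,
      `|\sum_(w <- A) c w *: y w - form_symb H (g m) h| < e n.
    by move/cvgrPdist_lt: yA => /(_ _ (e_gt0 n)).
  have [m [m1 m2]] : exists m,
      (L2norm_sq mu ((fun t => \sum_(w <- A) c w * x w t) \- g m)%R <= (e n)%:E)%E /\
      `|\sum_(w <- A) c w *: y w - form_symb H (g m) h| < e n.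
    by apply: (@filter_ex _ \oo); by apply: filterS2 near3 near4.
  exists (g m); split => //; last first.
    rewrite -(subrKA (\sum_(w <- A) c w *: y w)); apply: le_trans (ler_normD _ _) _.
    by rewrite mulr_natl mulr2n lerD // ltW.
  rewrite (_ : f \- g m = (fun t => 1 * (f t - \sum_(w <- A) c w * x w t) +
      ((fun t => \sum_(w <- A) c w * x w t) \- g m) t)%R); last first.
    by apply/funext => t /=; rewrite mul1r subrKA.
  (* Both weights are 2 and both squared errors are at most e n, whence 4 e n. *)
  apply: le_trans (L2norm_sq_lin _ _ _ _) _.
  - by apply: measurable_funB; [case: L2f|case: L2A].
  - by apply: measurable_funB; [case: L2A|exact: CK_measurable].
  apply: le_trans (leeD (lee_pmul _ (L2norm_sq_ge0 _ _) (lexx _) A1)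
    (lee_pmul _ (L2norm_sq_ge0 _ _) (lexx _) m1)) _; rewrite ?lee_fin ?mulr_ge0 //.
  by lra.
have e0 a : a * e n @[n --> \oo] --> (0 : R).
  by rewrite -(mulr0 a); apply: cvgMr; exact: cvg_harmonic.
have [g gP] := choice step; exists g; split.
- by move=> n; have [] := gP n.
- apply: (@squeeze_cvge _ _ _ _ (cst 0%E) _ (fun n => (4 * e n)%:E)).
  + by apply: nearW => n /=; rewrite L2norm_sq_ge0; have [_ ->] := gP n.
  + exact: cvg_cst.
  + by apply: cvg_EFin; [exact: nearW|exact: e0].
- apply/cvgrPdist_lt => d d0.
  have h2 : \forall n \near \oo, 2 * e n < d by apply: (cvgr_lt _ (e0 2)).
  apply: filterS h2 => n hn; have [_ _ /le_lt_trans] := gP n; exact.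
Qed.
End L2Multiplication.

(** * Composition with cell maps *)

Section Composition.
Variable R : realType.
Local Notation T := (R * R)%type.
Local Notation word := (seq 'I_3).
Local Notation K := (@gasket R).
Variable nu : (T -> R) -> (T -> R) -> {charge set T -> \bar R}.
Hypothesis nuE : energy_measures nu.
Variable H : one_forms nu.
Local Notation form := (oneform H).
Implicit Types (x y : T) (i j : 'I_3) (k m n : nat) (w v : word) (u f g : T -> R)
  (X Y Z : form) (a b : 'I_3 -> R).

Lemma dform_sub_norm u f : FF u -> FF f ->
  `|dform H u - dform H f| ^+ 2 = energy (fun x => u x - f x) (fun x => u x - f x).
Proof.
move=> Fu Ff; rewrite -form_ip_norm ipBl !ipBr !ip_dform //.
rewrite (energy_sym f u).
have e x : K x -> u x - f x = -1 * f x + u x by rewrite mulN1r addrC.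
have Fd : FF (fun x => -1 * f x + u x) by exact: FF_lin.
rewrite (energy_eq e e) (energy_linl (-1) Ff Fu Fd).
rewrite (energy_linr (-1) Ff Fu Ff) (energy_linr (-1) Ff Fu Fu) (energy_sym f u).
by ring.
Qed.

Lemma dform_eq u f : FF u -> FF f -> (forall x, K x -> u x = f x) -> dform H u = dform H f.
Proof.
move=> Fu Ff e; apply/eqP; rewrite -subr_eq0 -normr_eq0 -sqrf_eq0 dform_sub_norm //.
have e0 x : K x -> u x - f x = cst 0 x by move=> /e ->; rewrite subrr.
by rewrite (energy_eq e0 e0) energy_cstl.
Qed.

Lemma dform_comp_eq u f w : FF u -> FF f -> dform H u = dform H f ->
  dform H (u \o Fw w) = dform H (f \o Fw w).
Proof.
move=> Fu Ff e; have d0 := dform_sub_norm Fu Ff; rewrite e subrr normr0 expr0n /= in d0.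
have dc := energy0_cst (FF_sub Fu Ff) (esym d0).
apply/eqP; rewrite -subr_eq0 -normr_eq0 -sqrf_eq0 dform_sub_norm; [|exact: FF_Fw..].
have ec x : K x -> (u \o Fw w) x - (f \o Fw w) x = cst (u (qpt R 0) - f (qpt R 0)) x.
  by move=> Kx /=; rewrite (dc _ (gasket_Fw w Kx)).
by rewrite (energy_eq ec ec) energy_cstl.
Qed.

(** By orthogonality the pairing is constant along the finite sets that contain w, so the
    coefficients of an unconditional sum are determined. *)
Lemma usum_coef (c : word -> R) Z w : usum (fun v => c v *: dpsi H v) Z ->
  form_ip Z (dpsi H w) = c w * (30 * (5 / 3) ^+ size w).
Proof.
move=> sZ.
have sZ' : (fun A : {fset word} => \sum_(v <- A) c v *: dpsi H v) @ summability.totally --> Z.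
  exact: sZ.
have DF : Filter (@summability.totally word) by exact: filter_filter.
have l1 := ip_cvgl (DF := DF) (Y := dpsi H w) sZ'.
suff l2 : (fun A : {fset word} => form_ip (\sum_(v <- A) c v *: dpsi H v) (dpsi H w))
    @ summability.totally --> c w * (30 * (5 / 3) ^+ size w).
  exact: (cvg_totally_unique (@Rhausdorff R) l1 l2).
apply: cvg_near_cst; apply: filterS (totally_above [fset w]%fset) => A.
rewrite fsub1set => wA; rewrite ip_suml (bigD1_seq w) ?fset_uniq //=.
rewrite big1 ?addr0; first by rewrite ipZl ip_dpsi // eqxx.
by move=> v vw; rewrite ipZl ip_dpsi // (negbTE vw) mulr0.
Qed.

(** Orthogonality of the Hodge decomposition determines the exact part, hence eta up to a constant,
    which composition preserves; [usum_coef] determines the coefficients. *)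
Lemma is_comp_unique X w Y Z : is_comp X w Y -> is_comp X w Z -> Y = Z.
Proof.
move=> [e1 [t1 [c1 [s1 [[Fe1 k1] u1 x1 v1 ->]]]]].
move=> [e2 [t2 [c2 [s2 [[Fe2 k2] u2 x2 v2 ->]]]]].
have d12 : dform H e1 - dform H e2 = t2 - t1.
  by apply/eqP; rewrite subr_eq addrAC eq_sym subr_eq addrC -x1 x2 addrC.
have e12 : dform H e1 = dform H e2.
  apply/eqP; rewrite -subr_eq0; apply/eqP; apply: form_eq0.
  by rewrite {1}d12 ipBr !ipBl !(k1, k2) //; ring.
have t12 : t1 = t2.
  by move/eqP: d12; rewrite e12 subrr eq_sym subr_eq0 => /eqP.
rewrite (dform_comp_eq w Fe1 Fe2 e12); congr (_ + _).
have c12 : c1 = c2.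
  apply/funext => v; have := usum_coef v u1; rewrite t12 (usum_coef v u2).
  by move/mulIf => -> //; rewrite mulf_neq0 // expf_neq0 // divf_neq0.
rewrite c12 in v1.
exact: (cvg_totally_unique (@norm_hausdorff _ form) v1 v2).
Qed.

Lemma form_compE X w Y : is_comp X w Y -> form_comp X w = Y.
Proof. by move=> h; apply: (is_comp_unique _ h); apply: getPex; exists Y. Qed.

Lemma usum0 : usum (fun w : word => 0 : form) 0.
Proof.
rewrite /usum (_ : (fun A : seq word => _) = cst 0); first exact: cvg_cst.
by apply/funext => A; rewrite big1.
Qed.

Lemma ker_dstar0 : ker_dstar (0 : form).
Proof. by move=> f _; rewrite ip0l. Qed.

Lemma form_comp_dform u w : FF u -> form_comp (dform H u) w = dform H (u \o Fw w).
Proof.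
move=> Fu; apply: form_compE; exists u, 0, (fun=> 0), 0; split; rewrite ?addr0 //.
- by split=> //; exact: ker_dstar0.
- by under eq_fun do rewrite scale0r; exact: usum0.
- by under eq_fun do rewrite scale0r; exact: usum0.
Qed.

Lemma Fwinv_cat w v x : Fwinv (w ++ v) x = Fwinv v (Fwinv w x) :> T.
Proof. by elim: w x => //= i w IH x; rewrite IH. Qed.

Lemma psi_word_cat w v z : @psi_word R (w ++ v) (w ++ z) \o Fw w = psi_word v z.
Proof.
rewrite /psi_word; have e i : (w ++ z == rcons (w ++ v) i) = (z == rcons v i).
  by rewrite -cats1 -catA cats1 eqseq_cat // eqxx.
rewrite (eq_pick e); case: pickP => [i _|_] //.
by apply/funext => x /=; rewrite Fwinv_cat FwK.
Qed.

(** The form into which composition with F_{0^n} turns the loop at 0^k; the truncated level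
    [k.+1 - n] is 0 as soon as k < n. *)
Definition comp_psi n k : form :=
  dform_n H (k.+1 - n) (family_comp k.+1 (psi_word (nseq k 0)) (nseq n 0)).

Lemma comp_psi_ge n k : (n <= k)%N -> comp_psi n k = dpsi H (nseq (k - n) 0).
Proof.
move=> nk; rewrite /comp_psi /dpsi size_nseq subSn //.
apply: eq_bigr => v _; congr (form_act _ (dform H (extension _ _))).
rewrite /family_comp take_oversize; last first.
  by rewrite size_cat size_nseq size_tuple addnS subnKC.
have -> : nseq k (0 : 'I_3) = nseq n 0 ++ nseq (k - n) 0 by rewrite -nseqD subnKC.
exact: psi_word_cat.
Qed.

Lemma form_act_gasket u : FF u -> form_act (\1_(cell [::])) (dform H u) = dform H u.
Proof.
move=> Fu; apply/eqP; rewrite -subr_eq0; apply/eqP; apply: form_eq0.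
have e : energy (u \o Fw [::]) (u \o Fw [::]) = energy u u by exact: energy_eq.
rewrite ipBl !ipBr act_norm // (form_ipC (dform H u) (form_act _ _)).
by rewrite ip_act_dform // ip_dform //= e expr0 invr1; ring.
Qed.

Definition antisym m : T -> R := harm_ext (psi_val R 0) \o Fw (nseq m 0).

Lemma FF_antisym m : FF (antisym m).
Proof. by apply: FF_Fw; exact: FF_harm_ext. Qed.

(** For k < n the cell 0^n lies in the child 0^k 0 of the loop, where psi is a single harmonic
    function; F_{0^n} then factors through that child, leaving n - k - 1 further maps. Level 0 has
    only the empty word, whose indicator acts as the identity. *)
Lemma comp_psi_lt n k : (k < n)%N -> comp_psi n k = dform H (antisym (n - k.+1)).
Proof.
move=> kn; have nE : nseq n (0 : 'I_3) = rcons (nseq k 0) 0 ++ nseq (n - k.+1) 0.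
  by rewrite -(subnKC kn) nseqD -cats1 -(nseqD k 1) addn1 addKn.
pose f := psi_word (nseq k 0) (take k.+1 (nseq n 0 ++ [::])) \o Fw (nseq n 0) : T -> R.
have fE x : K x -> f x = antisym (n - k.+1) x.
  move=> Kx; rewrite /f cats0 nE take_size_cat ?size_rcons ?size_nseq //.
  rewrite psi_word_rcons /= Fw_cat Fw_rcons FwK psi_cellE //; exact: gasket_Fw.
rewrite /comp_psi; have -> : (k.+1 - n = 0)%N by apply/eqP; rewrite subn_eq0.
rewrite /dform_n (big_pred1 [tuple]); last by move=> v; apply/esym/eqP; exact: tuple0.
have [|Fe e] := @extensionP R [::] f.
  by exists (antisym (n - k.+1)) => [|x Kx]; [exact: FF_antisym|rewrite /= fE].
rewrite [family_comp _ _ _ _](_ : _ = f) // form_act_gasket //.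
by apply: dform_eq => // [|x Kx]; [exact: FF_antisym|rewrite e //= fE].
Qed.

(** Decomposition of a along the constants, (0, 1, 1) and (0, 1, -1), with eigenvalues 1, 3/5 and
    1/5. *)
Lemma iter_harm_rule0 m a : iter m (fun b => harm_rule b 0) a =
  fun j => a 0 + (if j == 0 then 0 else (3 / 5) ^+ m * ((a 1 + a 2) / 2 - a 0)
     + 5^-1 ^+ m * (if j == 1 then (a 1 - a 2) / 2 else (a 2 - a 1) / 2)).
Proof.
elim: m => [|m IH] /=; apply/funext; elim/I3_ind; rewrite ?IH /harm_rule /= ?expr0;
  rewrite ?exprS; by field.
Qed.

Lemma harm_ext_iter m a x : K x ->
  harm_ext a (Fw (nseq m 0) x) = harm_ext (iter m (fun b => harm_rule b 0) a) x.
Proof.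
elim: m a => //= m IH a Kx; rewrite harm_ext_Fmap; last exact: gasket_Fw.
by rewrite IH // -iterSr.
Qed.

Lemma energy_harm_ext_iter m a f : energy (harm_ext a \o Fw (nseq m 0)) f =
  (3 / 5) ^+ m * ((a 1 + a 2) / 2 - a 0) * (f (qpt R 1) + f (qpt R 2) - 2 * f (qpt R 0))
  + 5^-1 ^+ m * (3 / 2 * (a 1 - a 2)) * (f (qpt R 1) - f (qpt R 2)).
Proof.
rewrite (@energy_eq _ _ (harm_ext (iter m (fun b => harm_rule b 0) a)) _ f) //; last first.
  by move=> x Kx /=; exact: harm_ext_iter.
by rewrite energy_harm_ext iter_harm_rule0 /energy_V0 /=; field.
Qed.

Lemma energy_antisym m f : energy (antisym m) f =
  5^-1 ^+ m * 3 * (f (qpt R 1) - f (qpt R 2)).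
Proof. by rewrite energy_harm_ext_iter /psi_val /=; field. Qed.

(** Being uniform in n, the bound lets the composed series converge under the same condition as the
    original one. For k < n the squared norm is 6 / 25^(n-k-1). *)
Lemma comp_psi_norm n k : `|comp_psi n k| ^+ 2 <= 30 * (5 / 3) ^+ k.
Proof.
have p1 m : 1 <= (5 / 3 : R) ^+ m by rewrite exprn_ege1 //; lra.
have [nk|kn] := leqP n k.
  rewrite comp_psi_ge // -form_ip_norm ip_dpsi_eq // size_nseq ler_pM2l //.
  by rewrite ler_weXn2l ?leq_subr //; lra.
rewrite comp_psi_lt // -form_ip_norm ip_dform //; try exact: FF_antisym.
set m := (n - k.+1)%N.
rewrite energy_antisym /antisym /= !harm_ext_iter ?harm_ext_qpt; try exact: gasket_qpt.
rewrite iter_harm_rule0 /psi_val /=.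
have h5 : 0 <= (5^-1 : R) ^+ m <= 1.
  by rewrite exprn_ge0 //= exprn_ile1 // invf_le1 // ler1n.
by have := p1 k; move: h5 (_ ^+ k) => /andP[]; move: (5^-1 ^+ m) => q q0 q1 p p1'; nra.
Qed.

End Composition.

(** * Normal parts *)

Section CellPullback.
Variable R : realType.
Local Notation T := (R * R)%type.
Variables (mu : {finite_measure set T -> \bar R}) (w : seq 'I_3).
Implicit Types A : set T.

(** As F_w is a bijection of the plane, the pullback is the image measure under [Fwinv w], from
    which countable additivity and finiteness are inherited. *)
Lemma pullbackE A : pullback mu w A = mu (Fwinv w @^-1` A).
Proof.
congr (mu _); apply/seteqP; split=> [_ [x Ax <-]|x Ax] /=; first by rewrite FwK.
by exists (Fwinv w x); rewrite ?FwinvK.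
Qed.

Lemma continuous_measurable_plane (f : T -> R) : continuous f -> measurable_fun setT f.
Proof.
move=> /continuousP cf; apply: (measurability _ (RGenOpens.measurableE R)).
move=> _ [_ [a [b ->] <-]]; rewrite setTI; apply: open_measurable_plane.
exact/cf/interval_open.
Qed.

Lemma measurable_Fwinv A : measurable A -> measurable (Fwinv w @^-1` A).
Proof.
have mf : measurable_fun setT (@Fwinv R w).
  rewrite (_ : @Fwinv R w = (fun x => ((Fwinv w x).1, (Fwinv w x).2))); last first.
    by apply/funext => x; case: (Fwinv w x).
  apply: measurable_fun_pair; apply: continuous_measurable_plane => x.
    by apply: (@continuous_comp _ _ _ (Fwinv w) fst); [exact: continuous_Fwinv|exact: cvg_fst].
  by apply: (@continuous_comp _ _ _ (Fwinv w) snd); [exact: continuous_Fwinv|exact: cvg_snd].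
by move=> mA; rewrite -[X in measurable X]setTI; exact: mf.
Qed.

Let pullback0 : pullback mu w set0 = 0%E.
Proof. by rewrite pullbackE preimage_set0 measure0. Qed.

Let pullback_ge0 A : (0 <= pullback mu w A)%E.
Proof. by rewrite pullbackE. Qed.

Let pullback_sigma_additive : semi_sigma_additive (pullback mu w).
Proof.
move=> F mF tF mUF; rewrite pullbackE preimage_bigcup.
under eq_fun do under eq_bigr do rewrite pullbackE.
apply: measure_semi_sigma_additive.
- by move=> n; exact: measurable_Fwinv.
- apply/trivIsetP => /= i j _ _ ij; rewrite -preimage_setI.
  by move/trivIsetP : tF => /(_ _ _ _ _ ij) ->//; rewrite preimage_set0.
- by rewrite -preimage_bigcup; exact: measurable_Fwinv.
Qed.

HB.instance Definition _ := isMeasure.Build _ _ _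
  (pullback mu w) pullback0 pullback_ge0 pullback_sigma_additive.

Let pullback_fin : fin_num_fun (pullback mu w).
Proof. by move=> A mA; rewrite pullbackE fin_num_measure //; exact: measurable_Fwinv. Qed.

HB.instance Definition _ := @Measure_isFinite.Build _ _ _ (pullback mu w) pullback_fin.

Definition cell_measure : {finite_measure set T -> \bar R} := pullback mu w.

End CellPullback.

Section NormalPart.
Variable R : realType.
Local Notation T := (R * R)%type.
Local Notation K := (@gasket R).
Implicit Types (x y : T) (i j k : 'I_3) (m n : nat) (u f g : T -> R).

Definition qval i : 'I_3 -> R := fun j => (j == i)%:R.

Lemma harm_qP i : is_harmonic (@harm_q R i) /\ forall j, harm_q i (qpt R j) = qval i j.
Proof.
apply: (@getPex _ [set u : T -> R | is_harmonic u /\ forall j, u (qpt R j) = qval i j]).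
by exists (harm_ext (qval i)); split=> [|j]; [exact: harmonic_harm_ext|exact: harm_ext_qpt].
Qed.

Lemma FF_harm_q i : FF (@harm_q R i). Proof. by have [[]] := harm_qP i. Qed.

(** Same corner values as [harm_q i], but concentrated on the cell i^n, where it is a rescaled copy
    of the harmonic function. Its values stay bounded uniformly in n, as dominated convergence
    requires. *)
Fixpoint tent i n : T -> R :=
  if n is m.+1 then glue (fun j => if j == i then tent i m else cst 0) else harm_ext (qval i).

Lemma tent_qpt i n j : tent i n (qpt R j) = qval i j.
Proof.
elim: n j => [|n IH] j; first exact: harm_ext_qpt.
rewrite -{1}(Fmap_fix R j) /= glueE; last exact: gasket_qpt.
  by case: eqP => [->|/eqP ji]; rewrite /= -/(tent i n) ?IH // /qval (negbTE ji).
move=> k l; rewrite -/(tent i n).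
have [ki|ki] := eqVneq k i; have [li|li] := eqVneq l i; rewrite ?ki ?li //.
  by rewrite IH /qval (negbTE li).
by rewrite IH /qval (negbTE ki).
Qed.

Lemma tentS i n j x : K x ->
  tent i n.+1 (Fmap j x) = if j == i then tent i n x else 0.
Proof.
move=> Kx; rewrite /= glueE //; first by case: eqP.
move=> k l; rewrite -/(tent i n).
have [ki|ki] := eqVneq k i; have [li|li] := eqVneq l i; rewrite ?ki ?li //.
  by rewrite tent_qpt /qval (negbTE li).
by rewrite tent_qpt /qval (negbTE ki).
Qed.

Lemma FF_tent i n : FF (tent i n).
Proof.
elim: n => [|n IH]; first exact: FF_harm_ext.
apply: FF_glue => j; have [ji|ji] := eqVneq j i.
  by apply: FF_eq IH => x Kx /=; rewrite -/(tent i n.+1) tentS // ji eqxx.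
apply: (@FF_eq R (cst 0)); last exact: FF_cst.
by move=> x Kx /=; rewrite -/(tent i n.+1) tentS // (negbTE ji).
Qed.

Lemma tent_bounded i : exists2 M, 0 <= M & forall n x, K x -> `|tent i n x| <= M.
Proof.
have [M M0 hM] := CK_bounded (@CK_harm_ext R (qval i)); exists M => //.
elim=> [|n IH] x Kx; first exact: hM.
have [j [y [Ky ->]]] := gasketE Kx; rewrite tentS //.
by case: eqP => _; [exact: IH|rewrite normr0].
Qed.

Lemma tent_out i n x : K x -> ~ cell (nseq n i) x -> tent i n x = 0.
Proof.
elim: n x => [|n IH] x Kx; first by rewrite cell_nil.
have [j [y [Ky ->]]] := gasketE Kx => nc; rewrite tentS //.
case: eqP => // ji; apply: IH => // cy; apply: nc.
by rewrite -[nseq _ _]/([:: i] ++ nseq n i) cell_cat ji; exists y.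
Qed.

(** On a finite measure space, from |g| <= 1 + g^2. *)
Lemma L2_integrable (mu : {finite_measure set T -> \bar R}) g :
  L2 mu g -> mu.-integrable K (EFin \o g).
Proof.
move=> [mg fg]; have mK : measurable K := @measurable_gasket R.
apply/integrableP; split; first exact/measurable_EFinP.
apply: le_lt_trans (_ : (\int[mu]_(x in K) ((cst 1%:E) x + ((g x) ^+ 2)%:E) < +oo)%E).
  apply: ge0_le_integral => //.
  - by apply/measurable_EFinP; apply: measurableT_comp => //; exact/measurable_EFinP.
  - by apply: emeasurable_funD => //; exact: measurable_sqr.
  move=> x Kx /=; rewrite lee_fin -(@real_normK _ (g x)) ?num_real //.
  by have := normr_ge0 (g x); move: `|g x| => t t0; nra.
rewrite ge0_integralD //.
- rewrite integral_cst // mul1e; apply: lte_add_pinfty => //.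
  by rewrite ltey_eq fin_num_measure.
- by move=> x _; rewrite lee_fin sqr_ge0.
- exact: measurable_sqr.
Qed.

(* [harm_q i - tent i n] vanishes on the three corners, and [tent i n] lives on the cell
   i^n, which shrinks to a null set. *)
Lemma FV0_orthogonal_harm_q (mu : {finite_measure set T -> \bar R}) g i :
  mu [set qpt R i] = 0%E -> L2 mu g ->
  (forall u, FV0 u -> fine (\int[mu]_(t in K) (g t * u t)%:E)%E = 0) ->
  fine (\int[mu]_(t in K) (g t * harm_q i t)%:E)%E = 0.
Proof.
move=> mu0 L2g gu; have mK : measurable K := @measurable_gasket R.
have ig := L2_integrable L2g; have [mg _] := L2g.
have igf u : CK u -> mu.-integrable K (EFin \o (fun t => g t * u t)).
  move=> cu; have [M M0 hM] := CK_bounded cu.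
  apply: (@le_integrable _ _ _ mu K mK _ (EFin \o (fun t => M * `|g t|))).
  - by apply/measurable_EFinP; apply: measurable_funM => //; exact: CK_measurable.
  - move=> x Kx /=; rewrite lee_fin normrM [leRHS]ger0_norm ?mulr_ge0 // mulrC.
    by rewrite ler_wpM2r // hM.
  - rewrite (_ : EFin \o _ = (fun t => M%:E * (abse \o (EFin \o g)) t)%E).
      by apply: integrableZl => //; exact: integrable_abse.
    by apply/funext => t.
have tent0 n : fine (\int[mu]_(t in K) (g t * harm_q i t)%:E)%E =
    fine (\int[mu]_(t in K) (g t * tent i n t)%:E)%E.
  have Fd : FV0 (fun t => harm_q i t - tent i n t).
    split; first by apply: FF_sub; [exact: FF_harm_q|exact: FF_tent].
    by move=> j; have [_ ->] := harm_qP i; rewrite tent_qpt subrr.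
  have h1 := igf _ (FF_CK (FF_harm_q i)); have h2 := igf _ (FF_CK (FF_tent i n)).
  have e := RintegralB mK h1 h2; rewrite /Rintegral in e.
  have gu0 := gu _ Fd.
  rewrite (eq_integral (fun t => (g t * harm_q i t - g t * tent i n t)%:E)) in gu0.
    by apply/eqP; rewrite -subr_eq0 -e gu0.
  by move=> t _; rewrite mulrBr.
have [M M0 hM] := tent_bounded i.
have iMg : mu.-integrable K (fun t => M%:E * (abse \o (EFin \o g)) t)%E.
  by apply: integrableZl => //; exact: integrable_abse.
have [|||||_ _ hl] := @dominated_convergence _ T R mu K mK
  (fun n t => (g t * tent i n t)%:E) (cst 0%E) (fun t => M%:E * (abse \o (EFin \o g)) t)%E.
- by move=> n; apply/measurable_EFinP; apply: measurable_funM => //;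
    apply: CK_measurable; exact: FF_CK (FF_tent i n).
- exact: measurable_cst.
- exists [set qpt R i]; split => //; first exact: measurable_set1.
  move=> x /= nx; apply: contrapT => xq; apply: nx => Kx.
  apply: cvg_near_cst.
  have := @cell_corner_eventually R i [::] x Kx xq; apply: filterS => n nc.
  by rewrite tent_out ?mulr0.
- exact: iMg.
- by apply: aeW => x n Kx /=; rewrite -EFinM lee_fin normrM mulrC ler_wpM2r // hM.
rewrite integral0 in hl.
have h0 : (fun n => fine (\int[mu]_(t in K) (g t * tent i n t)%:E)%E) @ \oo --> 0.
  exact: (@fine_cvg _ _ _ _ _ 0 hl).
have h1 : (fun n => fine (\int[mu]_(t in K) (g t * tent i n t)%:E)%E) @ \oo -->
    fine (\int[mu]_(t in K) (g t * harm_q i t)%:E)%E.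
  rewrite [X in X @ _](_ : _ = cst (fine (\int[mu]_(t in K) (g t * harm_q i t)%:E)%E)).
    exact: cvg_cst.
  by apply/funext => n; rewrite (tent0 n).
exact: (cvg_unique (@Rhausdorff R) h1 h0).
Qed.

Variable nu_ : (T -> R) -> (T -> R) -> {charge set T -> \bar R}.
Variable H : one_forms nu_.

(** The function 0 is admissible for [is_dstar], so the one chosen by [dstar] is orthogonal to
    [FV0]; [FV0_orthogonal_harm_q] then removes the integral from the normal part. *)
Lemma normal_part_V0E (mu : {finite_measure set T -> \bar R}) (X : oneform H) i :
  mu [set qpt R i] = 0%E -> (forall u, FV0 u -> form_ip X (dform H u) = 0) ->
  dom_dstar mu X /\ normal_part_V0 mu X i = form_ip X (dform H (harm_q i)).
Proof.
move=> mu0 X0.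
have d0 : is_dstar mu X (cst 0).
  split=> [|u Fu]; first exact: L2_0.
  rewrite X0 // (eq_integral (cst 0%E)) ?integral0 // => t _.
  by rewrite /= mul0r.
have dX : dom_dstar mu X by exists (cst 0).
split=> //; have [L2d dE] : is_dstar mu X (dstar mu X) by exact: getPex.
rewrite /normal_part_V0 FV0_orthogonal_harm_q ?subr0 // => u Fu.
by rewrite -dE // X0.
Qed.
End NormalPart.

(** * Asymptotics *)

Section Asymptotics.
Variable R : realType.
Implicit Types (phi a e S c t : R) (kap : nat -> R).

Definition conv phi n : R := \sum_(k < n) phi ^+ k * 5^-1 ^+ (n - k.+1).

Lemma convS phi n : conv phi n.+1 = phi ^+ n + conv phi n / 5.
Proof.
rewrite /conv big_ord_recr /= subnn expr0 mulr1 addrC; congr (_ + _).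
rewrite mulr_suml; apply: eq_bigr => k _.
by rewrite subSn // exprSr mulrA.
Qed.

Lemma convE phi n : phi != 5^-1 -> conv phi n = (phi ^+ n - 5^-1 ^+ n) / (phi - 5^-1).
Proof.
move=> ne; have d0 : phi - 5^-1 != 0 by rewrite subr_eq0.
elim: n => [|n IH]; first by rewrite /conv big_ord0 !expr0 subrr mul0r.
rewrite convS IH !exprS; apply/(mulIf d0).
by rewrite mulrDl mulrAC !divfK //; ring.
Qed.

(** Common form of both ratios: e is 1 at q_1 and -1 at q_2, while S and c stand for [sym_part h]
    and [antisym_part h]. A vanishing denominator yields 0 by convention; for nonzero S this happens
    for finitely many n at most. *)
Definition rate e a phi S c n : R :=
  3 * e * a * ((5 / 3) ^+ n * conv phi n) / (S + e * c * 3^-1 ^+ n).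

Lemma third_to0 (c : R) : c * 3^-1 ^+ n @[n --> \oo] --> (0 : R).
Proof.
rewrite -(mulr0 c); apply: cvgMr; apply: cvg_expr.
by rewrite ger0_norm // invf_lt1 // ltr1n.
Qed.

Lemma rate_den e S c : S + e * c * 3^-1 ^+ n @[n --> \oo] --> S.
Proof.
by rewrite -[X in _ --> X]addr0; apply: cvgD; [exact: cvg_cst|exact: third_to0].
Qed.

(** The recursion for [conv] is used rather than its closed form, so that phi = 1/5 is covered. *)
Lemma rate_small e a phi S c : S != 0 -> `|phi| < 3 / 5 ->
  rate e a phi S c n @[n --> \oo] --> (0 : R).
Proof.
move=> S0 hphi.
suff P0 : (5 / 3) ^+ n * conv phi n @[n --> \oo] --> (0 : R).
  rewrite [X in _ --> X](_ : _ = 3 * e * a * 0 / S); last by rewrite mulr0 mul0r.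
  by apply: cvgM; [apply: cvgMr|apply: cvgV => //; exact: rate_den].
pose U n := (5 / 3) ^+ n * conv phi n.
have US n : U n.+1 = 5 / 3 * (5 / 3 * phi) ^+ n + 3^-1 * U n.
  by rewrite /U convS exprS (@exprMn _ n (5 / 3) phi); field.
(* With t >= 1/2 the bound 10 t^n propagates: 5/3 t^n + 10/3 t^n = 5 t^n <= 10 t^(n+1). *)
have [t [t0 tphi t1]] : exists t, [/\ 2^-1 <= t, `|5 / 3 * phi| <= t & t < 1].
  exists (Num.max `|5 / 3 * phi| 2^-1); split; rewrite ?le_max ?lexx ?orbT //.
  rewrite gt_max normrM (_ : `|5 / 3| = 5 / 3); last by apply: ger0_norm; lra.
  by apply/andP; split; lra.
have bnd n : `|U n| <= 10 * t ^+ n.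
  elim: n => [|n IH]; first by rewrite /U /conv big_ord0 mulr0 normr0 expr0 mulr1.
  rewrite US; apply: le_trans (ler_normD _ _) _.
  rewrite (normrM (5 / 3) (_ ^+ n)) (normrM 3^-1) normrX.
  have -> : `|5 / 3 : R| = 5 / 3 by apply: ger0_norm; lra.
  have -> : `|3^-1 : R| = 3^-1 by apply: ger0_norm; lra.
  have h1 : `|5 / 3 * phi| ^+ n <= t ^+ n by apply: lerXn2r; rewrite ?nnegrE //; lra.
  have tn0 : 0 <= t ^+ n by rewrite exprn_ge0; lra.
  rewrite exprS; move: h1 IH tn0.
  by move: (_ ^+ n) (t ^+ n) `|U n| => p q u ? ? ?; nra.
have t_to0 : 10 * t ^+ n @[n --> \oo] --> (0 : R).
  rewrite -(mulr0 10); apply: cvgMr; apply: cvg_expr.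
  by rewrite ger0_norm //; lra.
apply/cvgrPdist_le => d d0.
have h : \forall n \near \oo, 10 * t ^+ n < d by apply: (cvgr_lt _ t_to0).
by apply: filterS h => n hn; rewrite sub0r normrN (le_trans (bnd n)) // ltW.
Qed.

(** After the power (5 phi / 3)^n is split off, the remaining factor converges, because |5 phi| >= 3
    makes (5 phi)^(-n) tend to 0. *)
Lemma rate_factor e a phi S c : S != 0 -> 3 / 5 <= `|phi| ->
  exists2 kap, kap @ \oo --> 3 * e * a / (phi - 5^-1) / S &
    forall n, rate e a phi S c n = (5 / 3 * phi) ^+ n * kap n.
Proof.
move=> S0 hphi.
have phi0 : phi != 0 by apply: contraTneq hphi => ->; rewrite normr0 -ltNge; lra.
have phi5 : phi != 5^-1.
  by apply: contraTneq hphi => ->; rewrite ger0_norm ?invr_ge0 // -ltNge; lra.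
exists (fun n => 3 * e * a / (phi - 5^-1) * (1 - (5 * phi)^-1 ^+ n) /
    (S + e * c * 3^-1 ^+ n)).
  apply: cvgM; last by apply: cvgV => //; exact: rate_den.
  rewrite -[X in _ --> X]mulr1; apply: cvgMr; rewrite -[X in _ --> X]subr0.
  apply: cvgB; first exact: cvg_cst.
  apply: cvg_expr; rewrite normrV ?unitfE ?mulf_neq0 // invf_lt1 ?normr_gt0 ?mulf_neq0 //.
  by rewrite normrM ger0_norm //; lra.
move=> n; rewrite /rate convE // [RHS]mulrA; congr (_ / _).
have e3 : (5 / 3 : R) ^+ n * 5^-1 ^+ n = 3^-1 ^+ n.
  by rewrite -exprMn; congr (_ ^+ _); field.
have e4 : (5 / 3 * phi) ^+ n * (5 * phi)^-1 ^+ n = 3^-1 ^+ n.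
  by rewrite -exprMn; congr (_ ^+ _); field.
transitivity (3 * e * a / (phi - 5^-1) * ((5 / 3) ^+ n * phi ^+ n - (5 / 3) ^+ n * 5^-1 ^+ n)).
  by ring.
by rewrite e3 -e4 -exprMn; ring.
Qed.

Lemma pow_gt1_to_pinfty t kap (k : R) : 1 < t -> 0 < k -> kap @ \oo --> k ->
  (fun n => (t ^+ n * kap n)%:E) @ \oo --> +oo%E.
Proof.
move=> t1 k0 hk; apply/cvgeyPge => A.
have h1 : \forall n \near \oo, k / 2 < kap n by apply: (cvgr_gt _ hk); lra.
have ti : `|t^-1| < 1 by rewrite ger0_norm ?invr_ge0 ?invf_lt1; lra.
have hti : t^-1 ^+ n @[n --> \oo] --> (0 : R) by exact: cvg_expr.
have B0 : 0 < k / 2 / (`|A| + 1) by rewrite divr_gt0 ?ltr_pwDr //; lra.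
have h2 : \forall n \near \oo, t^-1 ^+ n < k / 2 / (`|A| + 1) by apply: (cvgr_lt _ hti).
apply: filterS2 h1 h2 => n kn; rewrite exprVn lee_fin.
have tn0 : 0 < t ^+ n by rewrite exprn_gt0; lra.
rewrite ltr_pdivlMr ?ltr_pwDr // mulrC ltr_pdivrMr // => hA.
have := ler_norm A; have : t ^+ n * (k / 2) <= t ^+ n * kap n by rewrite ler_pM2l // ltW.
by rewrite (mulrC (t ^+ n) (k / 2)); lra.
Qed.

Lemma pow_gt1_to_infty t kap (k : R) : 1 < t -> k != 0 -> kap @ \oo --> k ->
  (fun n => (t ^+ n * kap n)%:E) @ \oo --> ((Num.sg k)%:E * +oo)%E.
Proof.
move=> t1 k0 hk; have [kn|kp|/eqP] := ltgtP k 0; last by rewrite (negbTE k0).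
  rewrite ltr0_sg // mulN1e.
  rewrite (_ : (fun n => _) = (fun n => - (t ^+ n * (- kap n))%:E)%E); last first.
    by apply/funext => n; rewrite mulrN EFinN oppeK.
  apply: cvgeN; apply: (@pow_gt1_to_pinfty _ _ (- k)) => //; first by lra.
  exact: cvgN.
by rewrite gtr0_sg // mul1e; exact: pow_gt1_to_pinfty hk.
Qed.

(** The product of consecutive terms is eventually at most -k^2 / 2. A finite limit would have a
    negative square, and an infinite one would make consecutive terms agree in sign. *)
Lemma pow_leN1_diverges t kap (k : R) : t <= -1 -> k != 0 -> kap @ \oo --> k ->
  ~ exists l : \bar R, (fun n => (t ^+ n * kap n)%:E) @ \oo --> l.
Proof.
move=> t1 k0 hk [l hl]; pose u n := t ^+ n * kap n.
have k2 : 0 < k ^+ 2 by rewrite exprn_even_gt0.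
have hkk : (fun n => kap n * kap n.+1) @ \oo --> k ^+ 2.
  by rewrite expr2; apply: cvgM => //; rewrite (cvg_shiftS kap).
have neg : \forall n \near \oo, u n * u n.+1 <= - (k ^+ 2 / 2).
  have h : \forall n \near \oo, k ^+ 2 / 2 < kap n * kap n.+1.
    by apply: (cvgr_gt _ hkk); lra.
  apply: filterS h => n hn.
  rewrite (_ : u n * u n.+1 = t * (t ^+ 2) ^+ n * (kap n * kap n.+1)); last first.
    by rewrite /u -exprM mulnC exprM exprS; ring.
  have p1 : 1 <= (t ^+ 2) ^+ n by rewrite exprn_ege1 //; nra.
  have tp : t * (t ^+ 2) ^+ n <= -1 by nra.
  by nra.
have hl1 : (fun n => (u n.+1)%:E) @ \oo --> l by rewrite (cvg_shiftS (fun n => (u n)%:E)).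
have absurd : (\forall n \near \oo, 0 <= u n * u n.+1) -> False.
  move=> pos; have [n [n1 n2]] : exists n, u n * u n.+1 <= - (k ^+ 2 / 2) /\ 0 <= u n * u n.+1.
    by apply: (@filter_ex _ \oo); apply: filterS2 neg pos.
  by lra.
case: l hl hl1 => [b||] hl hl1.
- have /fine_cvgP[_ cu] := hl; have /fine_cvgP[_ cu1] := hl1.
  have cuu : (fun n => u n * u n.+1) @ \oo --> b * b by exact: cvgM cu cu1.
  have bb : b * b <= - (k ^+ 2 / 2) by apply: (cvgr_to_le cuu).
  by have := sqr_ge0 b; rewrite (expr2 b); lra.
- apply: absurd; move: hl hl1 => /cvgeyPge/(_ 0) h1 /cvgeyPge/(_ 0) h2.
  by apply: filterS2 h1 h2 => n; rewrite !lee_fin => *; exact: mulr_ge0.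
- apply: absurd; move: hl hl1 => /cvgeNyPle/(_ 0) h1 /cvgeNyPle/(_ 0) h2.
  by apply: filterS2 h1 h2 => n; rewrite !lee_fin => *; exact: mulr_le0.
Qed.
End Asymptotics.

(** * Geometric coefficients *)

Section GeometricForm.
Variable R : realType.
Local Notation T := (R * R)%type.
Local Notation word := (seq 'I_3).
Variable nu_ : (T -> R) -> (T -> R) -> {charge set T -> \bar R}.
Hypothesis nuE : energy_measures nu_.
Variable H : one_forms nu_.
Local Notation form := (oneform H).
Variables (c : word -> R) (a phi : R).
Hypothesis a_gt0 : 0 < a.
Hypothesis phi_bound : - Num.sqrt (3 / 5) < phi < Num.sqrt (3 / 5).
Hypothesis c_neq0 : forall w, c w <> 0 <-> exists k, w = nseq k 0.
Hypothesis c_geom : forall k, c (nseq k 0) = a * phi ^+ k.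

Lemma geometric_out w : (forall k, w <> nseq k 0) -> c w = 0.
Proof.
by move=> nw; apply: contrapT => /c_neq0 [k wk]; exact: (nw k).
Qed.

(** Ratio of the norm bounds for consecutive terms: |phi| from the coefficients, sqrt(5/3) from the
    loop forms. It is below 1 by [phi_bound]. *)
Let q := `|phi| * Num.sqrt (5 / 3).

Let q01 : 0 <= q < 1.
Proof.
rewrite mulr_ge0 ?sqrtr_ge0 //= -(@ltr_pXn2r _ 2) ?nnegrE ?mulr_ge0 ?sqrtr_ge0 //.
rewrite exprMn sqr_sqrtr; last by lra.
have : `|phi| ^+ 2 < Num.sqrt (3 / 5) ^+ 2.
  by rewrite ltr_pXn2r ?nnegrE ?sqrtr_ge0 // ltr_norml.
by rewrite sqr_sqrtr ?expr1n; lra.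
Qed.

Let scaled_norm (X : form) k : `|X| ^+ 2 <= 30 * (5 / 3) ^+ k ->
  `|(a * phi ^+ k) *: X| <= a * Num.sqrt 30 * q ^+ k.
Proof.
move=> hX; rewrite normrZ normrM (gtr0_norm a_gt0) normrX -!mulrA ler_pM2l //.
rewrite /q exprMn mulrCA ler_wpM2l ?exprn_ge0 //.
rewrite -(@ler_pXn2r _ 2) ?nnegrE ?mulr_ge0 ?exprn_ge0 ?sqrtr_ge0 //.
rewrite exprMn sqr_sqrtr // -exprM mulnC exprM sqr_sqrtr //; lra.
Qed.

(** Terms with k >= n are again loop forms and pair to zero with exact forms; the n others are
    exact, so partial sums of the pairing are constant from n on. *)
Lemma usum_comp_psi n : exists2 S : form,
  usum (fun w => c w *: dform_n H ((size w).+1 - n)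
     (family_comp (size w).+1 (psi_word w) (nseq n 0))) S &
  forall f, FF f -> form_ip S (dform H f) =
    3 * a * conv phi n * (f (qpt R 1) - f (qpt R 2)).
Proof.
pose F w : form := c w *: dform_n H ((size w).+1 - n)
     (family_comp (size w).+1 (psi_word w) (nseq n 0)).
have FE k : F (nseq k 0) = (a * phi ^+ k) *: comp_psi H n k.
  by rewrite /F c_geom size_nseq.
have [|||S FS lS] := @usum_nseq R form F (a * Num.sqrt 30) q q01.
- by rewrite mulr_ge0 ?sqrtr_ge0 ?ltW.
- by move=> w /geometric_out; rewrite /F => ->; rewrite scale0r.
- by move=> k; rewrite FE; apply: scaled_norm; exact: comp_psi_norm.
exists S => // f Ff.
have l1 : (fun N => form_ip (\sum_(k < N) F (nseq k 0)) (dform H f)) @ \oo -->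
    form_ip S (dform H f) by apply: ip_cvgl.
suff l2 : (fun N => form_ip (\sum_(k < N) F (nseq k 0)) (dform H f)) @ \oo -->
    3 * a * conv phi n * (f (qpt R 1) - f (qpt R 2)).
  exact: (cvg_unique (@Rhausdorff R) l1 l2).
apply: cvg_near_cst; exists n => // N /= nN.
have z : \sum_(k < N - n) form_ip (F (nseq (n + k) 0)) (dform H f) = 0.
  apply: big1 => k _; rewrite FE comp_psi_ge ?leq_addr // ipZl.
  by rewrite (ip_dpsi_dform nuE) ?mulr0.
rewrite -(subnKC nN) big_split_ord /= ipDl !ip_suml z addr0.
rewrite /conv mulr_sumr mulr_suml; apply: eq_bigr => k _ /=.
rewrite FE comp_psi_lt // ipZl ip_dform //; last exact: FF_antisym.
by rewrite energy_antisym; ring.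
Qed.

Lemma usum_psi : exists S : form, usum (fun w => c w *: dpsi H w) S.
Proof.
have [|||S FS _] := @usum_nseq R form (fun w => c w *: dpsi H w) (a * Num.sqrt 30) q q01.
- by rewrite mulr_ge0 ?sqrtr_ge0 ?ltW.
- by move=> w /geometric_out ->; rewrite scale0r.
- move=> k; rewrite c_geom; apply: scaled_norm.
  by rewrite -[k in dpsi _ (nseq k _)]subn0 -comp_psi_ge //; exact: comp_psi_norm.
by exists S.
Qed.

(** Z is its own part in the kernel, so its composition is witnessed with eta = 0 and is the
    composed series alone. *)
Lemma form_comp_geometric (Z : form) n : ker_dstar Z ->
  usum (fun w => c w *: dpsi H w) Z -> forall f, FF f ->
  form_ip (form_comp Z (nseq n 0)) (dform H f) =
    3 * a * conv phi n * (f (qpt R 1) - f (qpt R 2)).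
Proof.
move=> kZ sZ f Ff; have [S sS ip] := usum_comp_psi n.
rewrite (form_compE nuE (Y := S)); first exact: ip.
have d0 w : dform H (cst 0 \o @Fw R w) = 0.
  apply: form_eq0; rewrite ip_dform //; try exact: FF_cst.
  exact: energy_cstl.
exists (cst 0), Z, c, S; split => //.
- by split=> //; exact: FF_cst.
- by rewrite -[dform H (cst 0)]/(dform H (cst 0 \o @Fw R [::])) d0 add0r.
- by rewrite size_nseq.
- by rewrite d0 add0r.
Qed.

End GeometricForm.

(** * Normal parts of exact harmonic forms along the cells 0^n *)

Section NormalParts.
Variable R : realType.
Local Notation T := (R * R)%type.
Local Notation word := (seq 'I_3).
Local Notation r := (@rfac R).
Variable nu_ : (T -> R) -> (T -> R) -> {charge set T -> \bar R}.
Hypothesis nuE : energy_measures nu_.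
Variable H : one_forms nu_.
Local Notation form := (oneform H).
Variable nu : {finite_measure set T -> \bar R}.
Hypothesis nu_nonatomic : nonatomic nu.
Implicit Types (X : form) (i : 'I_3) (w : word).

Lemma normal_partE X w i :
  (forall u, FV0 u -> form_ip (form_comp X w) (dform H u) = 0) ->
  has_normal_part nu X w /\
  normal_part nu X w i = r ^- size w * form_ip (form_comp X w) (dform H (harm_q i)).
Proof.
move=> X0; have mu0 : cell_measure nu w [set qpt R i] = 0%E.
  by rewrite /cell_measure /= /pullback image_set1 nu_nonatomic.
have [dX nE] := normal_part_V0E mu0 X0.
by split=> //; rewrite /normal_part nE.
Qed.

Lemma harmonic_comp_energy h n f : is_harmonic h ->
  energy (h \o Fw (nseq n 0)) f = energy (harm_ext (h \o @qpt R) \o Fw (nseq n 0)) f.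
Proof.
move=> hh; apply: energy_eq => // x Kx /=.
by apply: harmonicE => //; exact: gasket_Fw.
Qed.

(** The coefficient of the boundary values of h along (0, 1, 1). [antisym_part] is three times the
    one along (0, 1, -1), with the factor 3 of [energy_antisym]. *)
Definition sym_part (h : T -> R) : R := (h (qpt R 1) + h (qpt R 2)) / 2 - h (qpt R 0).
Definition antisym_part (h : T -> R) : R := 3 / 2 * (h (qpt R 1) - h (qpt R 2)).

(** The scaling (5/3)^n cancels the eigenvalue 3/5 and turns 1/5 into 1/3, so the antisymmetric part
    of h dies out along the cells. *)
Lemma normal_part_harmonic h n i : is_harmonic h ->
  has_normal_part nu (dform H h) (nseq n 0) /\
  normal_part nu (dform H h) (nseq n 0) i =
    sym_part h * (qval R i 1 + qval R i 2 - 2 * qval R i 0)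
    + antisym_part h * 3^-1 ^+ n * (qval R i 1 - qval R i 2).
Proof.
move=> hh; have [Fh _] := hh.
have ipE f : FF f -> form_ip (form_comp (dform H h) (nseq n 0)) (dform H f) =
    energy (harm_ext (h \o @qpt R) \o Fw (nseq n 0)) f.
  move=> Ff; rewrite form_comp_dform // ip_dform //; last exact: FF_Fw.
  exact: harmonic_comp_energy.
have [|hn ->] := @normal_partE (dform H h) (nseq n 0) i.
  move=> u [Fu u0]; rewrite ipE // energy_harm_ext_iter !u0; ring.
split=> //; rewrite ipE ?energy_harm_ext_iter; last exact: FF_harm_q.
have [_ qE] := @harm_qP R i.
rewrite !qE size_nseq /rfac /sym_part /antisym_part /=.
have e1 : (3 / 5 : R) ^- n * (3 / 5) ^+ n = 1.
  by rewrite mulVf // expf_neq0 // divf_neq0.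
have e2 : (3 / 5 : R) ^- n * 5^-1 ^+ n = 3^-1 ^+ n.
  by rewrite -exprVn -exprMn; congr (_ ^+ _); field.
by rewrite mulrDr !mulrA e1 e2; ring.
Qed.

(** The antisymmetric values cancel between the two neighbours of q_0 and the symmetric ones scale
    exactly by r^n, so the defining sequence is constant. *)
Lemma normal_derivative_harmonic h : is_harmonic h ->
  normal_derivative h 0 = - 2 * sym_part h.
Proof.
move=> hh; apply/cvg_lim => //.
rewrite (_ : (fun n => _) = cst (- 2 * sym_part h)); first exact: cvg_cst.
apply/funext => n /=.
have e (k l : 'I_3) : val k = val l -> k = l by exact: val_inj.
rewrite (e (0 + 1) 1) // (e (0 + 2) 2) //.
rewrite !(harmonicE hh (gasket_Fw _ (gasket_qpt _ _))) !harm_ext_iter; try exact: gasket_qpt.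
rewrite !harm_ext_qpt iter_harm_rule0 /sym_part /=.
have n0 : (3 / 5 : R) ^+ n != 0 by rewrite expf_neq0 // divf_neq0.
by rewrite /rfac; field.
Qed.

End NormalParts.

(** * Limits of the ratios of normal parts *)

Theorem proposition10p2 (R : realType)
  (nu_ : (R * R -> R) -> (R * R -> R) -> {charge set (R * R)%type -> \bar R})
  (nu_energy : energy_measures nu_)
  (H : one_forms nu_)
  (nu : {finite_measure set (R * R)%type -> \bar R})
  (nu_K : measure_on_K nu) (nu_nonatomic : nonatomic nu) (nu_full : full_support nu)
  (h : R * R -> R) (h_harmonic : is_harmonic h) (h_nonconstant : nonconstant h)
  (h_q0 : normal_derivative h 0 <> 0)
  (star : oneform H -> R * R -> R) (star_h : hodge_star h star)
  (Phi : R * R -> R) (Phi_ker : ker_d_perp H h Phi)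
  (c : seq 'I_3 -> R)
  (Phi_sum : usumL2 nu_ h (fun w t => c w * star (dpsi H w) t) Phi)
  (c_neq0 : forall w, c w <> 0 <-> exists k, w = nseq k 0)
  (a phi : R) (a_gt0 : 0 < a)
  (phi_bound : - Num.sqrt (3 / 5) < phi < Num.sqrt (3 / 5))
  (c_geom : forall k, c (nseq k 0) = a * phi ^+ k) :
  let omega := L2mul H Phi h in
  let rho (i : 'I_3) (n : nat) : \bar R :=
    (normal_part nu omega (nseq n 0) i / normal_part nu (dform H h) (nseq n 0) i)%:E in
  let s := a / normal_derivative h 0 in
  [/\ forall n, has_normal_part nu omega (nseq n 0) /\
                has_normal_part nu (dform H h) (nseq n 0),
      [/\ phi <= - (3 / 5) -> ~ (exists l : \bar R, rho 1 @ \oo --> l),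
          `|phi| < 3 / 5 -> rho 1 @ \oo --> 0%E,
          phi = 3 / 5 -> rho 1 @ \oo --> (- 15 * s)%:E
        & 3 / 5 < phi -> rho 1 @ \oo --> ((- Num.sg s)%:E * +oo)%E]
    & [/\ phi <= - (3 / 5) -> ~ (exists l : \bar R, rho 2 @ \oo --> l),
          `|phi| < 3 / 5 -> rho 2 @ \oo --> 0%E,
          phi = 3 / 5 -> rho 2 @ \oo --> (15 * s)%:E
        & 3 / 5 < phi -> rho 2 @ \oo --> ((Num.sg s)%:E * +oo)%E]].
Proof.
move=> omega rho s.
have [Fh _] := h_harmonic; have [L2Phi kOmega] := Phi_ker.
have [S sS] := usum_psi nu_energy H a_gt0 phi_bound c_neq0 c_geom.
(* The L^2 expansion of Phi carries over to one-forms: the sum S of the loop forms is also a product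
   of Phi with dh, and such a product is unique. *)
have omegaE : omega = S.
  have mS : is_L2mul Phi h S.
    by apply: (is_L2mul_usum Fh _ L2Phi Phi_sum sS) => w; have [] := star_h.
  by apply: (is_L2mul_unique Fh _ mS); apply: getPex; exists S.
have ipo n f : FF f -> form_ip (form_comp omega (nseq n 0)) (dform H f) =
    3 * a * conv phi n * (f (qpt R 1) - f (qpt R 2)).
  apply: (form_comp_geometric nu_energy a_gt0 phi_bound c_neq0 c_geom) => //.
  by rewrite omegaE.
have npo n i : has_normal_part nu omega (nseq n 0) /\ normal_part nu omega (nseq n 0) i =
    3 * a * ((5 / 3) ^+ n * conv phi n) * (qval R i 1 - qval R i 2).
  have [|ho ->] := @normal_partE R nu_ H nu nu_nonatomic omega (nseq n 0) i.
    by move=> u [Fu u0]; rewrite ipo // !u0 subrr mulr0.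
  split=> //; rewrite ipo; last exact: FF_harm_q.
  have [_ qE] := @harm_qP R i; rewrite !qE size_nseq /rfac -exprVn invf_div.
  by ring.
have nph n i := normal_part_harmonic nu_energy H nu_nonatomic n i h_harmonic.
have Dh := normal_derivative_harmonic h_harmonic.
(* The limit of the denominators; this is where the assumption on the normal derivative at q_0
   enters. *)
have S0 : sym_part h != 0 by apply: contra_notN h_q0 => /eqP e; rewrite Dh e mulr0.
have rhoE e i n : qval R i 1 - qval R i 2 = e -> qval R i 1 + qval R i 2 - 2 * qval R i 0 = 1 ->
    rho i n = (rate e a phi (sym_part h) (antisym_part h) n)%:E.
  move=> e1 e2; rewrite /rho (npo n i).2 (nph n i).2 e1 e2 /rate; congr (_ / _)%:E; ring.
have rho1 : rho 1 = fun n => (rate 1 a phi (sym_part h) (antisym_part h) n)%:E.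
  by apply/funext => n; apply: rhoE; rewrite /qval /=; ring.
have rho2 : rho 2 = fun n => (rate (-1) a phi (sym_part h) (antisym_part h) n)%:E.
  by apply/funext => n; apply: rhoE; rewrite /qval /=; ring.
(* 6 = 3 * 2: the 3 is that of the numerator, and the 2 comes from [sym_part h] being -1/2 times the
   normal derivative. *)
have kE e : 3 * e * a / (phi - 5^-1) / sym_part h = 6 / (phi - 5^-1) * (- e * s).
  by rewrite /s Dh; move: (phi - 5^-1)^-1 => X; field.
have s0 : s != 0 by apply: mulf_neq0; [rewrite gt_eqF|rewrite invr_eq0; exact/eqP].
pose u e n := (rate e a phi (sym_part h) (antisym_part h) n)%:E.
have uE e : 3 / 5 <= `|phi| -> exists2 kap, kap @ \oo --> 6 / (phi - 5^-1) * (- e * s) &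
    u e = fun n => ((5 / 3 * phi) ^+ n * kap n)%:E.
  move=> hphi; have [kap hk uk] := rate_factor e a (antisym_part h) S0 hphi.
  by exists kap; [rewrite -kE|apply/funext => n; rewrite /u uk].
have div_case e : e != 0 -> phi <= - (3 / 5) -> ~ (exists l : \bar R, u e @ \oo --> l).
  move=> e0 hphi; have [|kap hk ->] := uE e; first by rewrite ler0_norm; lra.
  apply: pow_leN1_diverges hk; first by lra.
  have k0 : (phi - 5^-1)^-1 != 0 by rewrite invr_eq0 lt_eqF //; lra.
  by apply: mulf_neq0; apply: mulf_neq0; rewrite ?oppr_eq0.
have zero_case e : `|phi| < 3 / 5 -> u e @ \oo --> 0%E.
  by move=> hphi; apply: cvg_EFin; [exact: nearW|exact: rate_small].
have finite_case e : phi = 3 / 5 -> u e @ \oo --> (- 15 * e * s)%:E.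
  move=> hphi; have [|kap hk ->] := uE e; first by rewrite ger0_norm; lra.
  apply: cvg_EFin; first exact: nearW.
  (* At phi = 3/5 the factor 6 / (phi - 1/5) equals 15, and the power (5 phi / 3)^n is 1. *)
  rewrite (_ : - 15 * e * s = 6 / (phi - 5^-1) * (- e * s)); last first.
    by rewrite hphi; field.
  rewrite (_ : _ \o _ = kap) //; apply/funext => n /=.
  by rewrite hphi (_ : 5 / 3 * (3 / 5) = 1) ?expr1n ?mul1r //; field.
have infinite_case e : e != 0 -> 3 / 5 < phi -> u e @ \oo --> ((Num.sg (- e * s))%:E * +oo)%E.
  move=> e0 hphi; have [|kap hk ->] := uE e; first by rewrite ger0_norm; lra.
  have p0 : 0 < 6 / (phi - 5^-1) by rewrite divr_gt0 //; lra.
  rewrite (_ : Num.sg (- e * s) = Num.sg (6 / (phi - 5^-1) * (- e * s))); last first.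
    by rewrite [RHS]sgrM (gtr0_sg p0) mul1r.
  apply: pow_gt1_to_infty hk; first by lra.
  by apply: mulf_neq0; [rewrite gt_eqF|apply: mulf_neq0; rewrite ?oppr_eq0].
have n1 : (-1 : R) != 0 by rewrite oppr_eq0 oner_eq0.
split; first by move=> n; split; [have [] := npo n 0|have [] := nph n 0].
  rewrite rho1 -/(u 1); split.
  - by apply: div_case; exact: oner_neq0.
  - exact: zero_case.
  - by move=> /(finite_case 1); rewrite mulr1.
  - by move=> /(infinite_case 1 (oner_neq0 _)); rewrite mulN1r sgrN.
rewrite rho2 -/(u (-1)); split.
- exact: div_case.
- exact: zero_case.
- by move=> /(finite_case (-1)); rewrite mulrNN mulr1.
- by move=> /(infinite_case (-1) n1); rewrite opprK mul1r.
Qed.
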